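(* Consider the hybrid extremum seeking system $\mathcal{H}_\varepsilon$ under intermittence and spoofing defined in the context, with frequencies $w_1,\dots,w_r\in\mathbb{Q}_{>0}$ satisfying $w_i\ne w_j$ for $i\ne j$. Let $P(x)=\frac1{T_1}\sum_{i=1}^r\int_0^{T_1}b_i(x,\tau_1)\,b_i(x,\tau_1)^\top\,d\tau_1$ and suppose that: (1) there exist $\lambda_P>0$ and $M_P>0$ such that $|P(x)v|\le M_P|v|$ and $v^\top P(x)v\ge\lambda_P|v|^2$ for all $x,v\in\mathbb{R}^n$; (2) $J:\mathbb{R}^n\to\mathbb{R}$ is $\mathcal{C}^1$, strongly convex with strong-convexity parameter $\mu>0$ and minimizer $x^\star$, and there exists $L_J>0$ such that $|\nabla J(x)-\nabla J(x')|\le L_J|x-x'|$ for all $x,x'\in\mathbb{R}^n$. Then, for each $\eta_1>0$ there exists $\eta_2^*\in(0,1]$ such that for all $\eta_2\in(0,\eta_2^* )$ the system $\mathcal{H}_\varepsilon$ renders the set $\mathcal{A}=\{x^\star\}\times C_z$ semi-globally practically asymptotically stable (SGPAS) as $\varepsilon\to0^+$.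
   Context: **Hybrid systems.** A hybrid dynamical system (HDS) with data $(C,F,D,G)$ is written $y\in C,\ \dot y\in F(y)$; $y\in D,\ y^+\in G(y)$, with $F,G$ set-valued. A compact hybrid time domain is a set $E=\bigcup_{j=0}^{J-1}([t_j,t_{j+1}],j)\subset\mathbb{R}_{\ge0}\times\mathbb{Z}_{\ge0}$ for a finite sequence $0=t_0\le t_1\le\dots\le t_J$; $E$ is a hybrid time domain if $E\cap([0,T]\times\{0,\dots,J\})$ is a compact hybrid time domain for all $(T,J)\in E$. A solution is a function $y$ on a hybrid time domain $\mathrm{dom}(y)$, with $y(\cdot,j)$ locally absolutely continuous for each $j$ for which $I_j=\{t:(t,j)\in\mathrm{dom}(y)\}$ has nonempty interior, such that $y(0,0)\in C\cup D$; for each such $j$, $y(t,j)\in C$ for all $t\in I_j$ and $\dot y(t,j)\in F(y(t,j))$ for almost all $t\in I_j$; and whenever $(t,j),(t,j+1)\in\mathrm{dom}(y)$, $y(t,j)\in D$ and $y(t,j+1)\in G(y(t,j))$. **The hybrid system $\mathcal{H}_\varepsilon$.** Let $r\ge1$, $\kappa>0$, $\mathcal{Q}=\{1,2,3\}$, $\mathcal{Q}_s=\{3\}$ (stable, nominal mode), $\mathcal{Q}_u=\{1,2\}$ (unstable modes), $\mathbb{I}_{\mathcal{Q}_u}$ the indicator function of $\mathcal{Q}_u$, $\eta_1>0$, $\eta_2\in[0,1)$, $N_\circ\ge1$, $T_\circ>0$, and $C_z=\mathcal{Q}\times[0,N_\circ]\times[0,T_\circ]$, $D_z=\mathcal{Q}\times[1,N_\circ]\times[0,T_\circ]$.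 The functions $b_i:\mathbb{R}^n\times\mathbb{R}_{\ge0}\to\mathbb{R}^n$, $i=1,\dots,r$, are of class $\mathcal{C}^1$ in $(x,\tau_1)$ and $T_1$-periodic in $\tau_1$ for some $T_1>0$ (''of class $\mathcal{C}^k$'' means that the $k$th derivative is locally Lipschitz continuous). The state is $(x,z,\tau)$ with $x\in\mathbb{R}^n$, $z=(z_1,z_2,z_3)$, $\tau=(\tau_1,\tau_2)\in\mathbb{R}^2_{\ge0}$. For $(x,z)\in\mathbb{R}^n\times C_z$ the flow is $$\dot x=\sum_{i=1}^rb_i(x,\tau_1)u_{i,z_1}(x,\tau_2),\qquad u_{i,z_1}(x,\tau_2)=\varepsilon^{-1}\sqrt{2w_i}\cos\big(w_i\tau_2+\kappa(z_1-2)J(x)\big)\kappa^{-1/2},$$ $$\dot z\in\{0\}\times[0,\eta_1]\times\big([0,\eta_2]-\mathbb{I}_{\mathcal{Q}_u}(z_1)\big),\qquad\dot\tau_1=\varepsilon^{-1},\quad\dot\tau_2=\varepsilon^{-2}.$$ For $(x,z)\in\mathbb{R}^n\times D_z$ the jump is $x^+=x$, $z^+\in(\mathcal{Q}\setminus\{z_1\})\times\{z_2-1\}\times\{z_3\}$, $\tau^+=\tau$. Write $\theta=(x,z)$. **Stability notions.** $|y|_{\mathcal{A}}=\min_{a\in\mathcal{A}}\|y-a\|_2$. $\beta:\mathbb{R}_{\ge0}\times\mathbb{R}_{\ge0}\to\mathbb{R}_{\ge0}$ is of class $\mathcal{KL}$ if it is nondecreasing in its first argument, nonincreasing in its second, $\lim_{r\to0^+}\beta(r,s)=0$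 for each $s$ and $\lim_{s\to\infty}\beta(r,s)=0$ for each $r$. $\mathcal{A}$ is SGPAS as $\varepsilon\to0^+$ for $\mathcal{H}_\varepsilon$ (basin of attraction the whole space) if there is $\beta\in\mathcal{KL}$ such that for each compact set $K\subset\mathbb{R}^n\times\mathbb{R}^3$ and each $\nu>0$ there is $\varepsilon^*>0$ such that for all $\varepsilon\in(0,\varepsilon^*]$ every solution with $\theta(0,0)\in K$ satisfies $|\theta(t,j)|_{\mathcal{A}}\le\beta(|\theta(0,0)|_{\mathcal{A}},t+j)+\nu$ for all $(t,j)$ in its domain. *)

(* Defs.v *)
(* MathComp / MathComp-Analysis. *)
From HB Require Import structures.
From mathcomp Require Export all_boot all_order all_algebra.
From mathcomp Require Export all_classical all_reals all_analysis.

Set Implicit Arguments.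
Unset Strict Implicit.
Unset Printing Implicit Defensive.

Import Order.TTheory GRing.Theory Num.Theory.
Import numFieldNormedType.Exports.

Local Open Scope classical_set_scope.
Local Open Scope ring_scope.

(* The norm `|x| that the library puts on matrices and on products is the sup
   norm; the Euclidean norms are therefore defined separately. *)
Definition norm2 (R : realType) (n : nat) (x : 'cV[R]_n) : R :=
  Num.sqrt (\sum_(i < n) x i 0 ^+ 2).

(* "Class C^1" means that the first derivative is locally Lipschitz continuous.
   On a set S that is not open (here R^n x [0, oo)), the derivative is the
   Frechet derivative relative to S. *)
Definition deriv_within (R : realType) (V W : normedModType R)
    (S : set V) (f : V -> W) (p : V) (L : {linear V -> W}) : Prop :=
  continuous L /\
  forall e : R, 0 < e ->
    \forall q \near p, S q -> `|f q - f p - L (q - p)| <= e * `|q - p|.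

Definition class_C1 (R : realType) (V W : normedModType R)
    (S : set V) (f : V -> W) : Prop :=
  exists Df : V -> {linear V -> W},
    (forall p, S p -> deriv_within S f p (Df p)) /\
    (forall p, S p -> exists (U : set V) (k : R), nbhs p U /\
       forall q q', U q -> S q -> U q' -> S q' ->
         forall v, `|Df q v - Df q' v| <= k * `|q - q'| * `|v|).

Definition grad (R : realType) (n : nat) (J : 'cV[R]_n -> R) (x : 'cV[R]_n) :
    'cV[R]_n :=
  \col_(i < n) 'D_(delta_mx i 0) J x.

Definition strongly_convex (R : realType) (n : nat) (mu : R)
    (J : 'cV[R]_n -> R) : Prop :=
  forall (x y : 'cV[R]_n) (s : R), 0 <= s <= 1 ->
    J (s *: x + (1 - s) *: y) <=
    s * J x + (1 - s) * J y - mu / 2 * s * (1 - s) * norm2 (x - y) ^+ 2.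

Definition absolutely_continuous (R : realType) (V : normedModType R)
    (a b : R) (f : R -> V) : Prop :=
  forall e : R, 0 < e -> exists2 d : R, 0 < d &
    forall (m : nat) (s t : 'I_m -> R),
      (forall i, a <= s i /\ s i <= t i /\ t i <= b) ->
      trivIset setT (fun i => `]s i, t i[%classic) ->
      \sum_(i < m) (t i - s i) < d ->
      \sum_(i < m) `|f (t i) - f (s i)| < e.

Definition locally_absolutely_continuous (R : realType) (V : normedModType R)
    (I : set R) (f : R -> V) : Prop :=
  forall a b : R, a <= b -> `[a, b] `<=` I -> absolutely_continuous a b f.

Record hybrid_system (V : Type) := HybridSystem {
  flow_set : set V;
  flow_map : V -> set V;
  jump_set : set V;
  jump_map : V -> set V }.

Definition compact_hybrid_time_domain (R : realType) (E : set (R * nat)) : Prop :=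
  exists (J : nat) (t : nat -> R),
    t 0%N = 0 /\ (forall j, (j < J)%N -> t j <= t j.+1) /\
    E = \bigcup_(j in [set j | (j < J)%N]) (`[t j, t j.+1] `*` [set j]).

Definition hybrid_time_domain (R : realType) (E : set (R * nat)) : Prop :=
  E `<=` [set p | 0 <= p.1] /\
  forall (T : R) (J : nat), E (T, J) ->
    compact_hybrid_time_domain
      (E `&` (`[0, T] `*` [set j | (j <= J)%N])).

Definition time_slice (R : realType) (E : set (R * nat)) (j : nat) : set R :=
  [set t | E (t, j)].

(* A hybrid arc is a total function y together with its domain E; the values
   of y outside of E are irrelevant.  E contains (0, 0) as soon as it is
   nonempty; requiring it discards the empty arc. *)
Definition hybrid_solution (R : realType) (V : normedModType R)
    (H : hybrid_system V) (E : set (R * nat)) (y : R -> nat -> V) : Prop :=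
  hybrid_time_domain E /\
  E (0, 0%N) /\
  (flow_set H `|` jump_set H) (y 0 0%N) /\
  (forall j, (time_slice E j)° !=set0 ->
     locally_absolutely_continuous (time_slice E j) (y ^~ j) /\
     (forall t, time_slice E j t -> flow_set H (y t j)) /\
     {ae (@lebesgue_measure R), forall t, time_slice E j t ->
        exists2 v : V, is_derive t (1 : R) (y ^~ j) v & flow_map H (y t j) v}) /\
  (forall t j, E (t, j) -> E (t, j.+1) ->
     jump_set H (y t j) /\ jump_map H (y t j) (y t j.+1)).

(* z = (z_1, z_2, z_3) is ((z_1, z_2), z_3); theta = (x, z); the state is
   ((x, z), tau) with tau = (tau_1, tau_2). *)
Notation zspace R := (R * R * R)%type.
Notation theta_space R n := ('cV[R]_n * zspace R)%type.
Notation state_space R n := (theta_space R n * (R * R))%type.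

Definition theta_norm2 (R : realType) (n : nat) (th : theta_space R n) : R :=
  Num.sqrt (norm2 th.1 ^+ 2
            + th.2.1.1 ^+ 2 + th.2.1.2 ^+ 2 + th.2.2 ^+ 2).

(* The infimum is a minimum for the compact nonempty sets considered. *)
Definition theta_dist (R : realType) (n : nat) (A : set (theta_space R n))
    (th : theta_space R n) : R :=
  inf [set theta_norm2 (th - a) | a in A].

(* Only the values of beta on [0, oo) x [0, oo) matter. *)
Definition class_KL (R : realType) (beta : R -> R -> R) : Prop :=
  (forall r s, 0 <= r -> 0 <= s -> 0 <= beta r s) /\
  (forall r r' s, 0 <= r -> r <= r' -> 0 <= s -> beta r s <= beta r' s) /\
  (forall r s s', 0 <= r -> 0 <= s -> s <= s' -> beta r s' <= beta r s) /\
  (forall s, 0 <= s -> beta r s @[r --> 0^'+] --> 0) /\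
  (forall r, 0 <= r -> beta r s @[s --> +oo] --> 0).

Definition SGPAS (R : realType) (n : nat)
    (H : R -> hybrid_system (state_space R n)) (A : set (theta_space R n)) :
    Prop :=
  exists2 beta : R -> R -> R, class_KL beta &
    forall (K : set (theta_space R n)) (nu : R), compact K -> 0 < nu ->
      exists2 eps_star : R, 0 < eps_star &
        forall eps : R, 0 < eps -> eps <= eps_star ->
          forall (E : set (R * nat)) (y : R -> nat -> state_space R n),
            hybrid_solution (H eps) E y -> K (y 0 0%N).1 ->
            forall t j, E (t, j) ->
              theta_dist A (y t j).1
                <= beta (theta_dist A (y 0 0%N).1) (t + j%:R) + nu.

Definition modes (R : realType) : set R := [set q | q \in [:: 1; 2; 3]].
Definition unstable_modes (R : realType) : set R := [set q | q \in [:: 1; 2]].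

Arguments modes : clear implicits.
Arguments unstable_modes : clear implicits.

Definition C_z (R : realType) (N0 T0 : R) : set (zspace R) :=
  modes R `*` `[0, N0] `*` `[0, T0].
Definition D_z (R : realType) (N0 T0 : R) : set (zspace R) :=
  modes R `*` `[1, N0] `*` `[0, T0].

Definition es_input (R : realType) (n : nat) (kappa : R) (J : 'cV[R]_n -> R)
    (eps w z1 : R) (x : 'cV[R]_n) (tau2 : R) : R :=
  eps^-1 * Num.sqrt (2 * w) * cos (w * tau2 + kappa * (z1 - 2) * J x)
  * (Num.sqrt kappa)^-1.

Definition es_system (R : realType) (n r : nat) (kappa eta1 eta2 N0 T0 : R)
    (w : 'I_r -> rat) (b : 'I_r -> 'cV[R]_n -> R -> 'cV[R]_n)
    (J : 'cV[R]_n -> R) (eps : R) : hybrid_system (state_space R n) :=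
  {| flow_set := (setT `*` C_z N0 T0) `*` (`[0, +oo[ `*` `[0, +oo[);
     flow_map := fun y =>
       let: (x, (z1, z2, z3), (tau1, tau2)) := y in
       ([set \sum_(i < r)
               es_input kappa J eps (ratr (w i)) z1 x tau2 *: b i x tau1]
        `*` ([set 0] `*` `[0, eta1]
             `*` [set s - \1_(unstable_modes R) z1 | s in `[0, eta2]]))
       `*` ([set eps^-1] `*` [set eps ^- 2]);
     jump_set := (setT `*` D_z N0 T0) `*` (`[0, +oo[ `*` `[0, +oo[);
     jump_map := fun y =>
       let: (x, (z1, z2, z3), tau) := y in
       ([set x] `*` ((modes R `\` [set z1]) `*` [set z2 - 1] `*` [set z3]))
       `*` [set tau] |}.

Definition averaged_gain (R : realType) (n r : nat) (T1 : R)
    (b : 'I_r -> 'cV[R]_n -> R -> 'cV[R]_n) (x : 'cV[R]_n) : 'M[R]_n :=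
  T1^-1 *: \sum_(i < r) \matrix_(k, l)
    \int[@lebesgue_measure R]_(s in `[0, T1]) (b i x s *m (b i x s)^T) k l.

(* Main.v *)
(* Write theta_i = w_i tau_2 + k J(x) with k = kappa (z_1 - 2), and
   a_i = sqrt (2 w_i / kappa).  The near-identity change of variables
     xi = x - eps sum_i (a_i / w_i) sin(theta_i) b_i(x, tau_1)
   cancels the 1/eps part of the flow: xi moves with a bounded velocity that
   depends on eps only through the clocks.  Averaging first over tau_2 and then
   over one period of tau_1 shows that J(xi) changes over a window of length
   eps T_1 like along the averaged flow x' = - (z_1 - 2) P(x) grad J(x), up to
   an error that is small relative to the length of the window.  Since J is
   strongly convex with Lipschitz gradient, J - min J decays at some rate c in
   the stable mode and grows at a rate at most d in the unstable ones.  The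
   weight exp((c + d) z_3) turns both into decay at the rate
   c - (c + d) eta_2 > 0, and the jump timer z_2, which must be recharged
   before each jump, pays for the small additive error made on each flow
   interval. *)
Require Import Defs.
From mathcomp Require Import ring lra.
Import Order.TTheory GRing.Theory Num.Theory.
Import numFieldNormedType.Exports.
Local Open Scope classical_set_scope.
Local Open Scope ring_scope.
Set Implicit Arguments.
Unset Strict Implicit.
Unset Printing Implicit Defensive.

(** Solutions are never compared with trajectories of the averaged system: the estimates bear on
    J(xi) alone. About 1/eps windows fit into a unit of time, so an error o(1) per window would not
    do; it has to be small times the window length. All phases carry the same offset k J(x). In the
    derivative of J(xi), products of cosines of distinct frequencies and all products of a sine and
    a cosine therefore have zero mean in tau_2. Only the squared cosines survive, with weight a_i^2
    / (2 w_i) = 1 / kappa, so no derivative of b_i enters the limit and P appears. Two obstacles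
    shape the proof. The bounds are uniform on compact sets only: the slow clock is reduced modulo
    T_1, and the position is confined to a sublevel set of J chosen before eps, by continuous
    induction. Moreover solutions are merely absolutely continuous and satisfy an inclusion almost
    everywhere: the timers are handled through their increments, while the position is shown to be a
    classical solution inside each flow interval. *)

(** * Continuous induction on a segment *)

Section Creeping.
Context {R : realType}.

(** Let c be the supremum of the points of [a, b] where [P] holds. Such points exist arbitrarily
    close to c on its left, so the local step carries [P] to c and, if c < b, beyond it, which is
    absurd. *)
Lemma creeping (a b : R) (P : R -> Prop) : a <= b -> P a ->
  (forall c, a <= c <= b -> exists2 r, 0 < r &
     forall u v, a <= u <= c -> c <= v <= b -> c - r < u -> v < c + r ->
       P u -> P v) ->
  P b.
Proof.
move=> ab Pa step.
pose S := [set u : R | a <= u <= b /\ P u].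
have Sa : S a by split => //; rewrite lexx ab.
have hS : has_sup S by split; [exists a | exists b => u [/andP[_]]].
have ac : a <= sup S by apply: ub_le_sup => //; case: hS.
have cb : sup S <= b by apply: ge_sup; [exists a | move=> u [/andP[_]]].
have [r r0 hr] := step (sup S) (introT andP (conj ac cb)).
have [u [/andP[au ub] Pu] ru] := sup_adherent r0 hS.
have uc : u <= sup S by apply: ub_le_sup; [case: hS | split => //; rewrite au].
have hv v : sup S <= v <= b -> v < sup S + r -> P v.
  by move=> h1 h2; apply: (hr u) => //; rewrite au.
have [cb'|] := ltP (sup S) b; last first.
  by move=> bc; apply: hv; rewrite ?cb ?lexx//; lra.
pose v := Num.min b (sup S + r / 2).
have vb : v <= b by rewrite /v ge_min lexx.
have cv : sup S < v by rewrite /v lt_min cb' /=; lra.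
have vr : v < sup S + r by rewrite /v gt_min; apply/orP; right; lra.
have Sv : S v by split; [apply/andP; split => //; lra | apply: hv => //; rewrite vb ltW].
have := ub_le_sup (proj2 hS) Sv; lra.
Qed.

End Creeping.

(** * Derivatives of curves as first-order expansions *)

Section IsDerive.
Context {R : realType} {V : normedModType R}.

(** Free of division and of the exclusion s <> t, this form reduces the calculus rules for curves to
    triangle inequalities. *)
Lemma is_derive_nearP (f : R -> V) (t : R) (v : V) :
  is_derive t (1 : R) f v <->
  forall e : R, 0 < e ->
    \forall s \near t, `|f s - f t - (s - t) *: v| <= e * `|s - t|.
Proof.
split=> [[df dv] e e0|h].
  have : h^-1 *: (f (h *: (1 : R) + t) - f t) @[h --> 0^'] --> v.
    by rewrite -dv; exact: df.
  move=> /cvgrPdist_le/(_ e e0); rewrite near_withinE => /nbhs_ballP[r /= r0 hr].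
  apply/nbhs_ballP; exists r => //= s; rewrite -ball_normE /= => st.
  have [->|neq] := eqVneq s t.
    by rewrite !subrr scale0r subr0 !normr0 mulr0.
  have st0 : s - t != 0 by rewrite subr_eq0.
  have st' : ball_ Num.Def.normr (0:R) r (s - t) by rewrite /= sub0r normrN distrC.
  have := hr (s - t); rewrite -ball_normE => /(_ st' st0).
  rewrite /GRing.scale /= mulr1 subrK => H.
  have -> : f s - f t - (s - t) *: v =
     (s - t) *: ((s - t)^-1 *: (f s - f t) - v).
    by rewrite scalerBr scalerA divff// scale1r.
  by rewrite normrZ [leLHS]mulrC ler_wpM2r// distrC.
have : h^-1 *: (f (h *: (1 : R) + t) - f t) @[h --> 0^'] --> v.
  apply/cvgrPdist_le => e e0; rewrite near_withinE.
  have /nbhs_ballP[r /= r0 hr] := h e e0.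
  apply/nbhs_ballP; exists r => //= s; rewrite -ball_normE /= sub0r normrN => s0 sn0.
  have := hr (s + t); rewrite -ball_normE /= opprD addrCA subrr addr0 normrN => /(_ s0).
  rewrite addrK => H.
  have -> : s *: (1 : R) = s by rewrite /GRing.scale /= mulr1.
  have -> : v - s^-1 *: (f (s + t) - f t) = - (s^-1 *: (f (s + t) - f t - s *: v)).
    by rewrite [in RHS]scalerBr scalerA mulVf// scale1r opprB.
  rewrite normrN normrZ normfV ler_pdivrMl ?normr_gt0//.
  by rewrite mulrC.
move=> H; split; first by apply/cvg_ex; exists v.
exact/cvg_lim.
Qed.

End IsDerive.

(** * Mean value inequality from an almost everywhere bound on the derivative *)

Section MeanValueAC.
Context {R : realType}.

(** Cousin's lemma, by continuous induction on the right end of the partitioned segment. The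
    sequence is kept constant after its last node, so that monotonicity holds for all indices. *)
Lemma fine_partition (a b : R) (Q : R -> R -> Prop) : a <= b ->
  (forall c, a <= c <= b -> exists2 r, 0 < r &
     forall u v, a <= u <= c -> c <= v <= b -> c - r < u -> v < c + r ->
       Q u v) ->
  exists (m : nat) (u : nat -> R), [/\ u 0%N = a, u m = b,
    (forall i j, (i <= j)%N -> u i <= u j) &
    forall i, (i < m)%N -> Q (u i) (u i.+1)].
Proof.
move=> ab hQ.
pose P x := exists (m : nat) (u : nat -> R), [/\ u 0%N = a,
    (forall i, (m <= i)%N -> u i = x),
    (forall i j, (i <= j)%N -> u i <= u j) &
    forall i, (i < m)%N -> Q (u i) (u i.+1)].
suff [m [u [u0 um umono uQ]]] : P b.
  by exists m, u; split => //; exact: um.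
apply: (creeping ab) => [|c cab].
  by exists 0%N, (fun=> a); split.
have [r r0 hr] := hQ c cab.
exists r => // x y xc yc cx yx [m [u [u0 um umono uQ]]].
have xy : x <= y by lra.
exists m.+1, (fun i => if (i <= m)%N then u i else y); split => //.
- by move=> i; rewrite ltnNge => /negbTE ->.
- move=> i j ij; case: (leqP j m) => jm; first by rewrite (leq_trans ij jm) umono.
  case: leqP => im //.
  by rewrite (le_trans (umono _ _ im))// um.
- move=> i im; have im1 : (i <= m)%N by [].
  rewrite im1.
  have [im'|mi] := ltnP i m; first exact: uQ.
  have -> : u i = x by apply: um.
  exact: hr.
Qed.

Lemma sum_disjoint_itv_le (m : nat) (s t : 'I_m -> R) (U : set R) (d : R) :
  open U -> (forall i, s i <= t i) -> (forall i, `]s i, t i[ `<=` U) ->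
  trivIset setT (fun i => `]s i, t i[%classic) ->
  (lebesgue_measure U < d%:E)%E -> \sum_(i < m) (t i - s i) < d.
Proof.
move=> oU st sU triv muU; rewrite -lte_fin.
apply: le_lt_trans muU.
have -> : ((\sum_(i < m) (t i - s i))%:E =
   lebesgue_measure (\big[setU/set0]_(i < m) `]s i, t i[%classic))%E.
  rewrite (measure_bigsetU_ord _ xpredT)//= -sumEFin.
  apply: eq_bigr => i _; rewrite lebesgue_measure_itv /= lte_fin.
  case: ltP => // tsi; have -> : t i = s i by apply/eqP; rewrite eq_le tsi st.
  by rewrite subrr.
apply: le_measure; rewrite ?inE.
- exact: bigsetU_measurable.
- exact: measurable_realfun.open_measurable.
- by elim/big_ind : _ => // A B hA hB x [/hA|/hB].
Qed.

(* Off an open set U of small measure containing the exceptional null set, the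
   increments of f over a fine partition are controlled by the derivative;
   the increments inside U are controlled by absolute continuity. *)
Lemma ac_increment_le (a b c : R) (f : R -> R) : a <= b ->
  absolutely_continuous a b f ->
  {ae @lebesgue_measure R, forall t, a <= t <= b ->
     exists2 v, is_derive t (1 : R) f v & v <= c} ->
  f b - f a <= c * (b - a).
Proof.
move=> ab acf [N [mN muN subN]].
suff H e : 0 < e -> f b - f a <= (c + e) * (b - a) + 2 * e.
  apply/ler_addgt0Pr => e e0.
  have ba : 0 < b - a + 2 by lra.
  have e'0 : 0 < e / (b - a + 2) by rewrite divr_gt0.
  have := H _ e'0.
  rewrite (_ : (c + e / (b - a + 2)) * (b - a) + 2 * (e / (b - a + 2)) =
    c * (b - a) + (e / (b - a + 2)) * (b - a + 2)); last by ring.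
  by rewrite divfK// gt_eqF.
move=> e0.
have [d1 d10 acd] := acf e e0.
(* The measure allowed for the exceptional open set: below [d1] the increments of f over it sum to
   less than e, and the second bound makes its contribution to (c + e)(b - a) at most e. *)
pose d := Num.min d1 (e / (`|c + e| + 1)).
have c1 : 0 < `|c + e| + 1 by rewrite ltr_wpDl.
have d0 : 0 < d by rewrite lt_min d10 divr_gt0.
have d1d : d <= d1 by rewrite ge_min lexx.
have dce : `|c + e| * d <= e.
  have : d <= e / (`|c + e| + 1) by rewrite ge_min lexx orbT.
  by rewrite ler_pdivlMr// mulrDr mulr1 mulrC; lra.
have [U [oU NU muU]] := lebesgue_regularity_outer mN
  (eq_ind_r (fun x => (x < +oo)%E) (ltry 0) muN) d0.
have {}muU : (lebesgue_measure U < d%:E)%E.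
  rewrite (_ : U = (U `\` N) `|` N); last first.
    by rewrite setDKU.
  apply: le_lt_trans (measureU2 _ _ _) _ => //.
    by apply: measurableD => //; exact: measurable_realfun.open_measurable.
  by rewrite /= muN adde0.
pose Q u v := f v - f u <= (c + e) * (v - u) \/ `]u, v[ `<=` U.
have [|m [u [u0 um umono uQ]]] := @fine_partition a b Q ab.
  move=> x xab; have [Nx|Nx] := pselect (N x).
    have /nbhs_ballP[r /= r0 hr] : nbhs x U by apply: open_nbhs_nbhs; split => //; exact: NU.
    exists r => // u v ux xv ru vr; right => y /=; rewrite in_itv /= => /andP[uy yv].
    by apply: hr; rewrite -ball_normE /= ltr_norml; lra.
  have [v dv vc] : exists2 v, is_derive x (1 : R) f v & v <= c.
    apply: contrapT => h; apply: Nx; apply: subN => /= h'; apply: h; exact: h'.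
  have /is_derive_nearP/(_ e e0)/nbhs_ballP[r /= r0 hr] := dv.
  exists r => // u w ux xw ru wr; left.
  have hu : `|f u - f x - (u - x) *: v| <= e * `|u - x|.
    by apply: hr; rewrite -ball_normE /= ltr_norml; lra.
  have hw : `|f w - f x - (w - x) *: v| <= e * `|w - x|.
    by apply: hr; rewrite -ball_normE /= ltr_norml; lra.
  move: hu hw; rewrite /GRing.scale /=.
  rewrite (ler0_norm (_ : u - x <= 0)); last by lra.
  rewrite (ger0_norm (_ : 0 <= w - x)); last by lra.
  rewrite !ler_norml => hu hw.
  have : (w - u) * v <= (w - u) * c by rewrite ler_wpM2l//; lra.
  lra.
pose good i := `[< f (u i.+1) - f (u i) <= (c + e) * (u i.+1 - u i) >].
pose s (i : 'I_m) := u i.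
(* Good pieces are collapsed to empty intervals, so that absolute continuity applies to one family
   indexed by all pieces. *)
pose t (i : 'I_m) := if good i then u i else u i.+1.
have st i : s i <= t i by rewrite /s /t; case: ifP => // _; exact: umono.
have su (i : 'I_m) : u 0%N <= u i by exact: umono.
have tb (i : 'I_m) : t i <= b.
  by rewrite /t -um; case: ifP => _; apply: umono => //; exact: ltnW.
have tU i : t i <= u i.+1 by rewrite /t; case: ifP => // _; exact: umono.
have triv : trivIset setT (fun i => `]s i, t i[%classic).
  move=> i j _ _ [x [/=]]; rewrite !in_itv /= => /andP[si it] /andP[sj jt].
  have hl (k l : 'I_m) : s k < x -> x < t l -> (k <= l)%N.
    move=> sk tl; rewrite leqNgt; apply/negP => lk.
    by have := umono _ _ lk; have := tU l; rewrite /s in sk *; lra.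
  by apply/val_inj/eqP; rewrite eqn_leq !hl.
have sumd : \sum_(i < m) (t i - s i) < d.
  apply: (sum_disjoint_itv_le oU) => // i; rewrite /s /t /good.
  case: ifPn => [_|/asboolPn ng]; first by rewrite set_itvoo0// => x.
  by have [//|] := uQ i (ltn_ord i).
have hsum := acd m s t (fun i => conj (le_trans (eq_ind _ (fun z => z <= u 0%N) (lexx _) _ u0) (su i)) (conj (st i) (tb i))) triv (lt_le_trans sumd d1d).
have tele (g : nat -> R) : \sum_(i < m) (g i.+1 - g i) = g m - g 0%N.
  by rewrite -(big_mkord xpredT (fun i => g i.+1 - g i)) telescope_sumr.
have -> : f b - f a = \sum_(i < m) (f (u i.+1) - f (u i)).
  by rewrite (tele (f \o u)) /= um u0.
have -> : (c + e) * (b - a) + 2 * e = \sum_(i < m) (c + e) * (u i.+1 - u i) + 2 * e.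
  by rewrite -mulr_sumr tele um u0.
apply: le_trans (_ : _ <= \sum_(i < m) (c + e) * (u i.+1 - u i) + \sum_(i < m) `|f (t i) - f (s i)| + `|c + e| * \sum_(i < m) (t i - s i)) _.
  rewrite mulr_sumr -!big_split /=; apply: ler_sum => i _; rewrite /s /t /good.
  case: ifPn => [/asboolP h|_].
    by rewrite !subrr normr0 mulr0 !addr0.
  have := ler_norm (f (u i.+1) - f (u i)).
  have : 0 <= u i.+1 - u i by rewrite subr_ge0 umono.
  have := ler_norm (- (c + e)); rewrite normrN => h1 h2 h3.
  have : - (c + e) * (u i.+1 - u i) <= `|c + e| * (u i.+1 - u i) by exact: ler_wpM2r.
  lra.
have : `|c + e| * (\sum_(i < m) (t i - s i)) <= `|c + e| * d by rewrite ler_wpM2l// ltW.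
lra.
Qed.

End MeanValueAC.

(** * From almost everywhere to classical differential equations *)

Section AcOde.
Context {R : realType}.

Lemma ae_imply (P Q : R -> Prop) : (forall t, P t -> Q t) ->
  {ae @lebesgue_measure R, forall t, P t} ->
  {ae @lebesgue_measure R, forall t, Q t}.
Proof. by move=> PQ; apply: negligibleS => t /= nQ Pt; apply: nQ; exact: PQ. Qed.

Lemma ac_sub (V : normedModType R) (a b u v : R) (f : R -> V) :
  a <= u -> v <= b -> absolutely_continuous a b f ->
  absolutely_continuous u v f.
Proof.
move=> au vb acf e /acf[d d0 hd]; exists d => // m s t st; apply: hd => i.
by have [? [? ?]] := st i; split; [lra|split; lra].
Qed.

Lemma ac_comp_contraction (V W : normedModType R) (a b : R) (f : R -> V)
    (phi : V -> W) : (forall p q, `|phi p - phi q| <= `|p - q|) ->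
  absolutely_continuous a b f -> absolutely_continuous a b (phi \o f).
Proof.
move=> hphi acf e /acf[d d0 hd]; exists d => // m s t st triv hlt.
apply: le_lt_trans (hd m s t st triv hlt).
by apply: ler_sum => i _; exact: hphi.
Qed.

Lemma ac_increment_ge (a b c : R) (f : R -> R) : a <= b ->
  absolutely_continuous a b f ->
  {ae @lebesgue_measure R, forall t, a <= t <= b ->
     exists2 v, is_derive t (1 : R) f v & c <= v} ->
  c * (b - a) <= f b - f a.
Proof.
move=> ab acf aef.
have acN : absolutely_continuous a b (-%R \o f).
  by apply: ac_comp_contraction acf => p q; rewrite -opprD normrN.
have := @ac_increment_le R a b (- c) _ ab acN.
rewrite /=; suff h : {ae @lebesgue_measure R, forall t, a <= t <= b ->
     exists2 v, is_derive t (1 : R) (-%R \o f) v & v <= - c}.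
  by move=> /(_ h); lra.
apply: ae_imply aef => t h /h[v dv cv]; exists (- v); last by rewrite lerN2.
exact: is_deriveN.
Qed.

(** Near t the almost everywhere derivative lies within e of g t; the two mean value inequalities
    then enclose every increment from t, which is the first-order expansion. *)
Lemma ac_ode (a b : R) (f g : R -> R) (t : R) : a < t < b ->
  absolutely_continuous a b f ->
  {ae @lebesgue_measure R, forall s, a <= s <= b -> is_derive s (1 : R) f (g s)} ->
  {for t, continuous g} -> is_derive t (1 : R) f (g t).
Proof.
move=> /andP[at' tb] acf aef gc; apply/is_derive_nearP => e e0.
have /cvgrPdist_le/(_ e e0)/nbhs_ballP[r /= r0 hr] := gc.
pose r' := Num.min r (Num.min (t - a) (b - t)).
have r'0 : 0 < r' by rewrite !lt_min r0 !subr_gt0 at' tb.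
have [r1 r2 r3] : [/\ r' <= r, r' <= t - a & r' <= b - t].
  by rewrite /r' !ge_min !lexx ?orbT.
apply/nbhs_ballP; exists r' => //= s; rewrite -ball_normE /= ltr_norml => hs.
have key u v : u <= v -> t - r' < u -> v < t + r' ->
    (g t - e) * (v - u) <= f v - f u <= (g t + e) * (v - u).
  move=> uv hu hv; have acuv : absolutely_continuous u v f by apply: ac_sub acf; lra.
  have hg w : u <= w <= v -> g t - e <= g w <= g t + e.
    move=> huv; have := hr w; rewrite -ball_normE /= ltr_norml ler_norml.
    by move=> /(_ ltac:(lra)); lra.
  apply/andP; split.
    apply: ac_increment_ge => //; apply: ae_imply aef => w h huv.
    by exists (g w); [apply: h; lra|have := hg _ huv; lra].
  apply: ac_increment_le => //; apply: ae_imply aef => w h huv.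
  by exists (g w); [apply: h; lra|have := hg _ huv; lra].
rewrite /GRing.scale /=; have [ts|st] := leP t s.
  rewrite (ger0_norm (_ : 0 <= s - t)) ?subr_ge0// ler_norml.
  have := key t s ts; lra.
rewrite (ltr0_norm (_ : s - t < 0)) ?subr_lt0// ler_norml.
have := key s t (ltW st); lra.
Qed.

End AcOde.

(** * Calculus along curves in normed spaces *)

Section CurveDerivatives.
Context {R : realType}.
Implicit Types V W : normedModType R.

Lemma mx_norm_leP m n (v : 'M[R]_(m, n)) (e : R) : 0 <= e ->
  (forall i j, `|v i j| <= e) <-> `|v| <= e.
Proof.
move=> e0; rewrite [`|v|]/Num.Def.normr/= mx_normrE; split => [h|/bigmax_leP[_ h] i j].
  by apply/bigmax_leP; split => // i _.
exact: (h (i, j)).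
Qed.

Lemma mx_entry_le m n (v : 'M[R]_(m, n)) i j : `|v i j| <= `|v|.
Proof. by have /mx_norm_leP : `|v| <= `|v| by []; apply. Qed.

(** Meant for coordinate projections given as plain functions: linearity is asked only for the
    combination that occurs in the first-order expansion. *)
Lemma is_derive_contraction V W (phi : V -> W) (f : R -> V) (t : R) (v : V) :
  (forall p q (k : R), phi (p - q - k *: v) = phi p - phi q - k *: phi v) ->
  (forall p, `|phi p| <= `|p|) ->
  is_derive t (1 : R) f v -> is_derive t (1 : R) (fun s => phi (f s)) (phi v).
Proof.
move=> lin contr /is_derive_nearP h; apply/is_derive_nearP => e /h.
by apply: filterS => s hs; rewrite -lin (le_trans (contr _)).
Qed.

Lemma is_derive_colP n (x : R -> 'cV[R]_n) (t : R) (v : 'cV[R]_n) :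
  (forall i, is_derive t (1 : R) (fun s => x s i 0) (v i 0)) <->
  is_derive t (1 : R) x v.
Proof.
split=> [h|h i]; last first.
  apply: (is_derive_contraction (phi := fun u : 'cV[R]_n => u i 0)) h => [p q k|p].
    by rewrite !mxE.
  exact: mx_entry_le.
apply/is_derive_nearP => e e0.
have H i : \forall s \near t, `|x s i 0 - x t i 0 - (s - t) *: v i 0| <= e * `|s - t|.
  by have /is_derive_nearP := h i; exact.
have := @filter_forall _ _ _ _ (nbhs_filter t) H; apply: filterS => s hs.
apply/mx_norm_leP => [|i j]; first by rewrite mulr_ge0// ltW.
by rewrite ord1 !mxE; exact: hs.
Qed.

Lemma is_derive_pair V W (f : R -> V) (g : R -> W) (t : R) v w :
  is_derive t (1 : R) f v -> is_derive t (1 : R) g w ->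
  is_derive t (1 : R) (fun s => (f s, g s)) (v, w).
Proof.
move=> /is_derive_nearP hf /is_derive_nearP hg; apply/is_derive_nearP => e e0.
near=> s; rewrite /= /Num.Def.normr /= ge_max; apply/andP; split.
  by near: s; exact: hf.
by near: s; exact: hg.
Unshelve. all: by end_near. Qed.

Lemma is_derive_continuous V (f : R -> V) (t : R) v :
  is_derive t (1 : R) f v -> {for t, continuous f}.
Proof.
by move=> [/derivable1_diffP/differentiable_continuous]. 
Qed.

Lemma is_derive_scale V (f : R -> R) (g : R -> V) (t : R) df dg :
  is_derive t (1 : R) f df -> is_derive t (1 : R) g dg ->
  is_derive t (1 : R) (fun s => f s *: g s) (df *: g t + f t *: dg).
Proof.
move=> Df Dg; have cf := is_derive_continuous Df.
move/is_derive_nearP : Df => Df; move/is_derive_nearP : Dg => Dg.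
apply/is_derive_nearP => e e0.
pose A := `|f t| + 1; pose B := `|g t| + 1; pose C := `|dg| + 1.
have A0 : 0 < A by rewrite ltr_wpDl.
have B0 : 0 < B by rewrite ltr_wpDl.
have C0 : 0 < C by rewrite ltr_wpDl.
have e3 : 0 < e / 3 by rewrite divr_gt0.
near=> s.
have h1 : `|f s - f t - (s - t) *: df| <= e / 3 / B * `|s - t|.
  by near: s; apply: Df; rewrite divr_gt0.
have h2 : `|g s - g t - (s - t) *: dg| <= e / 3 / A * `|s - t|.
  by near: s; apply: Dg; rewrite divr_gt0.
have h3 : `|f t - f s| <= Num.min 1 (e / 3 / C).
  by near: s; move/cvgrPdist_le : cf; apply; rewrite lt_min ltr01 divr_gt0.
have -> : f s *: g s - f t *: g t - (s - t) *: (df *: g t + f t *: dg) =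
  (f s - f t - (s - t) *: df) *: g t + f s *: (g s - g t - (s - t) *: dg)
   + ((f s - f t) * (s - t)) *: dg.
  move: (s - t) (f s) (f t) => k p q; rewrite -[k *: df]/(k * df).
  rewrite !scalerBl !scalerBr !scalerDr !scalerA mulrBl scalerBl.
  rewrite [q * k]mulrC !opprD !addrA.
  by rewrite [RHS](ACl (4*2*3*8*(1*5)*(6*7)))/= subrr addNr !addr0.
have hs : `|f s| <= A.
  have := ler_distD (f t) (f s) 0; rewrite !subr0 distrC.
  by move: h3; rewrite le_min /A => /andP[]; lra.
have hk : 0 <= `|s - t| by [].
apply: le_trans (ler_normD _ _) _; apply: le_trans (lerD (ler_normD _ _) (lexx _)) _.
rewrite !normrZ (_ : e * _ = e / 3 / B * `|s - t| * B + A * (e / 3 / A * `|s - t|)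
   + e / 3 / C * `|s - t| * C); last by field; rewrite !gt_eqF.
have hG : `|g t| <= B by rewrite /B lerDl.
have hD : `|dg| <= C by rewrite /C lerDl.
apply: lerD; first apply: lerD; apply: ler_pM => //.
rewrite distrC ler_wpM2r//.
by move: h3; rewrite le_min => /andP[].
Unshelve. all: by end_near. Qed.

Lemma is_derive_sum_pt V (m : nat) (f : 'I_m -> R -> V) (t : R) (df : 'I_m -> V) :
  (forall i, is_derive t (1 : R) (f i) (df i)) ->
  is_derive t (1 : R) (fun s => \sum_(i < m) f i s) (\sum_(i < m) df i).
Proof.
move=> /is_derive_sum; rewrite (_ : \sum_(i < m) f i = fun s => \sum_(i < m) f i s)//.
by apply/funext => s; rewrite fct_sumE.
Qed.

Lemma is_derive_add_pt V (f g : R -> V) (t : R) df dg :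
  is_derive t (1 : R) f df -> is_derive t (1 : R) g dg ->
  is_derive t (1 : R) (fun s => f s + g s) (df + dg).
Proof. exact: is_deriveD. Qed.

Lemma is_derive_comp_pt (f g : R -> R) (t : R) df dg :
  is_derive (g t) (1 : R) f df -> is_derive t (1 : R) g dg ->
  is_derive t (1 : R) (fun s => f (g s)) (df * dg).
Proof. by move=> hf hg; have := is_derive1_comp; exact. Qed.

Lemma is_derive_affine (c d t : R) : is_derive t (1 : R) (fun s => c + d * s) d.
Proof.
apply/is_derive_nearP => e e0; near=> s.
rewrite (_ : _ - _ - _ = 0) ?normr0 ?mulr_ge0// ?ltW//.
by rewrite /GRing.scale /=; ring.
Unshelve. all: by end_near. Qed.

(** A derivative relative to [S] suffices because the curve stays in [S] near t. It is applied to
    the b_i, which are differentiable only relative to tau_1 >= 0. *)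
Lemma is_derive_comp_within V W (S : set V) (f : V -> W) (L : {linear V -> W})
    (c : R -> V) (t : R) (v : V) :
  deriv_within S f (c t) L -> (\forall s \near t, S (c s)) ->
  is_derive t (1 : R) c v -> is_derive t (1 : R) (fun s => f (c s)) (L v).
Proof.
move=> [Lc hf] Sc Dc; have cc := is_derive_continuous Dc.
have [M [M0 hM]] : exists M : R, 0 < M /\ forall u, `|L u| <= M * `|u|.
  have /linear_boundedP/pinfty_ex_gt0[M M0 hM] := continuous_linear_bounded 0 (Lc 0).
  by exists M; split.
move/is_derive_nearP : Dc => Dc; apply/is_derive_nearP => e e0.
pose N := `|v| + 1; have N0 : 0 < N by rewrite ltr_wpDl.
have e1 : 0 < e / 2 / N by rewrite !divr_gt0.
have e2 : 0 < e / 2 / M by rewrite !divr_gt0.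
near=> s.
have h1 : `|c s - c t - (s - t) *: v| <= Num.min 1 (e / 2 / M) * `|s - t|.
  by near: s; apply: Dc; rewrite lt_min ltr01.
have h2 : `|f (c s) - f (c t) - L (c s - c t)| <= e / 2 / N * `|c s - c t|.
  have Scs : S (c s) by near: s.
  by move: Scs; near: s; exact: (cc _ (hf _ e1)).
have k0 : 0 <= `|s - t| by [].
have h3 : `|c s - c t| <= N * `|s - t|.
  have := ler_normD (c s - c t - (s - t) *: v) ((s - t) *: v).
  rewrite subrK normrZ.
  have : `|c s - c t - (s - t) *: v| <= 1 * `|s - t|.
    by apply: le_trans h1 _; rewrite ler_wpM2r// ge_min lexx.
  by rewrite /N; lra.
have h4 : `|c s - c t - (s - t) *: v| <= e / 2 / M * `|s - t|.
  by apply: le_trans h1 _; rewrite ler_wpM2r// ge_min lexx orbT.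
have -> : f (c s) - f (c t) - (s - t) *: L v =
   (f (c s) - f (c t) - L (c s - c t)) + L (c s - c t - (s - t) *: v).
  by rewrite -linearZ_LR [X in _ = _ + X]linearB addrA subrK.
apply: le_trans (ler_normD _ _) _.
have -> : e * `|s - t| = e / 2 / N * (N * `|s - t|) + M * (e / 2 / M * `|s - t|).
  by field; rewrite !gt_eqF.
apply: lerD; first by apply: le_trans h2 _; rewrite ler_wpM2l// ltW.
by apply: le_trans (hM _) _; rewrite ler_wpM2l// ltW.
Unshelve. all: by end_near. Qed.

(** The hypotheses match what is known on a flow interval: continuity up to the ends,
    differentiability inside only. *)
Lemma mean_value_abs (a b e : R) (f df : R -> R) : a <= b ->
  (forall t, a <= t <= b -> {for t, continuous f}) ->
  (forall t, a < t < b -> is_derive t (1 : R) f (df t) /\ `|df t| <= e) ->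
  `|f b - f a| <= e * (b - a).
Proof.
move=> ab cf hf; have [<-|/eqP neq] := eqVneq a b.
  by rewrite !subrr normr0 mulr0.
have lt : a < b by rewrite lt_neqAle ab andbT; exact/eqP.
have [| |c] := @MVT R f df a b lt.
- by move=> x xab; have [|] := hf x _.
- apply: continuous_in_subspaceT => x; rewrite inE /= in_itv /= => xab; exact: cf.
rewrite in_itv /= => /hf[_ hc] ->.
by rewrite normrM (ger0_norm (_ : 0 <= b - a)) ?subr_ge0// ler_wpM2r// subr_ge0.
Qed.

End CurveDerivatives.

(** * Primitives of continuous and of periodic functions *)

Section Primitive.
Context {R : realType}.

Lemma primitive_exists (f : R -> R) (T : R) : continuous f -> 0 <= T ->
  exists2 F : R -> R, (forall s : R, 0 <= s -> is_derive s (1 : R) F (f s)) &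
    F T - F 0 = \int[@lebesgue_measure R]_(s in `[0, T]) f s.
Proof.
move=> cf T0.
have intf a b : (@lebesgue_measure R).-integrable `[a, b] (EFin \o f).
  apply: continuous_compact_integrable; first exact: segment_compact.
  exact: continuous_subspaceT.
(* Integrating from -1 makes 0 an interior point, where the two-sided derivative is also
   required. *)
pose F y := \int[@lebesgue_measure R]_(t in `[-1, y]) f t.
exists F => [s s0|].
  have su : s < s + 1 by lra.
  have [|] := @continuous_FTC1_closed R f (-1) s (s + 1) su (intf _ _) _ (cf s).
    by lra.
  by move=> df; rewrite derive1E => dF; exact: DeriveDef df dF.
rewrite /F Rintegral_itvB ?bnd_simp// Rintegral_itv_obnd_cbnd//.
by apply: integrableS (intf 0 T) => //; exact: subset_itv_oc_cc.
Qed.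

Lemma primitive_periodic (f F : R -> R) (T s : R) : 0 <= T -> 0 <= s ->
  (forall u, 0 <= u -> f (u + T) = f u) ->
  (forall u : R, 0 <= u -> is_derive u (1 : R) F (f u)) ->
  F (s + T) - F s = F T - F 0.
Proof.
move=> T0 s0 per dF.
have D (u : R) : 0 <= u -> is_derive u (1 : R) (fun v => F (v + T) - F v) 0.
  move=> u0; have -> : (0 : R) = f (u + T) * 1 - f u by rewrite per// mulr1 subrr.
  apply: is_deriveB; last exact: dF.
  apply: (is_derive_comp_pt (f := F) (g := fun v => v + T)); first by apply: dF; rewrite addr_ge0.
  have := is_derive_affine T 1 u; rewrite (_ : (fun v => T + 1 * v) = (fun v => v + T))//.
  by apply/funext => v; rewrite mul1r addrC.
have : `|F (s + T) - F s - (F (0 + T) - F 0)| <= 0 * (s - 0).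
  apply: (@mean_value_abs R 0 s 0 (fun v => F (v + T) - F v) (fun=> 0)) => // t /andP[t0 _].
    exact: is_derive_continuous (D t t0).
  by rewrite normr0; split => //; apply: D; exact: ltW.
by rewrite add0r mul0r normr_le0 subr_eq0 => /eqP.
Qed.

End Primitive.

(** * Boundedness and equicontinuity, uniform in the fast time *)

Section UniformOnCompact.
Context {R : realType} {V : normedModType R}.
Implicit Types (K : set V) (f g : V -> R -> R).

Definition cont_within (W : normedModType R) (K : set V) (f : V -> W) :=
  forall p, K p -> forall e : R, 0 < e ->
    \forall q \near p, K q -> `|f q - f p| <= e.

(** The fast time s runs over the whole line, so compactness can act on p only; bound and modulus
    are uniform in s. This is what allows p to be frozen while the fast phase oscillates. The bound
    is included because products need it. *)
Definition unif_on K f :=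
  (exists M : R, forall p, K p -> forall s, `|f p s| <= M) /\
  forall e : R, 0 < e -> exists2 d : R, 0 < d &
    forall p q, K p -> K q -> `|p - q| < d -> forall s, `|f p s - f q s| <= e.

(** Compactness is used as a near-covering property: the bound is sought along the filter at
    infinity, the modulus along the right filter at 0. *)
Lemma unif_on_continuous K (f : V -> R) : compact K -> cont_within K f ->
  unif_on K (fun p _ => f p).
Proof.
move=> /compact_near_coveringP cK cf; split.
  have /(_ _) h := cK R (+oo_R) (fun M p => K p -> `|f p| <= M) _.
  have [p Kp|M [_ hM]] := h.
    near=> q M => /= Kq.
    have h1 : `|f q - f p| <= 1 by move: Kq; near: q; exact: cf.
    have h2 : `|f p| + 1 <= M by near: M; apply: nbhs_pinfty_ge; rewrite num_real.
    apply: le_trans h2; have := ler_normD (f q - f p) (f p); rewrite subrK; lra.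
  exists (M + 1) => p Kp _; apply: (hM (M + 1)) => //; lra.
move=> e e0.
have /(_ _) h := cK R (0^'+) (fun d p => forall q, K p -> K q -> `|p - q| < d -> `|f p - f q| <= e) _.
have [p Kp|d' /= d'0 hd] := h.
  have /nbhs_ballP[r /= r0 hr] := cf p Kp (e / 2) (divr_gt0 e0 (ltr0Sn R 1)).
  near=> p' d => /= q Kp' Kq pq.
  have pp' : `|p - p'| < r / 2.
    near: p'; apply: (cvgr_dist_lt _) => //; last by rewrite divr_gt0. 
  have dr : d < r / 2 by near: d; apply: nbhs_right_lt; rewrite divr_gt0.
  have h1 : `|f p' - f p| <= e / 2 by apply: hr => //; rewrite -ball_normE /=; lra.
  have h2 : `|f q - f p| <= e / 2.
    apply: hr => //; rewrite -ball_normE /=; have := ler_distD p' p q; lra.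
  have := ler_distD (f p) (f p') (f q); rewrite [`|f p - f q|]distrC; lra.
exists (d' / 2) => [|p q Kp Kq pq _]; first by rewrite divr_gt0.
have := hd (d' / 2); rewrite /= sub0r normrN gtr0_norm ?divr_gt0// => hd2.
apply: hd2 => //; lra.
Unshelve. all: by end_near. Qed.

Lemma unif_on_add K f g : unif_on K f -> unif_on K g ->
  unif_on K (fun p s => f p s + g p s).
Proof.
move=> [[M hM] hf] [[N hN] hg]; split.
  exists (M + N) => p Kp s; apply: le_trans (ler_normD _ _) _.
  by rewrite lerD ?hM ?hN.
move=> e e0; have e2 : 0 < e / 2 by rewrite divr_gt0.
have [d1 d10 h1] := hf _ e2; have [d2 d20 h2] := hg _ e2.
exists (Num.min d1 d2) => [|p q Kp Kq]; first by rewrite lt_min d10.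
rewrite lt_min => /andP[pq1 pq2] s; rewrite opprD addrACA.
apply: le_trans (ler_normD _ _) _; have := h1 p q Kp Kq pq1 s.
by have := h2 p q Kp Kq pq2 s; lra.
Qed.

Lemma unif_on_mul K f g : unif_on K f -> unif_on K g ->
  unif_on K (fun p s => f p s * g p s).
Proof.
move=> [[M hM] hf] [[N hN] hg].
have hM1 p : K p -> forall s, `|f p s| <= `|M| + 1.
  by move=> Kp s; have := hM p Kp s; have := ler_norm M; lra.
have hN1 p : K p -> forall s, `|g p s| <= `|N| + 1.
  by move=> Kp s; have := hN p Kp s; have := ler_norm N; lra.
move: (`|M| + 1) (`|N| + 1) (ltr_wpDl (normr_ge0 M) ltr01) (ltr_wpDl (normr_ge0 N) ltr01) hM1 hN1 => {M N hM hN} N' N M0 N0 hM hN.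
split.
  by exists (N' * N) => p Kp s; rewrite normrM ler_pM ?hM ?hN.
move=> e e0.
have e1 : 0 < e / 2 / N by rewrite !divr_gt0.
have e2 : 0 < e / 2 / N' by rewrite !divr_gt0.
have [d1 d10 h1] := hf _ e1; have [d2 d20 h2] := hg _ e2.
exists (Num.min d1 d2) => [|p q Kp Kq]; first by rewrite lt_min d10.
rewrite lt_min => /andP[pq1 pq2] s.
have -> : f p s * g p s - f q s * g q s =
  (f p s - f q s) * g p s + f q s * (g p s - g q s) by ring.
apply: le_trans (ler_normD _ _) _; rewrite !normrM.
have -> : e = e / 2 / N * N + N' * (e / 2 / N') by field; rewrite !gt_eqF.
by apply: lerD; apply: ler_pM => //; [exact: h1|exact: hN|exact: hM|exact: h2].
Qed.

Lemma unif_on_cst K (c : R -> R) (M : R) : (forall s, `|c s| <= M) ->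
  unif_on K (fun _ s => c s).
Proof.
move=> cM; split; first by exists M.
by move=> e e0; exists 1 => // p q _ _ _ s; rewrite subrr normr0 ltW.
Qed.

Lemma unif_on_scale K f (c : R) : unif_on K f -> unif_on K (fun p s => c * f p s).
Proof. by apply: unif_on_mul; exact: (@unif_on_cst _ (fun=> c) `|c|). Qed.

Lemma unif_on_sum K (m : nat) (f : 'I_m -> V -> R -> R) :
  (forall i, unif_on K (f i)) -> unif_on K (fun p s => \sum_(i < m) f i p s).
Proof.
elim: m f => [f _|m ih f hf].
  rewrite (_ : (fun _ _ => _) = (fun _ _ => 0)); last first.
    by apply/funext => p; apply/funext => s; rewrite big_ord0.
  by apply: (@unif_on_cst _ (fun=> 0) 0) => s; rewrite normr0.
rewrite (_ : (fun _ _ => _) = (fun p s => \sum_(i < m) f (widen_ord (leqnSn m) i) p s + f ord_max p s)).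
  by apply: unif_on_add => //; apply: (ih (fun i => f (widen_ord (leqnSn m) i))).
by apply/funext => p; apply/funext => s; rewrite big_ord_recr.
Qed.

Lemma sin_cos_lipschitz (u v : R) :
  `|sin u - sin v| <= `|u - v| /\ `|cos u - cos v| <= `|u - v|.
Proof.
wlog vu : u v / v <= u => [h|].
  have [/h//|/ltW/h] := leP v u.
  by rewrite distrC [`|v - u|]distrC [`|cos v - _|]distrC.
rewrite [`|u - v|]ger0_norm ?subr_ge0//; split.
  rewrite -[u - v]mul1r; apply: (@mean_value_abs R v u 1 sin cos) => // t _.
    exact: continuous_sin.
  by split; rewrite ?ler_norml ?cos_geN1 ?cos_le1//; exact: is_derive_sin.
rewrite -[u - v]mul1r; apply: (@mean_value_abs R v u 1 cos (fun x => - sin x)) => // t _.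
  exact: continuous_cos.
by split; rewrite ?normrN ?ler_norml ?sin_geN1 ?sin_le1//; exact: is_derive_cos.
Qed.

Lemma sin_cos_norm (u : R) : `|sin u| <= 1 /\ `|cos u| <= 1.
Proof. by rewrite !ler_norml sin_geN1 sin_le1 cos_geN1 cos_le1. Qed.

(** Sine and cosine are 1-Lipschitz and the term w s cancels in the difference of two phases, whence
    a modulus independent of s. *)
Lemma unif_on_sin_cos K (f : V -> R) (w : R) : unif_on K (fun p _ => f p) ->
  unif_on K (fun p s => sin (w * s + f p)) /\
  unif_on K (fun p s => cos (w * s + f p)).
Proof.
move=> [_ hf]; split; split.
- by exists 1 => p _ s; have [] := sin_cos_norm (w * s + f p).
- move=> e /hf[d d0 hd]; exists d => // p q Kp Kq pq s.
  have [h _] := sin_cos_lipschitz (w * s + f p) (w * s + f q).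
  by apply: le_trans h _; rewrite opprD addrACA subrr add0r; exact: hd.
- by exists 1 => p _ s; have [] := sin_cos_norm (w * s + f p).
- move=> e /hf[d d0 hd]; exists d => // p q Kp Kq pq s.
  have [_ h] := sin_cos_lipschitz (w * s + f p) (w * s + f q).
  by apply: le_trans h _; rewrite opprD addrACA subrr add0r; exact: hd.
Qed.

End UniformOnCompact.

(** * Euclidean inner product and comparison with the sup norm *)

Section DotProduct.
Context {R : realType} {n : nat}.
Implicit Types u v : 'cV[R]_n.

Definition dotv u v : R := \sum_(i < n) u i 0 * v i 0.

Lemma norm2_ge0 u : 0 <= norm2 u. Proof. exact: sqrtr_ge0. Qed.

Lemma norm2_sqr u : norm2 u ^+ 2 = dotv u u.
Proof.
rewrite /norm2 sqr_sqrtr; last by apply: sumr_ge0 => i _; exact: sqr_ge0.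
by apply: eq_bigr => i _; rewrite expr2.
Qed.

Lemma dotvDr u v v' : dotv u (v + v') = dotv u v + dotv u v'.
Proof. by rewrite -big_split /=; apply: eq_bigr => i _; rewrite mxE mulrDr. Qed.

Lemma dotvZr u v (c : R) : dotv u (c *: v) = c * dotv u v.
Proof. by rewrite mulr_sumr; apply: eq_bigr => i _; rewrite mxE mulrCA. Qed.

Lemma dotvNr u v : dotv u (- v) = - dotv u v.
Proof. by rewrite -scaleN1r dotvZr mulN1r. Qed.

Lemma dotvBr u v v' : dotv u (v - v') = dotv u v - dotv u v'.
Proof. by rewrite dotvDr dotvNr. Qed.

Lemma dotvC u v : dotv u v = dotv v u.
Proof. by apply: eq_bigr => i _; rewrite mulrC. Qed.

Lemma dotvBl u u' v : dotv (u - u') v = dotv u v - dotv u' v.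
Proof. by rewrite dotvC dotvBr !(dotvC v). Qed.

Lemma dotvZl u v (c : R) : dotv (c *: u) v = c * dotv u v.
Proof. by rewrite dotvC dotvZr dotvC. Qed.

Lemma dotv_sumr (m : nat) u (v : 'I_m -> 'cV[R]_n) :
  dotv u (\sum_(i < m) v i) = \sum_(i < m) dotv u (v i).
Proof.
rewrite /dotv exchange_big /=; apply: eq_bigr => k _.
by rewrite summxE mulr_sumr.
Qed.

Lemma dotvv_ge0 u : 0 <= dotv u u.
Proof. by rewrite -norm2_sqr sqr_ge0. Qed.

Lemma norm_le_norm2 u : `|u| <= norm2 u.
Proof.
apply/mx_norm_leP => [|i j]; first exact: norm2_ge0.
rewrite ord1 -ler_sqr ?nnegrE ?norm2_ge0// real_normK ?num_real// norm2_sqr.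
rewrite /dotv (bigD1 i)//= -expr2 lerDl; apply: sumr_ge0 => k _.
by rewrite -expr2 sqr_ge0.
Qed.

(** Cauchy-Schwarz, from the nonnegative square of [dotv v v *: u - dotv u v *: v]. *)
Lemma dotv_mul_le u v : dotv u v ^+ 2 <= dotv u u * dotv v v.
Proof.
have [v0|v0] := eqVneq (dotv v v) 0.
  have v'0 : norm2 v = 0 by apply/eqP; rewrite -sqrf_eq0 norm2_sqr v0.
  have -> : v = 0 by apply/eqP; rewrite -normr_le0 -v'0 norm_le_norm2.
  by rewrite -(scale0r 0) !dotvZr !mul0r expr0n mulr0.
have vp : 0 < dotv v v by rewrite lt_def v0 dotvv_ge0.
have := dotvv_ge0 (dotv v v *: u - dotv u v *: v).
rewrite !(dotvBl, dotvBr, dotvZl, dotvZr) (dotvC v u).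
rewrite (_ : _ - _ = dotv v v * (dotv u u * dotv v v - dotv u v ^+ 2)); last by ring.
by rewrite pmulr_rge0// subr_ge0.
Qed.

Lemma norm2Z (c : R) (u : 'cV[R]_n) : norm2 (c *: u) = `|c| * norm2 u.
Proof.
apply/eqP; rewrite -(@eqrXn2 _ 2)// ?norm2_ge0 ?mulr_ge0 ?norm2_ge0//.
by rewrite exprMn !norm2_sqr dotvZr dotvC dotvZr mulrA -expr2 real_normK ?num_real.
Qed.

Lemma dotv_le_norm2 u v : `|dotv u v| <= norm2 u * norm2 v.
Proof.
rewrite -ler_sqr ?nnegrE ?mulr_ge0 ?norm2_ge0//.
by rewrite real_normK ?num_real// exprMn !norm2_sqr dotv_mul_le.
Qed.

(** Only equivalence of the norms matters; the crude factor n + 1 avoids a square root and is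
    positive even when n = 0. *)
Lemma norm2_le_norm u : norm2 u <= n.+1%:R * `|u|.
Proof.
rewrite -ler_sqr ?nnegrE ?mulr_ge0 ?norm2_ge0// norm2_sqr exprMn.
apply: (@le_trans _ _ (\sum_(i < n) `|u| ^+ 2)).
  apply: ler_sum => i _; rewrite -expr2 -[leLHS]real_normK ?num_real//.
  by rewrite ler_sqr ?nnegrE// mx_entry_le.
rewrite sumr_const card_ord -[leLHS]mulr_natl ler_wpM2r// ?sqr_ge0//.
by rewrite -natrX ler_nat (leq_trans (leqnSn n))// leq_pmull.
Qed.

End DotProduct.

(** * Inequalities for strongly convex functions with Lipschitz gradient *)

Section StronglyConvex.
Context {R : realType} {n : nat} (J : 'cV[R]_n -> R).
Context (DJ : 'cV[R]_n -> {linear 'cV[R]_n -> R}).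
Hypothesis hDJ : forall x, deriv_within setT J x (DJ x).

Lemma is_derive_along (x u : 'cV[R]_n) :
  is_derive (0 : R) (1 : R) (fun s : R => J (x + s *: u)) (DJ x u).
Proof.
apply: (is_derive_comp_within (S := setT) (f := J) (c := fun s => x + s *: u)).
- by rewrite scale0r addr0; exact: hDJ.
- by near=> s.
- apply/is_derive_nearP => e e0; near=> s.
  rewrite scale0r addr0 subr0 addrAC addrK subrr normr0.
  by rewrite mulr_ge0// ltW.
Unshelve. all: by end_near. Qed.

Lemma derive_grad (x v : 'cV[R]_n) : DJ x v = dotv (grad J x) v.
Proof.
have key u : 'D_u J x = DJ x u.
  have [_ <-] := is_derive_along x u.
  rewrite /derive; set f := (X in lim (X @ _) = _); set g := (X in _ = lim (X @ _)).
  rewrite (_ : f = g)//; apply/funext => h; rewrite /f /g.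
  have h1 : h *: (1 : R) = h by rewrite /GRing.scale /= mulr1.
  by rewrite h1 /= addr0 scale0r addr0 [x + _]addrC.
have -> : v = \sum_(i < n) v i 0 *: delta_mx i 0.
  by rewrite [LHS]matrix_sum_delta; apply: eq_bigr => i _; rewrite big_ord1.
rewrite linear_sum dotv_sumr; apply: eq_bigr => i _.
rewrite linearZ /= dotvZr -key; congr (_ * _).
rewrite /dotv (bigD1 i)//= !mxE !eqxx mulr1 big1 ?addr0// => j ji.
by rewrite !mxE (negbTE ji) mulr0.
Qed.

Context (mu : R) (hmu : 0 < mu) (hconv : strongly_convex mu J).

(** The convexity inequality at a small parameter s is compared with the derivative at x along y - x
    and divided by s; the quadratic gain is discarded. *)
Lemma convex_first_order (x y : 'cV[R]_n) : J x + dotv (grad J x) (y - x) <= J y.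
Proof.
rewrite -derive_grad; apply/ler_addgt0Pr => e e0.
have /is_derive_nearP/(_ e e0)/nbhs_ballP[r /= r0 hr] := is_derive_along x (y - x).
pose s := Num.min (r / 2) 1.
have s0 : 0 < s by rewrite lt_min ltr01 divr_gt0.
have s1 : s <= 1 by rewrite ge_min lexx orbT.
have sr : s < r by rewrite gt_min; apply/orP; left; lra.
have h : `|J (x + s *: (y - x)) - J x - s * DJ x (y - x)| <= e * s.
  have sb : ball (0 : R) r s by rewrite -ball_normE /= sub0r normrN gtr0_norm.
  by have := hr s sb; rewrite subr0 scale0r addr0 (gtr0_norm s0).
move: h; rewrite ler_norml => /andP[h _].
have := @hconv y x s; rewrite ltW// s1 => /(_ isT).
have -> : s *: y + (1 - s) *: x = x + s *: (y - x).
  by rewrite scalerBl scale1r scalerBr addrCA.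
have : 0 <= mu / 2 * s * (1 - s) * norm2 (y - x) ^+ 2.
  apply: mulr_ge0; last exact: sqr_ge0.
  apply: mulr_ge0; last by rewrite subr_ge0.
  by apply: mulr_ge0; [rewrite divr_ge0// ltW | exact: ltW].
move=> h1 h2.
have : s * (J x + DJ x (y - x)) <= s * (J y + e) by lra.
by rewrite ler_pM2l//; lra.
Qed.

Context (xs : 'cV[R]_n) (hxs : forall x, J xs <= J x).

(** Strong convexity at the midpoint of x and the minimizer. This yields mu / 4 without any limit;
    the sharp mu / 2 would bring nothing. *)
Lemma quadratic_growth (x : 'cV[R]_n) : mu / 4 * norm2 (x - xs) ^+ 2 <= J x - J xs.
Proof.
have := @hconv x xs (1 / 2); have := hxs (1 / 2 *: x + (1 - 1 / 2) *: xs).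
by move=> h1 /(_ ltac:(lra)) h2; lra.
Qed.

Context (LJ : R) (hLJ : 0 < LJ).
Hypothesis hlip : forall x x', norm2 (grad J x - grad J x') <= LJ * norm2 (x - x').

(** A gradient step of length s = 1 / (2 LJ) cannot go below the minimum. By the tangent inequality
    at its end, it lowers J by at least s |g|^2 / 2, since the gradient varies by at most |g| / 2
    along it. *)
Lemma grad_sqr_le (x : 'cV[R]_n) : norm2 (grad J x) ^+ 2 <= 4 * LJ * (J x - J xs).
Proof.
set g := grad J x; set s := (2 * LJ)^-1.
have s0 : 0 < s by rewrite invr_gt0 mulr_gt0.
have sL : s * LJ = 1 / 2 by rewrite /s; field; rewrite gt_eqF.
have h1 := convex_first_order (x - s *: g) x.
have h2 := hxs (x - s *: g).
have h3 : `|dotv (grad J x - grad J (x - s *: g)) (s *: g)| <= s * (1 / 2) * norm2 g ^+ 2.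
  apply: le_trans (dotv_le_norm2 _ _) _.
  have := hlip x (x - s *: g); rewrite opprB addrCA subrr addr0 norm2Z gtr0_norm// => h.
  apply: le_trans (ler_wpM2r _ h) _; first by rewrite mulr_ge0 ?norm2_ge0// ltW.
  by rewrite -sL le_eqVlt; apply/orP; left; apply/eqP; ring.
move: h1 h3; rewrite opprB addrCA subrr addr0 dotvBl !dotvZr -/g -norm2_sqr ler_norml.
move=> h1 /andP[_ h3].
have : s * norm2 g ^+ 2 <= 2 * (J x - J xs) by lra.
rewrite -(ler_pM2l hLJ); have -> : LJ * (s * norm2 g ^+ 2) = (s * LJ) * norm2 g ^+ 2 by ring.
rewrite sL; lra.
Qed.

Lemma grad_min : grad J xs = 0.
Proof.
have := grad_sqr_le xs; rewrite subrr mulr0 => h.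
have h0 : norm2 (grad J xs) = 0.
  by apply/eqP; rewrite -sqrf_eq0 eq_le h sqr_ge0.
by apply/eqP; rewrite -normr_le0 -h0 norm_le_norm2.
Qed.

Lemma value_le_dot (x : 'cV[R]_n) :
  J x - J xs <= norm2 (grad J x) * norm2 (x - xs).
Proof.
have h := convex_first_order x xs.
have := dotv_le_norm2 (grad J x) (x - xs); rewrite ler_norml => /andP[_].
move: h; rewrite -[xs - x]opprB dotvNr; lra.
Qed.

Lemma value_le_sqr (x : 'cV[R]_n) : J x - J xs <= LJ * norm2 (x - xs) ^+ 2.
Proof.
apply: le_trans (value_le_dot x) _.
have := hlip x xs; rewrite grad_min subr0 => h.
by rewrite expr2 mulrA ler_wpM2r// norm2_ge0.
Qed.

(** With V the excess value, g the gradient norm and d the distance to the minimizer, V <= g d and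
    (mu / 4) d^2 <= V give (mu / 4) V^2 <= g^2 V. *)
Lemma polyak_lojasiewicz (x : 'cV[R]_n) :
  mu / 4 * (J x - J xs) <= norm2 (grad J x) ^+ 2.
Proof.
have h1 := value_le_dot x; have h2 := quadratic_growth x.
have := hxs x; rewrite -subr_ge0.
move: (J x - J xs) (norm2 (grad J x)) (norm2 (x - xs)) (norm2_ge0 (grad J x)) (norm2_ge0 (x - xs)) h1 h2 => V g d g0 d0 h1 h2 V0.
have [->|Vn0] := eqVneq V 0; first by rewrite mulr0 sqr_ge0.
have Vp : 0 < V by rewrite lt_def Vn0.
rewrite -(ler_pM2r Vp).
have h3 : V ^+ 2 <= (g * d) ^+ 2 by rewrite ler_sqr ?nnegrE ?mulr_ge0.
have h4 : mu / 4 * (g * d) ^+ 2 <= g ^+ 2 * V.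
  by rewrite exprMn mulrCA ler_wpM2l// sqr_ge0.
have -> : mu / 4 * V * V = mu / 4 * V ^+ 2 by ring.
by apply: le_trans h4; rewrite ler_wpM2l// ltW// divr_gt0.
Qed.

(** Tangent inequalities at both ends: by convexity no bound on the gradient between the two points
    is needed. *)
Lemma value_diff_le (x y : 'cV[R]_n) (g : R) :
  norm2 (grad J x) <= g -> norm2 (grad J y) <= g -> `|J x - J y| <= g * norm2 (x - y).
Proof.
have key (u v : 'cV[R]_n) : norm2 (grad J u) <= g -> J u - J v <= g * norm2 (u - v).
  move=> hg; have h := convex_first_order u v.
  have := dotv_le_norm2 (grad J u) (u - v); rewrite ler_norml => /andP[_ h2].
  have : norm2 (grad J u) * norm2 (u - v) <= g * norm2 (u - v) by rewrite ler_wpM2r// norm2_ge0.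
  move: h; rewrite -[v - u]opprB dotvNr; lra.
move=> hx hy; have h1 := key x y hx; have h2 := key y x hy.
have e : norm2 (y - x) = norm2 (x - y) by rewrite -opprB -scaleN1r norm2Z normrN normr1 mul1r.
by rewrite e in h2; rewrite ler_norml; lra.
Qed.

End StronglyConvex.

(** * Bounded primitives of trigonometric products *)

Section TrigPrimitives.
Context {R : realType} {V : normedModType R}.

Lemma is_derive_sin_affine (l c s : R) :
  is_derive s (1 : R) (fun s => sin (l * s + c)) (l * cos (l * s + c)).
Proof.
rewrite mulrC; apply: (is_derive_comp_pt (f := sin) (g := fun s => l * s + c)).
by under eq_fun do rewrite addrC; exact: is_derive_affine.
Qed.

Lemma is_derive_cos_affine (l c s : R) :
  is_derive s (1 : R) (fun s => cos (l * s + c)) (- (l * sin (l * s + c))).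
Proof.
rewrite mulrC -mulNr; apply: (is_derive_comp_pt (f := cos) (g := fun s => l * s + c)).
by under eq_fun do rewrite addrC; exact: is_derive_affine.
Qed.

Lemma is_derive_scalel (f : R -> R) (c t df : R) :
  is_derive t (1 : R) f df -> is_derive t (1 : R) (fun s => c * f s) (c * df).
Proof. exact: is_deriveZ. Qed.

(* Each primitive below depends on the phase only through sines and cosines. *)
Definition unif_phase (C : R -> R -> R) := forall (K : set V) (f : V -> R),
  unif_on K (fun p _ => f p) -> unif_on K (fun p s => C (f p) s).

Lemma trig_primitive (l c : R) : l != 0 ->
  exists S C : R -> R -> R, [/\
    forall phi s, is_derive s (1 : R) (S phi) (sin (l * s + c * phi)),
    forall phi s, is_derive s (1 : R) (C phi) (cos (l * s + c * phi)),
    unif_phase S & unif_phase C].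
Proof.
move=> l0; exists (fun phi s => (- l^-1) * cos (l * s + c * phi)).
exists (fun phi s => l^-1 * sin (l * s + c * phi)); split => [phi s|phi s|K f hf|K f hf].
- have := is_derive_scalel (- l^-1) (is_derive_cos_affine l (c * phi) s).
  by rewrite mulrNN mulrA mulVf// mul1r.
- have := is_derive_scalel l^-1 (is_derive_sin_affine l (c * phi) s).
  by rewrite mulrA mulVf// mul1r.
- apply: unif_on_scale.
  by have [] := @unif_on_sin_cos _ _ K (fun p => c * f p) l (unif_on_scale c hf).
- apply: unif_on_scale.
  by have [] := @unif_on_sin_cos _ _ K (fun p => c * f p) l (unif_on_scale c hf).
Qed.

(** At resonance, l = 0, the phase must vanish as well: the sine is then 0 and the cosine is 1,
    which is the mean subtracted. *)
Lemma trig_primitive_mean (l c : R) : (l = 0 -> c = 0) ->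
  exists S C : R -> R -> R, [/\
    forall phi s, is_derive s (1 : R) (S phi) (sin (l * s + c * phi)),
    forall phi s, is_derive s (1 : R) (C phi) (cos (l * s + c * phi) - (l == 0)%:R),
    unif_phase S & unif_phase C].
Proof.
have [->|l0] := eqVneq l 0.
  move=> /(_ erefl) ->; exists (fun _ _ => 0), (fun _ _ => 0).
  split => [phi s|phi s|K f _|K f _].
  - by rewrite !mul0r addr0 sin0; exact: is_derive_cst.
  - by rewrite !mul0r addr0 cos0 subrr; exact: is_derive_cst.
  - by apply: (@unif_on_cst _ _ _ (fun=> 0) 0) => s; rewrite normr0.
  - by apply: (@unif_on_cst _ _ _ (fun=> 0) 0) => s; rewrite normr0.
move=> _; have [S [C [hS hC uS uC]]] := trig_primitive c l0.
by exists S, C; split => // phi s; rewrite subr0.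
Qed.

(** Product-to-sum formulas. Both factors carry the same phase, so it doubles in the sum term
    (frequency u + v > 0) and cancels in the difference term; when u = v the latter leaves the mean
    1/2 for two cosines and 0 for a sine and a cosine. *)
Lemma trig_product_primitive (u v : R) : 0 < u -> 0 < v ->
  exists SC CC : R -> R -> R, [/\
    forall phi s, is_derive s (1 : R) (SC phi) (sin (u * s + phi) * cos (v * s + phi)),
    forall phi s, is_derive s (1 : R) (CC phi)
      (cos (u * s + phi) * cos (v * s + phi) - (u == v)%:R / 2),
    unif_phase SC & unif_phase CC].
Proof.
move=> u0 v0.
have uv : u + v != 0 by rewrite gt_eqF ?addr_gt0.
have [S1 [C1 [hS1 hC1 uS1 uC1]]] := trig_primitive 2 uv.
have [S2 [C2 [hS2 hC2 uS2 uC2]]] := @trig_primitive_mean (u - v) 0 (fun=> erefl).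
exists (fun phi s => 2^-1 * (S1 phi s + S2 phi s)).
exists (fun phi s => 2^-1 * (C1 phi s + C2 phi s)).
have eA phi s : (u + v) * s + 2 * phi = (u * s + phi) + (v * s + phi) by ring.
have eB phi s : (u - v) * s + 0 * phi = (u * s + phi) - (v * s + phi) by ring.
split => [phi s|phi s|K f hf|K f hf].
- have -> : sin (u * s + phi) * cos (v * s + phi) =
    2^-1 * (sin ((u + v) * s + 2 * phi) + sin ((u - v) * s + 0 * phi)).
    by rewrite eA eB; move: (u * s + phi) (v * s + phi) => A B; rewrite sinD sinB; field.
  by apply: is_derive_scalel; apply: is_derive_add_pt.
- have -> : cos (u * s + phi) * cos (v * s + phi) - (u == v)%:R / 2 =
    2^-1 * (cos ((u + v) * s + 2 * phi) + (cos ((u - v) * s + 0 * phi) - (u - v == 0)%:R)).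
    rewrite eA eB subr_eq0; move: (u * s + phi) (v * s + phi) (_ == _) => A B e.
    by rewrite cosD cosB; field.
  by apply: is_derive_scalel; apply: is_derive_add_pt.
- by apply: unif_on_scale; apply: unif_on_add; [exact: uS1|exact: uS2].
- by apply: unif_on_scale; apply: unif_on_add; [exact: uC1|exact: uC2].
Qed.

End TrigPrimitives.

(** * Continuity relative to a set *)

Section ContWithin.
Context {R : realType}.
Implicit Types V W U : normedModType R.

Lemma near_dist_le V (p : V) (e : R) : 0 < e -> \forall q \near p, `|p - q| <= e.
Proof. by move=> e0; apply: (@cvgr_dist_le _ _ _ _ _ id p). Qed.

Lemma cont_within_sub V W (K S : set V) (f : V -> W) :
  K `<=` S -> cont_within S f -> cont_within K f.
Proof.
move=> KS cf p Kp e e0; have := cf p (KS _ Kp) e e0.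
by apply: filterS => q h Kq; apply: h; exact: KS.
Qed.

Lemma cont_within_deriv V W (S : set V) (f : V -> W) (L : V -> {linear V -> W}) :
  (forall p, S p -> deriv_within S f p (L p)) -> cont_within S f.
Proof.
move=> hf p Sp e e0; have [Lc hL] := hf p Sp.
have h0 : \forall q \near p, `|L p (q - p)| <= e / 2.
  have : L p (q - p) @[q --> p] --> L p 0.
    apply: continuous_cvg; first exact: Lc.
    by rewrite -[X in _ --> X](subrr p); apply: cvgB => //; exact: cvg_cst.
  rewrite linear0 => /cvgrPdist_le/(_ (e / 2)); rewrite divr_gt0// => /(_ isT).
  by apply: filterS => q; rewrite sub0r normrN.
near=> q => Sq.
have h1 : `|f q - f p - L p (q - p)| <= 1 * `|q - p|.
  by move: Sq; near: q; exact: hL.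
have h2 : `|L p (q - p)| <= e / 2 by near: q.
have h3 : `|p - q| <= e / 2.
  by near: q; apply: near_dist_le; rewrite divr_gt0.
have := ler_normD (f q - f p - L p (q - p)) (L p (q - p)).
by rewrite subrK distrC in h3 *; lra.
Unshelve. all: by end_near. Qed.

(** The local Lipschitz bound on [D] absorbs the change of base point, the boundedness of the fixed
    operator [D p] the change of vector. *)
Lemma cont_within_deriv_apply V W U (S : set V) (D : V -> {linear W -> U}) (v : V -> W) :
  (forall p, S p -> continuous (D p)) ->
  (forall p, S p -> exists (N : set V) (k : R), nbhs p N /\
       forall q q', N q -> S q -> N q' -> S q' ->
         forall v, `|D q v - D q' v| <= k * `|q - q'| * `|v|) ->
  cont_within S v -> cont_within S (fun p => D p (v p)).
Proof.
move=> Dc Dlip cv p Sp e e0.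
have [N [k [Np hN]]] := Dlip p Sp.
pose A := `|v p| + 1; have A0 : 0 < A by rewrite ltr_wpDl.
pose k' := `|k| + 1; have k'0 : 0 < k' by rewrite ltr_wpDl.
have [M M0 hM] : exists2 M : R, 0 < M & forall u, `|D p u| <= M * `|u|.
  have /linear_boundedP/pinfty_ex_gt0[M M0 hM] := continuous_linear_bounded 0 (Dc p Sp 0).
  by exists M.
near=> q => Sq.
have Nq : N q by near: q.
have h1 : `|v q - v p| <= Num.min 1 (e / 2 / M).
  by move: Sq; near: q; apply: cv => //; rewrite lt_min ltr01 !divr_gt0.
have h2 : `|p - q| <= e / 2 / (k' * A).
  by near: q; apply: near_dist_le; rewrite !divr_gt0// mulr_gt0.
have vq : `|v q| <= A.
  have := ler_normD (v q - v p) (v p); rewrite subrK.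
  by move: h1; rewrite le_min /A => /andP[]; lra.
have -> : D q (v q) - D p (v p) = (D q (v q) - D p (v q)) + D p (v q - v p).
  by rewrite linearB addrA subrK.
apply: le_trans (ler_normD _ _) _.
have h3 : `|D q (v q) - D p (v q)| <= e / 2.
  apply: le_trans (hN q p Nq Sq (nbhs_singleton Np) Sp _) _.
  have hk : k <= k' by have := ler_norm k; rewrite /k'; lra.
  rewrite [e / 2](_ : _ = k' * (e / 2 / (k' * A)) * A); last by field; rewrite !gt_eqF.
  apply: (@le_trans _ _ (k' * `|p - q| * `|v q|)).
    by rewrite distrC ler_wpM2r// ler_wpM2r.
  by apply: ler_pM => //; [rewrite mulr_ge0// ltW|rewrite ler_pM2l].
have h4 : `|D p (v q - v p)| <= e / 2.
  apply: le_trans (hM _) _; rewrite [e / 2](_ : _ = M * (e / 2 / M)); last by field; rewrite !gt_eqF.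
  by rewrite ler_pM2l//; move: h1; rewrite le_min => /andP[].
lra.
Unshelve. all: by end_near. Qed.

Lemma cont_within_entry V m (S : set V) (f : V -> 'cV[R]_m) (i : 'I_m) :
  cont_within S f -> cont_within S (fun p => f p i 0).
Proof.
move=> cf p Sp e e0; have := cf p Sp e e0; apply: filterS => q h Sq.
by have := mx_entry_le (f q - f p) i 0; rewrite !mxE => /le_trans; apply; exact: h.
Qed.

Lemma cont_within_continuous V W (S : set V) (f : V -> W) :
  continuous f -> cont_within S f.
Proof.
move=> cf p _ e e0; have /cvgrPdist_le/(_ e e0) := cf p.
by apply: filterS => q h _; rewrite distrC.
Qed.

Lemma cont_within_comp V W U (S : set V) (S' : set W) (g : V -> W) (f : W -> U) :
  (forall p, S p -> S' (g p)) -> continuous g -> cont_within S' f ->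
  cont_within S (fun p => f (g p)).
Proof.
move=> SS cg cf p Sp e e0; have h : \forall q \near p, S' (g q) -> `|f (g q) - f (g p)| <= e.
  exact: cg p _ (cf (g p) (SS _ Sp) e e0).
by apply: filterS h => q h Sq; exact: (h (SS _ Sq)).
Qed.

End ContWithin.

(** * The near-identity change of variables *)

Section NearIdentity.
Context {R : realType} {n r : nat}.
Context (om a : 'I_r -> R) (b : 'I_r -> 'cV[R]_n -> R -> 'cV[R]_n).
Context (Db : 'I_r -> 'cV[R]_n * R -> {linear ('cV[R]_n * R)%type -> 'cV[R]_n}).
Context (J : 'cV[R]_n -> R) (DJ : 'cV[R]_n -> {linear 'cV[R]_n -> R}).
Context (k : R).
Implicit Types (eps s t : R) (p : 'cV[R]_n * R) (x : 'cV[R]_n).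

Definition phase (i : 'I_r) x s : R := om i * s + k * J x.

Definition es_field eps x t1 t2 : 'cV[R]_n :=
  \sum_(i < r) (eps^-1 * a i * cos (phase i x t2)) *: b i x t1.

Definition near_id eps x t1 t2 : 'cV[R]_n :=
  x - eps *: \sum_(i < r) (a i / om i * sin (phase i x t2)) *: b i x t1.

(** What remains of the velocity of [near_id] at order zero: the motion of the phase through J(x),
    then the motion of b_i through x and, with [Db i p (0, 1)], through tau_1. *)
Definition slow_field p s : 'cV[R]_n :=
  - \sum_(i < r) (a i / om i) *:
      ((k * cos (phase i p.1 s)
        * \sum_(j < r) a j * cos (phase j p.1 s) * dotv (grad J p.1) (b j p.1 p.2))
         *: b i p.1 p.2
       + sin (phase i p.1 s) *:
         (\sum_(j < r) (a j * cos (phase j p.1 s)) *: Db i p (b j p.1 p.2, 0)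
          + Db i p (0, 1))).

Let S := [set p : 'cV[R]_n * R | 0 <= p.2].

Hypothesis om_gt0 : forall i, 0 < om i.
Hypothesis hb : forall i p, S p ->
  deriv_within S (fun p => b i p.1 p.2) p (Db i p).
Hypothesis hDJ : forall x, deriv_within setT J x (DJ x).

(* The terms of order 1/eps in the derivative of [near_id] cancel. *)
Lemma is_derive_near_id eps (x : R -> 'cV[R]_n) (t1 t2 : R -> R) t :
  0 < eps -> 0 < t1 t -> is_derive t (1 : R) t1 eps^-1 ->
  is_derive t (1 : R) t2 (eps ^- 2) ->
  is_derive t (1 : R) x (es_field eps (x t) (t1 t) (t2 t)) ->
  is_derive t (1 : R) (fun s => near_id eps (x s) (t1 s) (t2 s))
    (slow_field (x t, t1 t) (t2 t)).
Proof.
move=> e0 t10 Dt1 Dt2 Dx; set v := es_field _ _ _ _ in Dx *.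
have en0 : eps != 0 by rewrite gt_eqF.
pose T := \sum_(j < r) a j * cos (phase j (x t) (t2 t)) * dotv (grad J (x t)) (b j (x t) (t1 t)).
pose p := (x t, t1 t).
pose E i := \sum_(j < r) (a j * cos (phase j (x t) (t2 t))) *: Db i p (b j (x t) (t1 t), 0) + Db i p (0, 1).
have H1 : eps * DJ (x t) v = T.
  rewrite /v /es_field linear_sum mulr_sumr; apply: eq_bigr => j _.
  by rewrite linearZ /= (derive_grad hDJ) !mulrA divff// mul1r.
have H2 i : eps *: Db i p (v, eps^-1) = E i.
  have -> : (v, eps^-1) = \sum_(j < r) (eps^-1 * a j * cos (phase j (x t) (t2 t))) *: (b j (x t) (t1 t), 0 : R)
      + eps^-1 *: (0 : 'cV[R]_n, 1 : R).
    have hs (c : 'I_r -> R) (u : 'I_r -> 'cV[R]_n) :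
        \sum_(j < r) c j *: (u j, 0 : R) = (\sum_(j < r) c j *: u j, 0).
      elim/big_ind2 : _ => // [y1 y2 z1 z2 -> ->|j _].
        transitivity (y1 + z1, 0 + 0 : R); first by [].
        by rewrite addr0.
      transitivity (c j *: u j, c j * 0 : R); first by [].
      by rewrite mulr0.
    rewrite hs; transitivity (v + eps^-1 *: 0, 0 + eps^-1 * 1 : R) => //.
    by rewrite scaler0 addr0 add0r mulr1.
  rewrite linearD linear_sum /= scalerDr scaler_sumr linearZ /= scalerA divff// scale1r.
  congr (_ + _); apply: eq_bigr => j _.
  by rewrite linearZ /= scalerA !mulrA divff// mul1r.
have DJx : is_derive t (1 : R) (fun s => J (x s)) (DJ (x t) v).
  by apply: (is_derive_comp_within (S := setT) (f := J)) => //; near=> s.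
have Dph i : is_derive t (1 : R) (fun s => phase i (x s) (t2 s))
    (om i * eps ^- 2 + k * DJ (x t) v).
  by apply: is_derive_add_pt; apply: is_derive_scalel.
have Dsin i : is_derive t (1 : R) (fun s => a i / om i * sin (phase i (x s) (t2 s)))
    (a i / om i * (cos (phase i (x t) (t2 t)) * (om i * eps ^- 2 + k * DJ (x t) v))).
  apply: is_derive_scalel.
have Dbi i : is_derive t (1 : R) (fun s => b i (x s) (t1 s)) (Db i p (v, eps^-1)).
  apply: (is_derive_comp_within (S := S) (f := fun p => b i p.1 p.2) (c := fun s => (x s, t1 s))).
  - by apply: hb; rewrite /S /=; exact: ltW.
  - have /cvgrPdist_lt/(_ _ t10) := is_derive_continuous Dt1.
    apply: filterS => s; rewrite ltr_norml /S /= => /andP[_ h].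
    by move: h; rewrite ltrBlDr ltrDl; exact: ltW.
  - exact: is_derive_pair.
have Dsum := is_derive_sum_pt (fun i => is_derive_scale (Dsin i) (Dbi i)).
have := is_derive_add_pt Dx (is_derive_scale (is_derive_cst (- eps) t (1:R)) Dsum).
rewrite /cst scale0r add0r => D.
have -> : (fun s => near_id eps (x s) (t1 s) (t2 s)) =
  (fun s => x s + (- eps) *: \sum_(i < r) (a i / om i * sin (phase i (x s) (t2 s))) *: b i (x s) (t1 s)).
  by apply/funext => s; rewrite /near_id scaleNr.
apply: is_derive_eq D _.
rewrite scaleNr scaler_sumr /slow_field /=.
(* The part om_i / eps^2 of the phase velocity, once multiplied by eps a_i / om_i, is exactly the
   i-th term of [es_field]; everything else is of order zero. *)
rewrite (eq_bigr (fun i => (eps^-1 * a i * cos (phase i (x t) (t2 t))) *: b i (x t) (t1 t)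
   + (a i / om i) *: ((k * cos (phase i (x t) (t2 t)) * T) *: b i (x t) (t1 t)
       + sin (phase i (x t) (t2 t)) *: E i))); last first.
  move=> i _; rewrite -H2 -H1 !scalerDr !scalerA addrA -scalerDl; congr (_ *: _ + _ *: _).
    by field; rewrite en0 gt_eqF.
  by ring.
by rewrite big_split /= opprD addrA subrr add0r.
Unshelve. all: by end_near. Qed.

End NearIdentity.

(** * Uniform regularity and mean of the slow field *)

Section SlowFieldRegularity.
Context {R : realType} {n r : nat}.
Context (om a : 'I_r -> R) (b : 'I_r -> 'cV[R]_n -> R -> 'cV[R]_n).
Context (Db : 'I_r -> 'cV[R]_n * R -> {linear ('cV[R]_n * R)%type -> 'cV[R]_n}).
Context (J : 'cV[R]_n -> R) (DJ : 'cV[R]_n -> {linear 'cV[R]_n -> R}).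
Context (k LJ : R).

Let S := [set p : 'cV[R]_n * R | 0 <= p.2].

Hypothesis om_gt0 : forall i, 0 < om i.
Hypothesis hb : forall i p, S p ->
  deriv_within S (fun p => b i p.1 p.2) p (Db i p).
Hypothesis hDb : forall i p, S p ->
  exists (U : set ('cV[R]_n * R)) (c : R), nbhs p U /\
    forall q q', U q -> S q -> U q' -> S q' ->
      forall v, `|Db i q v - Db i q' v| <= c * `|q - q'| * `|v|.
Hypothesis hDJ : forall x, deriv_within setT J x (DJ x).
Hypothesis hLJ : 0 < LJ.
Hypothesis hlip : forall x x', norm2 (grad J x - grad J x') <= LJ * norm2 (x - x').

Lemma grad_continuous : continuous (grad J).
Proof.
move=> x; apply/(@cvgrPdist_le _ _ _ (nbhs x)) => e e0.
have c0 : 0 < e / (LJ * n.+1%:R) by rewrite divr_gt0// mulr_gt0.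
have := near_dist_le x c0; apply: filterS => y h.
apply: le_trans (norm_le_norm2 _) _; apply: le_trans (hlip _ _) _.
have -> : e = LJ * (n.+1%:R * (e / (LJ * n.+1%:R))) by field; rewrite !gt_eqF.
rewrite ler_pM2l//; apply: le_trans (norm2_le_norm _) _.
by rewrite ler_pM2l.
Qed.

Lemma b_cont_within i : cont_within S (fun p => b i p.1 p.2).
Proof. exact: cont_within_deriv (hb i). Qed.

Lemma Db_cont_within i (v : 'cV[R]_n * R -> 'cV[R]_n * R) :
  cont_within S v -> cont_within S (fun p => Db i p (v p)).
Proof.
by apply: cont_within_deriv_apply => p Sp; [have [] := hb i Sp|exact: hDb].
Qed.

Context (K : set ('cV[R]_n * R)) (cK : compact K) (KS : K `<=` S).

Lemma unif_b i l : unif_on K (fun p _ => b i p.1 p.2 l 0).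
Proof.
apply: unif_on_continuous => //; apply: cont_within_entry.
exact: cont_within_sub KS (b_cont_within i).
Qed.

Lemma unif_Db i l (v : 'cV[R]_n * R -> 'cV[R]_n * R) : cont_within S v ->
  unif_on K (fun p _ => Db i p (v p) l 0).
Proof.
move=> cv; apply: unif_on_continuous => //; apply: cont_within_entry.
exact: cont_within_sub KS (Db_cont_within i cv).
Qed.

Lemma unif_grad l : unif_on K (fun p _ => grad J p.1 l 0).
Proof.
apply: unif_on_continuous => //; apply: cont_within_entry.
apply: cont_within_continuous => p; apply: continuous_comp; first exact: cvg_fst.
exact: grad_continuous.
Qed.

Lemma unif_J : unif_on K (fun p _ => k * J p.1).
Proof.
apply: unif_on_scale; apply: unif_on_continuous => //.
apply: (cont_within_comp (S' := setT) (g := fst)) => //.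
  by move=> p; exact: cvg_fst.
by apply: (cont_within_deriv (L := DJ)) => x _; exact: hDJ.
Qed.

Lemma unif_dotv (u v : 'cV[R]_n * R -> R -> 'cV[R]_n) :
  (forall l, unif_on K (fun p s => u p s l 0)) ->
  (forall l, unif_on K (fun p s => v p s l 0)) ->
  unif_on K (fun p s => dotv (u p s) (v p s)).
Proof. by move=> hu hv; apply: unif_on_sum => l; exact: unif_on_mul. Qed.

Lemma b0_cont_within j : cont_within S (fun p => (b j p.1 p.2, 0 : R)).
Proof.
move=> p Sp e e0; have := @b_cont_within j p Sp e e0; apply: filterS => q h Sq.
rewrite /Num.Def.normr /= ge_max; apply/andP; split; first exact: h.
rewrite (_ : snd _ = 0 - 0); last by [].
by rewrite subrr normr0 ltW.
Qed.

Lemma cst_cont_within (c : 'cV[R]_n * R) : cont_within S (fun=> c).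
Proof. by move=> p Sp e e0; near=> q => _; rewrite subrr normr0 ltW.
Unshelve. all: by end_near. Qed.

Lemma unif_slow_field l :
  unif_on K (fun p s => slow_field om a b Db J k p s l 0).
Proof.
have ph i := unif_on_sin_cos (om i) unif_J.
rewrite (_ : (fun p s => _) = (fun p s => (-1) * \sum_(i < r) (a i / om i) *
  ((k * cos (om i * s + k * J p.1) * \sum_(j < r) a j * (cos (om j * s + k * J p.1)
     * dotv (grad J p.1) (b j p.1 p.2))) * b i p.1 p.2 l 0
   + sin (om i * s + k * J p.1) * (\sum_(j < r) a j * (cos (om j * s + k * J p.1)
     * Db i p (b j p.1 p.2, 0) l 0) + Db i p (0, 1) l 0)))); last first.
  apply/funext => p; apply/funext => s; rewrite /slow_field mxE summxE mulN1r; congr (- _).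
  apply: eq_bigr => i _; rewrite !mxE summxE /phase; congr (_ * (_ * _ + _ * (_ + _))).
    by congr (_ * _); apply: eq_bigr => j _; rewrite mulrA.
  by apply: eq_bigr => j _; rewrite mxE mulrA.
apply: unif_on_scale; apply: unif_on_sum => i; apply: unif_on_scale.
apply: unif_on_add; apply: unif_on_mul.
- apply: unif_on_mul; first by apply: unif_on_scale; have [] := ph i.
  apply: unif_on_sum => j; apply: unif_on_scale; apply: unif_on_mul; first by have [] := ph j.
  apply: (unif_dotv (u := fun p _ => grad J p.1) (v := fun p _ => b j p.1 p.2)) => l'.
    exact: unif_grad.
  exact: unif_b.
- exact: unif_b.
- by have [] := ph i.
- apply: unif_on_add; last exact: unif_Db (cst_cont_within _).
  apply: unif_on_sum => j; apply: unif_on_scale; apply: unif_on_mul; first by have [] := ph j.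
  exact: unif_Db (b0_cont_within j).
Qed.

Context (kappa : R) (hkappa : 0 < kappa).
Hypothesis om_inj : forall i j, (om i == om j) = (i == j).
Hypothesis ha : forall i, a i * a i = 2 * om i / kappa.

(** For frozen p the added term is minus the mean of the first one over the fast time, hence a
    bounded primitive. Pairs of distinct frequencies have zero mean by [om_inj]; the diagonal
    cosines have mean 1/2, and [ha] turns a_i^2 / (2 om_i) into 1 / kappa; the terms in [Db] carry a
    sine, alone or times a cosine, and have zero mean. *)
Lemma slow_field_primitive :
  exists2 Psi : 'cV[R]_n * R -> R -> R,
    forall p s, is_derive s (1 : R) (Psi p)
      (dotv (grad J p.1) (slow_field om a b Db J k p s)
       + k / kappa * \sum_(i < r) dotv (grad J p.1) (b i p.1 p.2) ^+ 2) &
    unif_on K Psi.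
Proof.
have /choice[f hf] (ij : 'I_r * 'I_r) := trig_product_primitive (V := ('cV[R]_n * R)%type) (om_gt0 ij.1) (om_gt0 ij.2).
have /choice[g hg] (ij : 'I_r * 'I_r) := hf ij.
have /choice[h hh] (i : 'I_r) := trig_primitive (V := ('cV[R]_n * R)%type) 1 (negbT (gt_eqF (om_gt0 i))).
pose SC i j := f (i, j); pose CC i j := g (i, j).
pose al i (p : 'cV[R]_n * R) := dotv (grad J p.1) (b i p.1 p.2).
pose be i j (p : 'cV[R]_n * R) := dotv (grad J p.1) (Db i p (b j p.1 p.2, 0)).
pose ga i (p : 'cV[R]_n * R) := dotv (grad J p.1) (Db i p (0, 1)).
pose ph (p : 'cV[R]_n * R) := k * J p.1.
exists (fun p s => - 1 * \sum_(i < r) a i / om i *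
   ((\sum_(j < r) (k * a j) * (al j p * al i p * CC i j (ph p) s)
     + \sum_(j < r) a j * (be i j p * SC i j (ph p) s)) + ga i p * h i (ph p) s)).
- move=> p s.
  have -> : dotv (grad J p.1) (slow_field om a b Db J k p s)
       + k / kappa * \sum_(i < r) dotv (grad J p.1) (b i p.1 p.2) ^+ 2 =
    - 1 * \sum_(i < r) a i / om i *
   ((\sum_(j < r) (k * a j) * (al j p * al i p * (cos (om i * s + ph p) * cos (om j * s + ph p) - (om i == om j)%:R / 2))
     + \sum_(j < r) a j * (be i j p * (sin (om i * s + ph p) * cos (om j * s + ph p))))
      + ga i p * sin (om i * s + 1 * ph p)).
    rewrite /slow_field dotvNr dotv_sumr mulN1r mulr_sumr addrC -opprB -sumrB.
    congr (- _); apply: eq_bigr => i _.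
    rewrite dotvZr dotvDr !dotvZr dotvDr dotv_sumr mul1r /phase -/(ph p) -/(al i p) -/(ga i p).
    under [X in _ = _ * (_ + X + _)]eq_bigr => j _.
      rewrite (_ : a j * _ = sin (om i * s + ph p) * (a j * cos (om j * s + ph p) * be i j p)); last by ring.
      over.
    under [X in _ * (_ + _ * (X + _)) - _]eq_bigr => j _ do rewrite dotvZr -/(be i j p).
    rewrite -mulr_sumr.
    under [X in _ = _ * (X + _ + _)]eq_bigr => j _.
      rewrite (_ : k * a j * _ = (k * cos (om i * s + ph p) * al i p) * (a j * cos (om j * s + ph p) * al j p)
        - k * a j * (al j p * al i p * ((om i == om j)%:R / 2))); last by ring.
      over.
    rewrite sumrB -mulr_sumr.
    have hs : \sum_(j < r) k * a j * (al j p * al i p * ((om i == om j)%:R / 2)) =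
        k * a i * (al i p * al i p * (1 / 2)).
      rewrite (bigD1 i)//= eqxx big1 ?addr0// => j ji.
      by rewrite om_inj eq_sym (negbTE ji) mul0r !mulr0.
    rewrite hs.
    rewrite -/(al i p).
    have -> : k / kappa * al i p ^+ 2 = a i / om i * (k * a i * (al i p * al i p * (1 / 2))).
      rewrite (_ : a i / om i * _ = (a i * a i) * k * al i p ^+ 2 / 2 / om i); last by field; rewrite gt_eqF.
      by rewrite ha; field; rewrite !gt_eqF.
    rewrite [X in k * _ * X](_ : _ = \sum_(j < r) a j * cos (om j * s + ph p) * al j p)//.
    by ring.
  apply: is_derive_scalel; apply: is_derive_sum_pt => i; apply: is_derive_scalel.
  apply: is_derive_add_pt; last by apply: is_derive_scalel; have [C [hS _ _ _]] := hh i; exact: hS.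
  apply: is_derive_add_pt; apply: is_derive_sum_pt => j; apply: is_derive_scalel; apply: is_derive_scalel.
    by have [_ hC _ _] := hg (i, j); exact: hC.
  by have [hS _ _ _] := hg (i, j); exact: hS.
- have uph : unif_on K (fun p _ => ph p) by exact: unif_J.
  have ual i : unif_on K (fun p _ => al i p).
    apply: (unif_dotv (u := fun p _ => grad J p.1) (v := fun p _ => b i p.1 p.2)) => l.
      exact: unif_grad.
    exact: unif_b.
  have ube i j : unif_on K (fun p _ => be i j p).
    apply: (unif_dotv (u := fun p _ => grad J p.1) (v := fun p _ => Db i p (b j p.1 p.2, 0))) => l.
      exact: unif_grad.
    exact: unif_Db (b0_cont_within j).
  have uga i : unif_on K (fun p _ => ga i p).
    apply: (unif_dotv (u := fun p _ => grad J p.1) (v := fun p _ => Db i p (0, 1))) => l.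
      exact: unif_grad.
    exact: unif_Db (cst_cont_within _).
  apply: unif_on_scale; apply: unif_on_sum => i; apply: unif_on_scale; apply: unif_on_add.
    apply: unif_on_add; apply: unif_on_sum => j; apply: unif_on_scale; apply: unif_on_mul => //.
    + exact: unif_on_mul.
    + by have [_ _ _ uC] := hg (i, j); exact: uC.
    + by have [_ _ uS _] := hg (i, j); exact: uS.
  by apply: unif_on_mul => //; have [C [_ _ uS _]] := hh i; exact: uS.
Qed.

End SlowFieldRegularity.

(* The slow clock is frozen before t0, so that it stays in the half line where
   the vector fields are regular. *)
Definition slow_clock {R : realType} (eps sig t0 t : R) : R :=
  sig + eps^-1 * (Num.max t0 t - t0).

Definition fast_clock {R : realType} (eps s0 t0 t : R) : R :=
  s0 + eps ^- 2 * (t - t0).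

(** * Averaging over one period of the slow clock *)

Section Window.
Context {R : realType} {n r : nat}.
Context (om a : 'I_r -> R) (b : 'I_r -> 'cV[R]_n -> R -> 'cV[R]_n).
Context (Db : 'I_r -> 'cV[R]_n * R -> {linear ('cV[R]_n * R)%type -> 'cV[R]_n}).
Context (J : 'cV[R]_n -> R) (DJ : 'cV[R]_n -> {linear 'cV[R]_n -> R}).
Context (k LJ kappa mu T1 : R) (Q : 'cV[R]_n -> R).

Let S := [set p : 'cV[R]_n * R | 0 <= p.2].

Hypothesis om_gt0 : forall i, 0 < om i.
Hypothesis hb : forall i p, S p ->
  deriv_within S (fun p => b i p.1 p.2) p (Db i p).
Hypothesis hDb : forall i p, S p ->
  exists (U : set ('cV[R]_n * R)) (c : R), nbhs p U /\
    forall q q', U q -> S q -> U q' -> S q' ->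
      forall v, `|Db i q v - Db i q' v| <= c * `|q - q'| * `|v|.
Hypothesis hDJ : forall x, deriv_within setT J x (DJ x).
Hypothesis hLJ : 0 < LJ.
Hypothesis hlip : forall x x', norm2 (grad J x - grad J x') <= LJ * norm2 (x - x').
Hypothesis hkappa : 0 < kappa.
Hypothesis om_inj : forall i j, (om i == om j) = (i == j).
Hypothesis ha : forall i, a i * a i = 2 * om i / kappa.
Hypothesis hmu : 0 < mu.
Hypothesis hconv : strongly_convex mu J.
Hypothesis hT1 : 0 < T1.
Hypothesis hQ : forall x, exists2 Th : R -> R,
  forall s : R, 0 <= s ->
    is_derive s (1 : R) Th (\sum_(i < r) dotv (grad J x) (b i x s) ^+ 2) &
  forall s : R, 0 <= s -> Th (s + T1) - Th s = T1 * Q x.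

Local Notation near_id := (near_id om a b J k).
Local Notation es_field := (es_field om a b J k).
Local Notation slow_field := (slow_field om a b Db J k).

Lemma unif_norm2_bounded (K : set ('cV[R]_n * R)) (u : 'cV[R]_n * R -> R -> 'cV[R]_n) :
  (forall l, unif_on K (fun p s => u p s l 0)) ->
  exists C : R, forall p, K p -> forall s, norm2 (u p s) <= C.
Proof.
move=> hu; have [[C hC] _] := unif_dotv hu hu.
(* The inequality y <= 1 + y^2 replaces a square root. *)
exists (1 + C) => p Kp s; have := hC p Kp s; rewrite -norm2_sqr.
rewrite ger0_norm ?sqr_ge0//; have := norm2_ge0 (u p s); nra.
Qed.

Definition displacement (p : 'cV[R]_n * R) s : 'cV[R]_n :=
  \sum_(i < r) (a i / om i * sin (phase om J k i p.1 s)) *: b i p.1 p.2.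

Lemma near_idE eps x t1 t2 :
  near_id eps x t1 t2 = x - eps *: displacement (x, t1) t2.
Proof. by []. Qed.

Lemma compact_bounds (K : set ('cV[R]_n * R)) : compact K -> K `<=` S ->
  exists2 C : R, 0 < C & forall p, K p -> forall s,
    [/\ norm2 (displacement p s) <= C, norm2 (slow_field p s) <= C &
        norm2 (grad J p.1) <= C].
Proof.
move=> cK KS.
have [C1 h1] : exists C : R, forall p, K p -> forall s, norm2 (displacement p s) <= C.
  apply: unif_norm2_bounded => l.
  rewrite (_ : (fun _ _ => _) = fun p s => \sum_(i < r) (a i / om i)
     * (sin (om i * s + k * J p.1) * b i p.1 p.2 l 0)); last first.
    apply/funext => p; apply/funext => s; rewrite summxE.
    by apply: eq_bigr => i _; rewrite mxE mulrA.
  apply: unif_on_sum => i; apply: unif_on_scale; apply: unif_on_mul.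
    by have [] := unif_on_sin_cos (om i) (unif_J k hDJ cK).
  exact: (unif_b hb).
have [C2 h2] : exists C : R, forall p, K p -> forall s, norm2 (slow_field p s) <= C.
  apply: unif_norm2_bounded => l.
  exact: (unif_slow_field om a k hb hDb hDJ hLJ hlip cK KS).
have [C3 h3] : exists C : R, forall p, K p -> forall s : R, norm2 (grad J p.1) <= C.
  apply: (unif_norm2_bounded (u := fun p _ => grad J p.1)) => l.
  exact: (unif_grad hLJ hlip cK).
exists (`|C1| + `|C2| + `|C3| + 1) => [|p Kp s].
  by rewrite ltr_wpDl// !addr_ge0.
have := ler_norm C1; have := ler_norm C2; have := ler_norm C3.
have := normr_ge0 C1; have := normr_ge0 C2; have := normr_ge0 C3.
by have := h1 p Kp s; have := h2 p Kp s; have := h3 p Kp s; split; lra.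
Qed.

Lemma cont_within_curve (W U : normedModType R) (D : set W) (f : W -> U) (c : R -> W) (t : R) :
  cont_within D f -> (forall s, D (c s)) -> {for t, continuous c} ->
  {for t, continuous (fun s => f (c s))}.
Proof.
move=> hf Dc cc; apply/cvgrPdist_le => e e0.
have : \forall s \near t, D (c s) -> `|f (c s) - f (c t)| <= e.
  exact: cc _ (hf _ (Dc t) e e0).
by apply: filterS => s h; rewrite distrC; exact: h.
Qed.

Section Trajectory.
Context (K : set ('cV[R]_n * R)) (C eps t0 h sig s0 : R) (x : R -> 'cV[R]_n).
Hypothesis hC0 : 0 < C.
Hypothesis hC : forall p, K p -> forall s,
    [/\ norm2 (displacement p s) <= C, norm2 (slow_field p s) <= C &
        norm2 (grad J p.1) <= C].
Hypothesis he0 : 0 < eps.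
Hypothesis he1 : eps <= 1.

Lemma value_near_id p s : K p ->
  `|J (near_id eps p.1 p.2 s) - J p.1| <= eps * (C * (C + LJ * C)).
Proof.
move=> Kp; have [h1 _ h3] := hC Kp s.
have hd : norm2 (near_id eps p.1 p.2 s - p.1) <= eps * C.
  rewrite near_idE addrAC subrr add0r -scaleNr norm2Z normrN gtr0_norm//.
  by rewrite ler_pM2l//; case: (p) h1.
have hd' : eps * C <= C by rewrite -[leRHS]mul1r ler_wpM2r// ltW.
(* The transformed point may leave the compact set, so its gradient is bounded from that at [p.1]
   through the Lipschitz constant. *)
have hg : norm2 (grad J (near_id eps p.1 p.2 s)) <= C + LJ * C.
  have hl := hlip (near_id eps p.1 p.2 s) p.1.
  have htri : norm2 (grad J (near_id eps p.1 p.2 s)) <=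
     norm2 (grad J (near_id eps p.1 p.2 s) - grad J p.1) + norm2 (grad J p.1).
    move: (grad J _) (grad J p.1) => u v.
    rewrite -ler_sqr ?nnegrE ?addr_ge0 ?norm2_ge0//.
    have := dotv_le_norm2 (u - v) v; rewrite ler_norml => /andP[_].
    rewrite sqrrD !norm2_sqr !(dotvBl, dotvBr) (dotvC v u); lra.
  have : LJ * norm2 (near_id eps p.1 p.2 s - p.1) <= LJ * C by rewrite ler_pM2l//; lra.
  lra.
have hg' : norm2 (grad J p.1) <= C + LJ * C.
  by apply: le_trans h3 _; rewrite lerDl mulr_ge0// ltW.
apply: le_trans (value_diff_le hDJ hmu hconv hg hg') _.
rewrite (_ : eps * (C * (C + LJ * C)) = (C + LJ * C) * (eps * C)); last by ring.
by rewrite ler_wpM2l// addr_ge0// ?mulr_ge0// ltW.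
Qed.

Hypothesis hsig : 0 <= sig.
Hypothesis hh : 0 <= h.
Let tau1 := slow_clock eps sig t0.
Let tau2 := fast_clock eps s0 t0.
Hypothesis hx : forall t, t0 <= t <= t0 + h -> {for t, continuous x}.
Hypothesis hK : forall t, t0 <= t <= t0 + h -> K (x t, tau1 t).
Hypothesis hode : forall t, t0 < t < t0 + h ->
  is_derive t (1 : R) x (es_field eps (x t) (tau1 t) (tau2 t)).

Let xi t := near_id eps (x t) (tau1 t) (tau2 t).

Lemma tau1_ge0 t : 0 <= tau1 t.
Proof.
rewrite /tau1 /slow_clock addr_ge0// mulr_ge0// ?invr_ge0 ?subr_ge0 ?le_max ?lexx//.
exact: ltW.
Qed.

Lemma tau1_continuous : continuous tau1.
Proof.
move=> t; rewrite /tau1 /slow_clock; apply: cvgD; first exact: cvg_cst.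
apply: cvgM; first exact: cvg_cst.
by apply: cvgB; [apply: continuous_max => //; exact: cvg_cst|exact: cvg_cst].
Qed.

Lemma is_derive_tau1 t : t0 < t -> is_derive t (1 : R) tau1 eps^-1.
Proof.
move=> lt; have := is_derive_affine (sig - eps^-1 * t0) eps^-1 t.
apply: near_eq_is_derive; near=> s.
rewrite /tau1 /slow_clock max_r; first by ring.
by apply: ltW; near: s; exact: lt_nbhsr.
Unshelve. all: by end_near. Qed.

Lemma is_derive_tau2 t : is_derive t (1 : R) tau2 (eps ^- 2).
Proof.
have := is_derive_affine (s0 - eps ^- 2 * t0) (eps ^- 2) t.
rewrite (_ : (fun s => _) = tau2)//; apply/funext => s; rewrite /tau2 /fast_clock; ring.
Qed.

Lemma is_derive_xi t : t0 < t < t0 + h ->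
  is_derive t (1 : R) xi (slow_field (x t, tau1 t) (tau2 t)).
Proof.
move=> /[dup] /andP[l1 _] lt.
have t1 : 0 < tau1 t.
  rewrite /tau1 /slow_clock max_r ?ltW// ltr_wpDl// mulr_gt0 ?invr_gt0// subr_gt0//.
apply: (is_derive_near_id om_gt0 hb hDJ) => //; last exact: hode.
  exact: is_derive_tau1.
exact: is_derive_tau2.
Qed.

Lemma continuous_entry m (f : R -> 'cV[R]_m) t l :
  {for t, continuous f} -> {for t, continuous (fun s => f s l 0)}.
Proof.
move=> cf; apply: (@continuous_comp _ _ _ f (fun M : 'cV[R]_m => M l 0)) => //.
exact: coord_continuous.
Qed.

Lemma continuous_xi t : t0 <= t <= t0 + h -> {for t, continuous xi}.
Proof.
move=> ht; have cx := hx ht.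
have cc : {for t, continuous (fun s => (x s, tau1 s))}.
  have ct : {for t, continuous tau1} by exact: tau1_continuous.
  exact: (cvg_pair cx ct).
have cJ : {for t, continuous (fun s => J (x s))}.
  apply: (cont_within_curve (D := setT)) cx => //.
  by apply: (cont_within_deriv (L := DJ)) => y _; exact: hDJ.
have ct2 : {for t, continuous tau2} by exact: is_derive_continuous (is_derive_tau2 t).
have csum : {for t, continuous (fun s => \sum_(i < r) (a i / om i * sin (phase om J k i (x s) (tau2 s))) *: b i (x s) (tau1 s))}.
  apply: cvg_big => [|i _]; first exact: add_continuous.
  apply: cvgZ; last first.
    apply: (cont_within_curve (D := S) (f := fun p => b i p.1 p.2)) cc => //.
      exact: (b_cont_within hb).
    by move=> s; exact: tau1_ge0.
  apply: cvgM; first exact: cvg_cst.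
  apply: (cvg_comp _ sin); last exact: continuous_sin.
  apply: cvgD; first by apply: cvgM => //; exact: cvg_cst.
  by apply: cvgM => //; exact: cvg_cst.
by apply: cvgB => //; apply: cvgZ => //; exact: cvg_cst.
Qed.

Let G (p : 'cV[R]_n * R) s := dotv (grad J p.1) (slow_field p s).

Lemma near_id_dist t : t0 <= t <= t0 + h -> norm2 (x t - xi t) <= eps * C.
Proof.
move=> ht; have [h1 _ _] := hC (hK ht) (tau2 t).
by rewrite /xi near_idE opprB addrCA subrr addr0 norm2Z gtr0_norm// ler_pM2l.
Qed.

(** The chain rule evaluates the gradient at xi, whereas [G] evaluates it at x; the two points are
    eps C apart. *)
Lemma is_derive_value t : t0 < t < t0 + h ->
  exists2 dW, is_derive t (1 : R) (fun s => J (xi s)) dW &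
    `|dW - G (x t, tau1 t) (tau2 t)| <= eps * (LJ * C * C).
Proof.
move=> ht; have Dxi := is_derive_xi ht.
have ht' : t0 <= t <= t0 + h by lra.
exists (dotv (grad J (xi t)) (slow_field (x t, tau1 t) (tau2 t))).
  rewrite -(derive_grad hDJ).
  by apply: (is_derive_comp_within (S := setT) (f := J)) => //; near=> s.
have [_ h2 _] := hC (hK ht') (tau2 t).
rewrite /G -dotvBl; apply: le_trans (dotv_le_norm2 _ _) _.
rewrite [leRHS](_ : _ = (LJ * (eps * C)) * C); last by ring.
apply: ler_pM => //; try exact: norm2_ge0.
apply: le_trans (hlip _ _) _; rewrite ler_pM2l//=.
by have := near_id_dist ht'; rewrite -opprB -scaleN1r norm2Z normrN normr1 mul1r.
Unshelve. all: by end_near. Qed.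

Lemma continuous_value t : t0 <= t <= t0 + h -> {for t, continuous (fun s => J (xi s))}.
Proof.
move=> /continuous_xi; apply: (cont_within_curve (D := setT)) => //.
by apply: (cont_within_deriv (L := DJ)) => y _; exact: hDJ.
Qed.

(** The velocity of x is of order 1 / eps, so the drift is measured on xi, whose velocity is bounded
    by C; passing from x to xi at both ends costs 2 eps C. *)
Lemma x_drift t : t0 <= t <= t0 + h ->
  `|x t - x t0| <= C * (t - t0) + 2 * (eps * C).
Proof.
move=> ht; have hxi : `|xi t - xi t0| <= C * (t - t0).
  have t0t : t0 <= t by lra.
  apply/mx_norm_leP => [|l j]; first by rewrite mulr_ge0 ?subr_ge0// ltW.
  rewrite ord1 mxE [X in _ + X]mxE.
  apply: (@mean_value_abs R t0 t C (fun s => xi s l 0)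
     (fun s => slow_field (x s, tau1 s) (tau2 s) l 0)) => // s hs.
    by apply: continuous_entry; apply: continuous_xi; lra.
  have hs' : t0 < s < t0 + h by lra.
  split; first by move: l; apply/is_derive_colP; exact: is_derive_xi.
  have hs'' : t0 <= s <= t0 + h by lra.
  have [_ h2 _] := hC (hK hs'') (tau2 s).
  by apply: le_trans (mx_entry_le _ _ _) _; apply: le_trans (norm_le_norm2 _) h2.
have ht0 : t0 <= t0 <= t0 + h by lra.
have h1 := le_trans (norm_le_norm2 _) (near_id_dist ht).
have h2 := le_trans (norm_le_norm2 _) (near_id_dist ht0).
have -> : x t - x t0 = (x t - xi t) + (xi t - xi t0) - (x t0 - xi t0).
  move: (x t) (x t0) (xi t) (xi t0) => p q u v.
  by rewrite opprB !addrA !subrK.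
apply: le_trans (ler_normB _ _) _; have := ler_normD (x t - xi t) (xi t - xi t0).
lra.
Qed.

Lemma value_drift t : t0 <= t <= t0 + h ->
  `|J (xi t) - J (xi t0)| <= (C * C + LJ * C * C) * (t - t0).
Proof.
move=> ht; have t0t : t0 <= t by lra.
pose dW s := 'D_1 (fun s => J (xi s)) s.
apply: (@mean_value_abs R t0 t _ (fun s => J (xi s)) dW) => // s hs.
  by apply: continuous_value; lra.
have hs' : t0 < s < t0 + h by lra.
have hs'' : t0 <= s <= t0 + h by lra.
have [v Dv hv] := is_derive_value hs'.
have -> : dW s = v by rewrite /dW; case: Dv.
split=> //; have [_ h2 h3] := hC (hK hs'') (tau2 s).
have hG : `|G (x s, tau1 s) (tau2 s)| <= C * C.
  by apply: le_trans (dotv_le_norm2 _ _) _; apply: ler_pM => //; exact: norm2_ge0.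
have := ler_normD (v - G (x s, tau1 s) (tau2 s)) (G (x s, tau1 s) (tau2 s)).
rewrite subrK; have : eps * (LJ * C * C) <= LJ * C * C.
  by rewrite -[leRHS]mul1r ler_wpM2r// !mulr_ge0// ltW.
lra.
Qed.

End Trajectory.

(* [lra] considers every hypothesis in scope, which is slow in long proofs. *)
Local Tactic Notation "lra_from" ne_hyp_list(Hs) :=
  clear - Hs om_gt0 hb hDb hDJ hLJ hlip hkappa om_inj ha hmu hconv hT1 hQ; lra.

Lemma near0_mul_le (A c : R) : 0 < c -> \forall eps \near 0^'+, eps * A <= c.
Proof.
move=> c0; have A0 : 0 < `|A| + 1 by rewrite ltr_wpDl.
near=> eps; have e0 : 0 < eps by near: eps; exact: nbhs_right_gt.
have h : eps <= c / (`|A| + 1) by near: eps; apply: nbhs_right_le; rewrite divr_gt0.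
have := ler_norm A; move: h; rewrite ler_pdivlMr//; nra.
Unshelve. all: by end_near. Qed.

(** The only fact about averaging that the flow estimates use. The first three bounds hold for
    incomplete windows too; the last one has an error proportional to h, so it can be summed over
    the many windows of a flow interval. *)
Definition window_estimate : Prop := forall (B : set 'cV[R]_n) (e : R),
  compact B -> 0 < e ->
  \forall eps \near 0^'+, forall (x : R -> 'cV[R]_n) (t0 h sig s0 : R),
    0 <= h -> h <= eps * T1 -> 0 <= sig -> sig <= T1 ->
    (forall t, t0 <= t <= t0 + h -> {for t, continuous x}) ->
    (forall t, t0 <= t <= t0 + h -> B (x t)) ->
    (forall t, t0 < t < t0 + h -> is_derive t (1 : R) x
       (es_field eps (x t) (slow_clock eps sig t0 t) (fast_clock eps s0 t0 t))) ->
    let W t := J (near_id eps (x t) (slow_clock eps sig t0 t) (fast_clock eps s0 t0 t)) in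
    [/\ `|W t0 - J (x t0)| <= e, `|W (t0 + h) - J (x (t0 + h))| <= e,
        `|W (t0 + h) - W t0| <= e &
        h = eps * T1 -> W (t0 + h) <= W t0 - h * (k / kappa * Q (x t0)) + e * h].

(* Over one period of the slow clock the state is frozen at its initial value.
   The period is cut into M pieces, M depending on e only; on each piece the
   slow clock is frozen as well, and the fast oscillation is integrated
   explicitly through its bounded primitive. *)
Lemma averaging_window : window_estimate.
Proof.
move=> B e cB e0.
(* The slow clock starts in [0, T1] and advances by at most T1 during a window. *)
pose K : set ('cV[R]_n * R) := B `*` `[0, 2 * T1].
have cK : compact K by apply: compact_setX => //; exact: segment_compact.
have KS : K `<=` S by move=> p [_ /=]; rewrite in_itv /= => /andP[].
have [C C0 hC] := compact_bounds cK KS.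
have [Psi dPsi [[M0 hM0'] _]] := slow_field_primitive k om_gt0 hb hDb hDJ hLJ hlip cK KS hkappa om_inj ha.
pose G (p : 'cV[R]_n * R) s := dotv (grad J p.1) (slow_field p s).
pose A (p : 'cV[R]_n * R) := k / kappa * \sum_(i < r) dotv (grad J p.1) (b i p.1 p.2) ^+ 2.
have ug l := unif_grad hLJ hlip cK l.
have [_ uG] : unif_on K G.
  apply: (unif_dotv (u := fun p _ => grad J p.1) (v := slow_field)) => // l.
  exact: (unif_slow_field om a k hb hDb hDJ hLJ hlip cK KS).
have [_ uA] : unif_on K (fun p _ => A p).
  apply: unif_on_scale; apply: unif_on_sum => i.
  have ub : unif_on K (fun p _ => dotv (grad J p.1) (b i p.1 p.2)).
    apply: (unif_dotv (u := fun p _ => grad J p.1) (v := fun p _ => b i p.1 p.2)) => // l.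
    exact: (unif_b hb).
  exact: unif_on_mul.
have e8 : 0 < e / 8 by rewrite divr_gt0.
have [d1 d10 hd1] := uG _ e8; have [d2 d20 hd2] := uA _ e8.
pose d := Num.min d1 d2; have d0 : 0 < d by rewrite lt_min d10.
pose M := (Num.bound (T1 / d)).+1.
have Mpos : 0 < M%:R :> R by rewrite ltr0n.
have hMd : T1 / M%:R < d.
  rewrite ltr_pdivrMr// mulrC -ltr_pdivrMr//.
  have := archi_boundP (divr_ge0 (ltW hT1) (ltW d0)) => h1.
  by apply: lt_le_trans h1 _; rewrite ler_nat.
pose CP := `|M0| + 1; have CP0 : 0 < CP by rewrite ltr_wpDl.
near=> eps.
have ep0 : 0 < eps by near: eps; exact: nbhs_right_gt.
have ep1 : eps <= 1 by near: eps; exact: nbhs_right_le.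
have c1 : eps * (C * (C + LJ * C)) <= e by near: eps; exact: near0_mul_le.
have c2 : eps * ((C * C + LJ * C * C) * T1) <= e by near: eps; exact: near0_mul_le.
have c3 : eps * (LJ * C * C) <= e / 4 by near: eps; apply: near0_mul_le; rewrite divr_gt0.
have c4 : eps * (C * T1 + 2 * C) <= d / 2 by near: eps; apply: near0_mul_le; rewrite divr_gt0.
(* Multiplied by eps, this bounds the boundary terms of the primitive over all M pieces by half of e
   h, as h = eps T1. *)
have c5 : eps * (2 * M%:R * CP) <= e / 2 * T1 by near: eps; apply: near0_mul_le; rewrite mulr_gt0// divr_gt0.
move=> x t0 h sig s0 h0 hT sig0 sigT cx xB ode.
have en0 : eps != 0 by rewrite gt_eqF.
pose tau1 := slow_clock eps sig t0; pose tau2 := fast_clock eps s0 t0.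
have tau1E t : t0 <= t -> tau1 t = sig + eps^-1 * (t - t0).
  by move=> t0t; rewrite /tau1 /slow_clock max_r.
have xK t : t0 <= t <= t0 + h -> K (x t, tau1 t).
  move=> ht; split; first exact: xB.
  have ht0 : t0 <= t by lra_from ht.
  rewrite /= in_itv /= tau1_ge0// tau1E//.
  have : eps^-1 * (t - t0) <= T1; last lra.
  by rewrite mulrC ler_pdivrMr// mulrC; lra.
have b0 : t0 <= t0 <= t0 + h by lra_from h0.
have b1 : t0 <= t0 + h <= t0 + h by lra_from h0.
split.
- by have := value_near_id C0 hC ep0 ep1 (tau2 t0) (xK _ b0) => /le_trans; apply.
- by have := value_near_id C0 hC ep0 ep1 (tau2 (t0 + h)) (xK _ b1) => /le_trans; apply.
- have := value_drift C0 hC ep0 ep1 sig0 (s0 := s0) cx xK ode b1 => /le_trans; apply.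
  rewrite addrAC subrr add0r; apply: le_trans c2.
  by rewrite [leRHS]mulrCA ler_wpM2l// addr_ge0// !mulr_ge0// ltW.
move=> hE.
have [Th dTh Thper] := hQ (x t0).
pose xi t := near_id eps (x t) (tau1 t) (tau2 t).
(* The expected decrease is added back with x frozen at t0 but the true slow clock, so that [g]
   should be almost constant; over a full period [Th] increases by exactly T1 Q(x t0). *)
pose g t := J (xi t) + k / kappa * (eps * Th (tau1 t)).
have hM0 : 0 <= h / M%:R by rewrite divr_ge0// ltW.
pose tm (j : nat) := t0 + h / M%:R * j%:R.
have tm_in j : (j <= M)%N -> t0 <= tm j <= t0 + h.
  move=> jM; rewrite /tm lerDl mulr_ge0//= lerD2l.
  by rewrite -[leRHS](divfK (lt0r_neq0 Mpos)) ler_wpM2l// ler_nat.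
have micro j : (j < M)%N ->
    `|g (tm j.+1) - g (tm j)| <= e / 2 * (h / M%:R) + 2 * eps ^+ 2 * CP.
  move=> jM; set u := tm j; set v := tm j.+1.
  have huv : v - u = h / M%:R by rewrite /u /v /tm -natr1; ring.
  have uv : u <= v by rewrite -subr_ge0 huv.
  have /andP[t0u _] : t0 <= u <= t0 + h by apply: tm_in; exact: ltnW.
  have /andP[_ vt] : t0 <= v <= t0 + h by exact: tm_in.
  pose p := (x t0, tau1 u).
  have Kp : K p.
    have [|_ htau] := xK u; first by lra_from t0u uv vt.
    by split => //; apply: xB.
  have hPsi t : `|eps ^+ 2 * Psi p (tau2 t)| <= eps ^+ 2 * CP.
    rewrite normrM (ger0_norm (sqr_ge0 _)) ler_wpM2l ?sqr_ge0//.
    by have := hM0' p Kp (tau2 t); have := ler_norm M0; rewrite /CP; lra_from Mpos.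
  (* Since tau_2 runs at speed eps^-2, the subtracted term has derivative [G p (tau2 t) + A p]. What
     is left in the derivative of [f] is the error of [is_derive_value] and the effect of freezing
     p, at most e/4 + e/8 + e/8. *)
  pose f t := g t - eps ^+ 2 * Psi p (tau2 t).
  have hf : `|f v - f u| <= e / 2 * (v - u).
    pose df t := 'D_1 f t.
    apply: (mean_value_abs (df := df)) => // t ht.
      have ht' : t0 <= t <= t0 + h by lra_from ht t0u vt.
      apply: cvgB.
        apply: cvgD; first exact: (continuous_value ep0 sig0 cx ht').
        apply: cvgM; first exact: cvg_cst.
        apply: cvgM; first exact: cvg_cst.
        apply: (@continuous_comp _ _ _ tau1 Th); first exact: tau1_continuous.
        by apply: (is_derive_continuous (dTh _ _)); exact: tau1_ge0.
      apply: cvgM; first exact: cvg_cst.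
      apply: (@continuous_comp _ _ _ tau2 (Psi p)).
        exact: is_derive_continuous (is_derive_tau2 _ _ _ _).
      exact: is_derive_continuous (dPsi p _).
    have ht' : t0 < t < t0 + h by lra_from ht t0u vt.
    have ht'' : t0 <= t <= t0 + h by lra_from ht'.
    have [dW DW hW] := is_derive_value hC ep0 sig0 xK ode ht'.
    have Df : is_derive t (1 : R) f
       (dW + A (x t0, tau1 t) - (G p (tau2 t) + A p)).
      have DTh : is_derive t (1 : R) (fun s => k / kappa * (eps * Th (tau1 s))) (A (x t0, tau1 t)).
        have -> : A (x t0, tau1 t) = k / kappa * (eps *
            ((\sum_(i < r) dotv (grad J (x t0)) (b i (x t0) (tau1 t)) ^+ 2) * eps^-1)).
          by rewrite /A /=; field; rewrite en0 gt_eqF.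
        apply: is_derive_scalel; apply: is_derive_scalel.
        apply: (is_derive_comp_pt (f := Th) (g := tau1)).
          by apply: dTh; exact: tau1_ge0.
        by apply: is_derive_tau1; lra_from ht'.
      have DPsi : is_derive t (1 : R) (fun s => eps ^+ 2 * Psi p (tau2 s)) (G p (tau2 t) + A p).
        have -> : G p (tau2 t) + A p = eps ^+ 2 * ((G p (tau2 t) + A p) * eps ^- 2).
          by rewrite mulrCA divff ?mulr1// expf_neq0.
        apply: is_derive_scalel.
        apply: (is_derive_comp_pt (f := Psi p) (g := tau2)); first exact: dPsi.
        exact: is_derive_tau2.
      have D1 := is_derive_add_pt DW DTh.
      have := is_derive_add_pt D1 (is_derive_scalel (-1) DPsi).
      rewrite mulN1r (_ : (fun s => _) = f)//.
      by apply/funext => s; rewrite /f mulN1r.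
    have -> : df t = dW + A (x t0, tau1 t) - (G p (tau2 t) + A p) by rewrite /df; case: Df.
    split => //.
    have dtau : `|tau1 t - tau1 u| < d.
      rewrite !tau1E//; last by lra_from ht''.
      rewrite (_ : _ - _ = eps^-1 * (t - u)); last by ring.
      rewrite ger0_norm; last by rewrite mulr_ge0// ?invr_ge0 ?subr_ge0 ltW//; lra_from ht.
      apply: le_lt_trans hMd; rewrite mulrC ler_pdivrMr//.
      by rewrite mulrAC [T1 * _]mulrC -hE; lra_from ht huv.
    have dx : `|x t - x t0| < d.
      have := x_drift C0 hC ep0 sig0 cx xK ode ht''.
      have : C * (t - t0) <= C * (eps * T1).
        by rewrite ler_pM2l//; lra_from ht'' hT.
      lra_from c4 d0.
    have K1 : K (x t, tau1 t) by exact: xK.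
    have K2 : K (x t0, tau1 t) by case: K1 => _ ?; split => //; exact: xB.
    have g1 : `|G (x t, tau1 t) (tau2 t) - G p (tau2 t)| <= e / 8.
      apply: hd1 => //; rewrite /Num.Def.normr /= gt_max.
      apply/andP; split; first by apply: lt_le_trans dx _; rewrite ge_min lexx.
      by apply: lt_le_trans dtau _; rewrite ge_min lexx.
    have g2 : `|A (x t0, tau1 t) - A p| <= e / 8.
      apply: (hd2 _ _ _ _ _ 0) => //; rewrite /Num.Def.normr /= gt_max.
      apply/andP; split; first by rewrite (_ : fst _ = x t0 - x t0)// subrr normr0.
      by apply: lt_le_trans dtau _; rewrite ge_min lexx orbT.
    have -> : dW + A (x t0, tau1 t) - (G p (tau2 t) + A p) =
      (dW - G (x t, tau1 t) (tau2 t)) + (G (x t, tau1 t) (tau2 t) - G p (tau2 t))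
       + (A (x t0, tau1 t) - A p) by ring.
    have := ler_normD (dW - G (x t, tau1 t) (tau2 t) + (G (x t, tau1 t) (tau2 t) - G p (tau2 t))) (A (x t0, tau1 t) - A p).
    have := ler_normD (dW - G (x t, tau1 t) (tau2 t)) (G (x t, tau1 t) (tau2 t) - G p (tau2 t)).
    move: hW; rewrite -/(G _ _); lra_from c3 g1 g2.
  have := hPsi u; have := hPsi v; move: hf.
  rewrite huv /f !ler_norml; lra_from huv.
have total j : (j <= M)%N ->
    `|g (tm j) - g (tm 0%N)| <= j%:R * (e / 2 * (h / M%:R) + 2 * eps ^+ 2 * CP).
  elim: j => [_|j ih jM]; first by rewrite subrr normr0 mul0r.
  have h1 := ih (ltnW jM); have h2 := micro j jM.
  have := ler_distD (g (tm j)) (g (tm j.+1)) (g (tm 0%N)).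
  by rewrite -natr1 mulrDl mul1r; lra_from h1 h2.
have := total M (leqnn M).
have -> : tm 0%N = t0 by rewrite /tm mulr0 addr0.
have -> : tm M = t0 + h by rewrite /tm divfK// gt_eqF.
have -> : M%:R * (e / 2 * (h / M%:R) + 2 * eps ^+ 2 * CP) =
  e / 2 * h + eps * (eps * (2 * M%:R * CP)) by field; rewrite gt_eqF.
have : eps * (eps * (2 * M%:R * CP)) <= eps * (e / 2 * T1) by rewrite ler_pM2l.
have hTh : Th (tau1 (t0 + h)) - Th (tau1 t0) = T1 * Q (x t0).
  rewrite -(Thper sig sig0) !tau1E ?lerDl// subrr mulr0 addr0 addrAC subrr add0r hE.
  by rewrite mulrA mulVf// mul1r.
rewrite /g ler_norml => h1 /andP[_].
have -> : J (xi (t0 + h)) + k / kappa * (eps * Th (tau1 (t0 + h))) -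
   (J (xi t0) + k / kappa * (eps * Th (tau1 t0))) =
   J (xi (t0 + h)) - J (xi t0) + k / kappa * (eps * (Th (tau1 (t0 + h)) - Th (tau1 t0))) by ring.
rewrite hTh => h2.
have : h * (k / kappa * Q (x t0)) = k / kappa * (eps * (T1 * Q (x t0))) by rewrite hE; ring.
have : e * h = e / 2 * h + eps * (e / 2 * T1) by rewrite hE; field.
rewrite /xi in h2; move: h2; rewrite /tau1 /tau2.
lra_from h1.
Unshelve. all: by end_near. Qed.

End Window.

(** * The averaged gain as an increment over a period *)

Section AveragedGain.
Context {R : realType} {n r : nat}.
Context (b : 'I_r -> 'cV[R]_n -> R -> 'cV[R]_n) (T1 : R).
Hypothesis hT1 : 0 < T1.
Hypothesis hper : forall i x s, 0 <= s -> b i x (s + T1) = b i x s.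
Hypothesis hcont : forall i,
  cont_within [set p : 'cV[R]_n * R | 0 <= p.2] (fun p => b i p.1 p.2).

(** The square of the inner product is expanded into entries of b_i b_i^T, each with its own
    primitive; periodicity makes the increment over [s, s + T1] independent of s. With v = grad J(x)
    this supplies [hQ]. *)
Lemma averaged_gain_primitive (x v : 'cV[R]_n) :
  exists2 Th : R -> R,
    forall s : R, 0 <= s ->
      is_derive s (1 : R) Th (\sum_(i < r) dotv v (b i x s) ^+ 2) &
    forall s : R, 0 <= s ->
      Th (s + T1) - Th s = T1 * (v^T *m averaged_gain T1 b x *m v) 0 0.
Proof.
(* The absolute value extends the entries evenly to negative times, where nothing is assumed on b,
   into functions continuous on the whole line. *)
pose f (ikl : 'I_r * 'I_n * 'I_n) (s : R) : R :=
  (b ikl.1.1 x `|s| *m (b ikl.1.1 x `|s|)^T) ikl.1.2 ikl.2.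
have fE i k l s : f (i, k, l) s = b i x `|s| k 0 * b i x `|s| l 0.
  by rewrite /f mxE big_ord1 !mxE.
have cf ikl : continuous (f ikl).
  case: ikl => [[i k] l] t.
  have cb m : {for t, continuous (fun s => b i x `|s| m 0)}.
    apply: continuous_entry.
    apply: (cont_within_curve (D := [set p : 'cV[R]_n * R | 0 <= p.2])
      (f := fun p => b i p.1 p.2) (c := fun s => (x, `|s|))) => //=.
    have ca : {for t, continuous (fun s : R => `|s|)} by exact: norm_continuous.
    have cx : {for t, continuous (fun _ : R => x)} by exact: cvg_cst.
    exact: (cvg_pair cx ca).
  rewrite (_ : f (i, k, l) = fun s => b i x `|s| k 0 * b i x `|s| l 0); last first.
    by apply/funext => s; exact: fE.
  by apply: cvgM; exact: cb.
have /choice[F hF] (ikl : 'I_r * 'I_n * 'I_n) : exists F : R -> R,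
    (forall s : R, 0 <= s -> is_derive s (1 : R) F (f ikl s)) /\
    F T1 - F 0 = \int[@lebesgue_measure R]_(s in `[0, T1]) f ikl s.
  by have [F h1 h2] := primitive_exists (cf ikl) (ltW hT1); exists F.
exists (fun s => \sum_(i < r) \sum_(k < n) \sum_(l < n) (v k 0 * v l 0) * F (i, k, l) s).
  move=> s s0; apply: is_derive_sum_pt => i.
  rewrite (_ : dotv v (b i x s) ^+ 2 =
    \sum_(k < n) \sum_(l < n) (v k 0 * v l 0) * f (i, k, l) s); last first.
    rewrite expr2 /dotv mulr_suml; apply: eq_bigr => k _; rewrite mulr_sumr.
    by apply: eq_bigr => l _; rewrite fE ger0_norm//; ring.
  apply: is_derive_sum_pt => k; apply: is_derive_sum_pt => l.
  by apply: is_derive_scalel; have [h _] := hF (i, k, l); exact: h.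
move=> s s0; rewrite -sumrB.
have FE i k l : F (i, k, l) (s + T1) - F (i, k, l) s =
    \int[@lebesgue_measure R]_(u in `[0, T1]) (b i x u *m (b i x u)^T) k l.
  have [h1 h2] := hF (i, k, l).
  rewrite (primitive_periodic (ltW hT1) s0 _ h1) ?h2.
    apply: eq_Rintegral => u; rewrite inE /= in_itv /= => /andP[u0 _].
    by rewrite /f ger0_norm.
  by move=> u u0; rewrite !fE !ger0_norm ?addr_ge0// ?ltW// hper.
rewrite mxE; under eq_bigr => i _.
  rewrite -sumrB; under eq_bigr => k _.
    rewrite -sumrB; under eq_bigr => l _ do rewrite -mulrBr FE.
    over.
  over.
rewrite exchange_big mulr_sumr /=.
under eq_bigr => k _ do rewrite exchange_big /=.
rewrite exchange_big /=; apply: eq_bigr => l _.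
rewrite mxE mulr_suml mulr_sumr; apply: eq_bigr => k _.
rewrite !mxE summxE -mulr_sumr.
rewrite [X in _ = T1 * (_ * (_ * X) * _)](eq_bigr (fun i =>
  \int[@lebesgue_measure R]_(u in `[0, T1]) (b i x u *m (b i x u)^T) k l)); last first.
  by move=> i _; rewrite mxE.
by field; rewrite gt_eqF.
Qed.

End AveragedGain.

(** * Compactness of sublevel sets *)

Section Sublevel.
Context {R : realType}.

Lemma trmx_continuous m n : continuous (fun M : 'M[R]_(m, n) => M^T).
Proof.
move=> M; apply/(@cvgrPdist_le _ _ _ (nbhs M)) => e e0.
have := near_dist_le M e0; apply: filterS => N h.
apply/mx_norm_leP => [|i j]; first exact: ltW.
by have := mx_entry_le (M - N) j i; rewrite !mxE => /le_trans; apply.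
Qed.

Lemma sublevel_compact n (J : 'cV[R]_n -> R) (l rho : R) (xs : 'cV[R]_n) :
  continuous J -> (forall x, J x <= l -> norm2 (x - xs) <= rho) ->
  compact [set x | J x <= l].
Proof.
move=> cJ hJ.
(* Transposition moves the set to row vectors, to which [bounded_closed_compact] applies. *)
have -> : [set x | J x <= l] = (fun v : 'rV[R]_n => v^T) @` [set v | J v^T <= l].
  apply/seteqP; split => x /=; first by exists x^T; rewrite ?trmxK.
  by move=> [v hv <-].
apply: continuous_compact.
  by apply: continuous_subspaceT; exact: trmx_continuous.
apply: bounded_closed_compact.
  exists (rho + norm2 xs); split; first exact: num_real.
  move=> M hM v /= hv; apply: ltW; apply: le_lt_trans hM.
  apply/mx_norm_leP => [|i j].
    by rewrite addr_ge0 ?norm2_ge0// (le_trans (norm2_ge0 _) (hJ _ hv)).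
  rewrite ord1; have := mx_entry_le (v^T - xs) j 0.
  rewrite !mxE => h1; have := mx_entry_le xs j 0 => h2.
  have h3 := le_trans (norm_le_norm2 _) (hJ _ hv).
  have h4 := norm_le_norm2 xs.
  have := ler_normD (v 0 j - xs j 0) (xs j 0); rewrite subrK.
  lra.
apply: (@closed_comp _ _ (fun v : 'rV[R]_n => J v^T) [set y | y <= l]).
  move=> v _; apply: (@continuous_comp _ _ _ (fun v : 'rV[R]_n => v^T) J).
    exact: trmx_continuous.
  exact: cJ.
exact: closed_le.
Qed.

End Sublevel.

(** * Summation of window errors *)

Section Iteration.
Context {R : realType}.

(** A level independent of h that the recursion v -> exp(-rho h) v + e1 h does not exceed, because 1
    - exp(-rho h) >= rho h / (1 + rho h) >= rho h / (1 + rho). *)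
Lemma expR_fixpoint (rho h e1 : R) : 0 < rho -> 0 <= h -> h <= 1 -> 0 <= e1 ->
  expR (- (rho * h)) * (e1 * (1 + rho) / rho) + e1 * h <= e1 * (1 + rho) / rho.
Proof.
move=> rho0 h0 h1 e10; set q := expR _.
have hq : q * (1 + rho * h) <= 1.
  have := expR_ge1Dx (rho * h) => h2.
  have : q * (1 + rho * h) <= q * expR (rho * h) by rewrite ler_pM2l// expR_gt0.
  by rewrite -expRD addNr expR0.
have rh : 0 <= rho * h by rewrite mulr_ge0// ltW.
have h3 : rho * h <= (1 - q) * (1 + rho).
  have q1 : 0 <= 1 - q by rewrite subr_ge0 -expR0 ler_expR oppr_le0.
  have : (1 - q) * (1 + rho * h) <= (1 - q) * (1 + rho).
    by rewrite ler_wpM2l// lerD2l -[leRHS]mulr1 ler_pM2l.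
  lra.
have h4 : e1 * (rho * h) <= e1 * ((1 - q) * (1 + rho)) by rewrite ler_wpM2l.
rewrite -(ler_pM2l rho0).
have -> : rho * (q * (e1 * (1 + rho) / rho) + e1 * h) =
   q * (e1 * (1 + rho)) + e1 * (rho * h) by field; rewrite gt_eqF.
have -> : rho * (e1 * (1 + rho) / rho) = e1 * (1 + rho) by field; rewrite gt_eqF.
lra.
Qed.

(** The errors of the full windows stay below the level of [expR_fixpoint], however many there are;
    the cruder error [e2] is paid once, on the last incomplete window. *)
Lemma window_iteration (u : R -> R) (A B h rho e1 e2 : R) :
  0 < rho -> 0 < h -> h <= 1 -> 0 <= e1 ->
  (forall s, A <= s -> s + h <= B -> u (s + h) <= expR (- (rho * h)) * u s + e1 * h) ->
  (forall s d, A <= s -> 0 <= d -> d <= h -> s + d <= B ->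
     u (s + d) <= expR (- (rho * d)) * u s + e2) ->
  forall t, A <= t <= B ->
    u t <= expR (- (rho * (t - A))) * u A + e1 * (1 + rho) / rho + e2.
Proof.
move=> rho0 h0 h1 e10 full part t /andP[At tB].
set l := e1 * (1 + rho) / rho.
have l0 : 0 <= l by exact: divr_ge0 (mulr_ge0 e10 (addr_ge0 ler01 (ltW rho0))) (ltW rho0).
have it m : A + m%:R * h <= B ->
    u (A + m%:R * h) <= expR (- (rho * (m%:R * h))) * u A + l.
  elim: m => [_|m ih hm]; first by rewrite mul0r addr0 mulr0 oppr0 expR0 mul1r lerDl.
  have mh : A <= A + m%:R * h by rewrite lerDl mulr_ge0// ltW.
  have E : A + m.+1%:R * h = A + m%:R * h + h by rewrite -natr1; ring.
  rewrite E in hm *; apply: le_trans (full _ mh hm) _.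
  have hB : A + m%:R * h <= B by lra.
  have := expR_fixpoint rho0 (ltW h0) h1 e10; rewrite -/l => hl.
  have : expR (- (rho * h)) * u (A + m%:R * h) <=
      expR (- (rho * h)) * (expR (- (rho * (m%:R * h))) * u A + l).
    by rewrite ler_pM2l ?expR_gt0//; exact: ih.
  rewrite mulrDr mulrA -expRD.
  have -> : - (rho * h) + - (rho * (m%:R * h)) = - (rho * (m.+1%:R * h)).
    by rewrite -natr1; ring.
  lra.
pose m := Num.truncn ((t - A) / h).
have q0 : 0 <= (t - A) / h by rewrite divr_ge0 ?subr_ge0// ltW.
have /andP[hm1 hm2] := truncn_itv q0.
rewrite -/m in hm1 hm2.
have m1 : m%:R * h <= t - A by rewrite -ler_pdivlMr.
have m2 : t - A < m.+1%:R * h by rewrite -ltr_pdivrMr.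
have := part (A + m%:R * h) (t - A - m%:R * h).
rewrite (_ : A + m%:R * h + (t - A - m%:R * h) = t); last by ring.
move: m2; rewrite -natr1 => m2.
move=> /(_ ltac:(have := mulr_ge0 (ler0n R m) (ltW h0); lra) ltac:(lra) ltac:(lra) tB) H.
apply: le_trans H _; rewrite lerD2r.
set d := t - A - m%:R * h.
have hAm : A + m%:R * h <= B by lra.
have := it m hAm => H.
apply: (@le_trans _ _ (expR (- (rho * d)) * (expR (- (rho * (m%:R * h))) * u A + l))).
  by rewrite ler_pM2l ?expR_gt0.
rewrite mulrDr mulrA -expRD.
have -> : - (rho * d) + - (rho * (m%:R * h)) = - (rho * (t - A)) by rewrite /d; ring.
have d0 : 0 <= d by rewrite /d; lra.
by rewrite lerD2l -[leRHS]mul1r ler_wpM2r// -expR0 ler_expR oppr_le0 mulr_ge0// ltW.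
Qed.

End Iteration.

(** * Decay of the weighted value along a flow interval *)

Section Flow.
Context {R : realType} {n r : nat}.
Context (om a : 'I_r -> R) (b : 'I_r -> 'cV[R]_n -> R -> 'cV[R]_n).
Context (J : 'cV[R]_n -> R) (k kappa T1 : R) (Q : 'cV[R]_n -> R).
Context (Jmin cz rate th rho T0 : R).
Hypothesis hT1 : 0 < T1.
Hypothesis hper : forall i x s, 0 <= s -> b i x (s + T1) = b i x s.
Hypothesis hwin : window_estimate om a b J k kappa T1 Q.
Hypothesis hJmin : forall x, Jmin <= J x.
Hypothesis hcz : forall x, cz * (J x - Jmin) <= k / kappa * Q x.
Hypothesis hrho : 0 < rho.
Hypothesis hth : 0 <= th.
Hypothesis hrate : th * rate - cz <= - rho.

Local Notation near_id := (near_id om a b J k).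
Local Notation es_field := (es_field om a b J k).

Local Tactic Notation "lra_from" ne_hyp_list(Hs) :=
  clear - Hs hT1 hper hwin hJmin hcz hrho hth hrate; lra.

Lemma b_shift i x s (m : nat) : 0 <= s -> b i x (s + m%:R * T1) = b i x s.
Proof.
move=> s0; elim: m => [|m ih]; first by rewrite mul0r addr0.
rewrite -natr1 mulrDl mul1r addrA hper ?ih// addr_ge0// mulr_ge0// ltW//.
Qed.

Lemma near_id_shift eps x s s' (m : nat) : 0 <= s ->
  near_id eps x (s + m%:R * T1) s' = near_id eps x s s'.
Proof.
move=> s0; congr (_ - _ *: _).
by apply: eq_bigr => i _; rewrite b_shift.
Qed.

Lemma es_field_shift eps x s s' (m : nat) : 0 <= s ->
  es_field eps x (s + m%:R * T1) s' = es_field eps x s s'.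
Proof. by move=> s0; apply: eq_bigr => i _; rewrite b_shift. Qed.

(** One statement serves all modes: [cz] is a decay rate, negative when the value may grow, and
    [rate] bounds the speed of the timer in the weight; [hrate] says that together they give decay
    at rate [rho]. *)
Lemma flow_decay (B : set 'cV[R]_n) (Lv dl : R) : compact B ->
  (forall x, B x -> J x - Jmin <= Lv) -> 0 < dl ->
  \forall eps \near 0^'+, forall (x : R -> 'cV[R]_n) (z : R -> R) (A E s1 s2 : R),
    0 <= s1 ->
    (forall t, A <= t <= E -> {for t, continuous x}) ->
    (forall t, A <= t <= E -> B (x t)) ->
    (forall t, A < t < E -> is_derive t (1 : R) x
       (es_field eps (x t) (s1 + eps^-1 * (t - A)) (s2 + eps ^- 2 * (t - A)))) ->
    (forall s t, A <= s -> s <= t -> t <= E -> z t - z s <= rate * (t - s)) ->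
    (forall t, A <= t <= E -> z t <= T0) ->
    forall t, A <= t <= E ->
      expR (th * z t) * (J (x t) - Jmin) <=
      expR (- (rho * (t - A))) * (expR (th * z A) * (J (x A) - Jmin)) + dl.
Proof.
move=> cB BLv dl0.
pose X := expR (th * T0); have X0 : 0 < X by exact: expR_gt0.
(* The quotient comes from the full windows; of the 4, two units come from the last partial window
   and one from each passage between [V] and [W] at the two ends. *)
pose Cst := (1 + `|cz|) * (1 + rho) / rho + 4.
have C0 : 0 < Cst.
  have : 0 <= (1 + `|cz|) * (1 + rho) / rho.
    exact: divr_ge0 (mulr_ge0 (addr_ge0 ler01 (normr_ge0 _)) (addr_ge0 ler01 (ltW hrho))) (ltW hrho).
  by rewrite /Cst; lra.
pose e := Num.min 1 (dl / (X * Cst)).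
have e0 : 0 < e by rewrite lt_min ltr01 divr_gt0// mulr_gt0.
have e1 : e <= 1 by rewrite ge_min lexx.
have edl : X * Cst * e <= dl.
  by rewrite mulrC -ler_pdivlMr ?mulr_gt0// ge_min lexx orbT.
have := hwin cB e0; apply: filter_app; near=> eps => win.
have ep0 : 0 < eps by near: eps; exact: nbhs_right_gt.
have c1 : eps * T1 <= 1 by near: eps; exact: near0_mul_le.
have c2 : eps * (T1 * (`|cz| * (`|Lv| + 1))) <= e by near: eps; exact: near0_mul_le.
move=> x z A E s1 s2 s10 cx xB ode zrate zT0 t tAE.
have h0 : 0 < eps * T1 by rewrite mulr_gt0.
set h := eps * T1 in h0 c1 win.
pose tau1 t := s1 + eps^-1 * (t - A); pose tau2 t := s2 + eps ^- 2 * (t - A).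
pose W t := J (near_id eps (x t) (tau1 t) (tau2 t)) - Jmin.
pose V t := J (x t) - Jmin.
have W0 s : 0 <= W s by rewrite subr_ge0.
have step s d : A <= s -> 0 <= d -> d <= h -> s + d <= E ->
    [/\ `|W s - V s| <= e, `|W (s + d) - V (s + d)| <= e, `|W (s + d) - W s| <= e &
        d = h -> W (s + d) <= W s - h * (k / kappa * Q (x s)) + e * h].
  move=> As d0 dh sdE.
  have t0 : 0 <= tau1 s by rewrite addr_ge0// mulr_ge0 ?invr_ge0 ?subr_ge0// ltW.
  (* Whole periods are removed from the slow clock: every window then starts in [0, T1], where the
     estimate is uniform. *)
  have /andP[m1 m2] := truncn_itv (divr_ge0 t0 (ltW hT1)).
  set m := Num.truncn _ in m1 m2.
  pose sig := tau1 s - m%:R * T1.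
  have sig0 : 0 <= sig by rewrite subr_ge0 -ler_pdivlMr.
  have sig1 : sig <= T1.
    by move: m2; rewrite ltr_pdivrMr// -natr1 mulrDl mul1r /sig; lra_from t0.
  have clk y : s <= y -> tau1 y = slow_clock eps sig s y + m%:R * T1.
    by move=> sy; rewrite /slow_clock max_r// /sig /tau1; ring.
  have clk0 y : s <= y -> 0 <= slow_clock eps sig s y.
    move=> sy; rewrite /slow_clock max_r//; apply: addr_ge0 => //.
    by apply: mulr_ge0; [rewrite invr_ge0 ltW | rewrite subr_ge0].
  have fclk y : tau2 y = fast_clock eps (tau2 s) s y.
    by rewrite /fast_clock /tau2; ring.
  have WE y : s <= y -> J (near_id eps (x y) (slow_clock eps sig s y) (fast_clock eps (tau2 s) s y)) = W y + Jmin.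
    by move=> sy; rewrite /W subrK (clk y sy) (fclk y) near_id_shift//; exact: clk0.
  have ss : s <= s by [].
  have ssd : s <= s + d by lra_from d0.
  have [] := win x s d sig (tau2 s) d0 dh sig0 sig1.
  - by move=> y hy; apply: cx; lra_from hy As sdE.
  - by move=> y hy; apply: xB; lra_from hy As sdE.
  - move=> y hy; have sy : s <= y by lra_from hy.
    rewrite -(es_field_shift _ _ _ m (clk0 _ sy)) -clk// -(fclk y).
    by apply: ode; lra_from hy As sdE.
  rewrite !WE// => S0 S1 S2 S3; split.
  - by rewrite (_ : W s - V s = W s + Jmin - J (x s)) // /V; ring.
  - by rewrite (_ : W (s + d) - V (s + d) = W (s + d) + Jmin - J (x (s + d))) // /V; ring.
  - by rewrite (_ : W (s + d) - W s = W (s + d) + Jmin - (W s + Jmin)) //; ring.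
  - by move=> dE; have := S3 dE; rewrite dE; lra_from e0.
pose u s := expR (th * z s) * W s.
have zX s : A <= s <= E -> expR (th * z s) <= X.
  by move=> hs; rewrite ler_expR ler_wpM2l// zT0.
have ez0 s : 0 < expR (th * z s) by exact: expR_gt0.
have grow s d : A <= s -> 0 <= d -> s + d <= E ->
    expR (th * z (s + d)) * (expR (- (cz * d)) * W s) <= expR (- (rho * d)) * u s.
  move=> As d0 sdE.
  have hz : z (s + d) - z s <= rate * d.
    have := zrate s (s + d) As _ sdE; rewrite addrAC subrr add0r; apply; lra_from d0.
  rewrite /u !mulrA; apply: ler_wpM2r; first exact: W0.
  rewrite -!expRD ler_expR.
  have : th * (z (s + d) - z s) <= th * (rate * d) by rewrite ler_wpM2l.
  have : (th * rate - cz) * d <= - rho * d by rewrite ler_wpM2r.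
  lra.
have dec d : 1 - cz * d <= expR (- (cz * d)).
  by have := expR_ge1Dx (- (cz * d)).
have key : forall t, A <= t <= E ->
    u t <= expR (- (rho * (t - A))) * u A + X * (1 + `|cz|) * e * (1 + rho) / rho + X * 2 * e.
  apply: (window_iteration hrho h0 c1).
  - by rewrite mulr_ge0 ?(ltW e0)// mulr_ge0 ?(ltW X0)// addr_ge0.
  - move=> s As shE; have [S0 S1 S2 S3] := step s h As (ltW h0) (lexx _) shE.
    (* One e h is the averaging error; |cz| e h comes from replacing [V s] by [W s] in the
       decrease. *)
    have W1 : W (s + h) <= expR (- (cz * h)) * W s + (1 + `|cz|) * e * h.
      have h1 := S3 erefl.
      have h2 : h * (cz * V s) <= h * (k / kappa * Q (x s)).
        by rewrite ler_pM2l//; exact: hcz.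
      have h3 : (1 - cz * h) * W s <= expR (- (cz * h)) * W s by exact: ler_wpM2r (W0 s) _ _ (dec h).
      have h4 : cz * (W s - V s) <= `|cz| * e.
        apply: le_trans (ler_norm _) _; rewrite normrM.
        by rewrite ler_wpM2l.
      have h5 : h * (cz * (W s - V s)) <= h * (`|cz| * e) by rewrite ler_pM2l.
      lra.
    have hsh : A <= s + h <= E by lra_from As shE h0.
    apply: (@le_trans _ _ (expR (th * z (s + h)) * (expR (- (cz * h)) * W s)
       + X * ((1 + `|cz|) * e * h))).
      apply: le_trans (ler_wpM2l (ltW (ez0 _)) W1) _; rewrite mulrDr lerD2l.
      by apply: ler_wpM2r; [exact: mulr_ge0 (mulr_ge0 (addr_ge0 ler01 (normr_ge0 _)) (ltW e0)) (ltW h0) | exact: zX].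
    have := grow s h As (ltW h0) shE; rewrite !mulrA; lra_from h0.
  - move=> s d As d0 dh sdE; have [S0 S1 S2 S3] := step s d As d0 dh sdE.
    (* One e bounds the drift of [W]; the other bounds cz d [W s], small because d <= eps T1 and the
       value is bounded on [B]. *)
    have W1 : W (s + d) <= expR (- (cz * d)) * W s + 2 * e.
      have h2 : W s <= `|Lv| + 1.
        have hV : V s <= Lv by apply: BLv; apply: xB; lra_from As sdE d0.
        by move: S0; rewrite ler_norml; have := ler_norm Lv; lra_from e1 hV.
      have h3 : (1 - cz * d) * W s <= expR (- (cz * d)) * W s by exact: ler_wpM2r (W0 s) _ _ (dec d).
      have h4 : cz * d * W s <= `|cz| * h * (`|Lv| + 1).
        apply: le_trans (ler_norm _) _; rewrite !normrM.
        rewrite (ger0_norm d0) (ger0_norm (W0 s)).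
        by apply: ler_pM => //; [rewrite mulr_ge0|rewrite ler_wpM2l].
      move: c2; rewrite (_ : eps * _ = `|cz| * h * (`|Lv| + 1)); last by rewrite /h; ring.
      by move: S2; rewrite ler_norml; lra_from h3 h4.
    have hsh : A <= s + d <= E by lra_from As sdE d0.
    apply: (@le_trans _ _ (expR (th * z (s + d)) * (expR (- (cz * d)) * W s)
       + X * (2 * e))).
      apply: le_trans (ler_wpM2l (ltW (ez0 _)) W1) _; rewrite mulrDr lerD2l.
      by apply: ler_wpM2r; [rewrite mulr_ge0// ltW | exact: zX].
    have := grow s d As d0 sdE; rewrite !mulrA; lra_from h0.
have conv s : A <= s <= E -> `|expR (th * z s) * V s - u s| <= X * e.
  move=> hs; have As : A <= s by lra_from hs.
  have sE : s + 0 <= E by lra_from hs.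
  have [] := step s 0 As (lexx _) (ltW h0) sE.
  move=> S0 _ _ _; rewrite /u -mulrBr normrM (gtr0_norm (ez0 s)).
  by apply: ler_pM; rewrite ?expR_ge0 ?zX// distrC.
have hA : A <= A <= E by lra_from tAE.
have := conv A hA; have := conv t tAE; have := key t tAE.
rewrite -/(V t) -/(V A) !ler_norml.
have q0 : 0 <= expR (- (rho * (t - A))) by exact: expR_ge0.
have q1 : expR (- (rho * (t - A))) <= 1.
  have tA : 0 <= t - A by lra_from tAE.
  by rewrite -expR0 ler_expR oppr_le0; exact: mulr_ge0 (ltW hrho) tA.
move=> h1 /andP[_ h2] /andP[h3 _].
have h4 : expR (- (rho * (t - A))) * (u A - expR (th * z A) * V A) <= X * e.
  apply: (@le_trans _ _ (expR (- (rho * (t - A))) * (X * e))).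
    by rewrite ler_wpM2l//; lra.
  by rewrite -[leRHS]mul1r ler_wpM2r//; exact: mulr_ge0 (ltW X0) (ltW e0).
have h5 : X * Cst * e = X * (1 + `|cz|) * e * (1 + rho) / rho + 4 * (X * e).
  by rewrite /Cst; field; rewrite gt_eqF.
lra.
Unshelve. all: by end_near. Qed.

Hypothesis hJc : continuous J.

(** Stated at a single eps and with a level in place of a compact set: the modes can then share one
    eps, and the hybrid argument has only a level to check. *)
Definition flow_estimate eps (l dl : R) : Prop :=
  forall (x : R -> 'cV[R]_n) (z : R -> R) (A E s1 s2 : R),
    A <= E -> 0 <= s1 ->
    (forall t, A <= t <= E -> {for t, continuous x}) ->
    (forall t, A < t < E -> is_derive t (1 : R) x
       (es_field eps (x t) (s1 + eps^-1 * (t - A)) (s2 + eps ^- 2 * (t - A)))) ->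
    (forall s t, A <= s -> s <= t -> t <= E -> z t - z s <= rate * (t - s)) ->
    (forall t, A <= t <= E -> 0 <= z t <= T0) ->
    expR (th * z A) * (J (x A) - Jmin) + dl < l ->
    forall t, A <= t <= E ->
      expR (th * z t) * (J (x t) - Jmin) <=
      expR (- (rho * (t - A))) * (expR (th * z A) * (J (x A) - Jmin)) + dl.

(* The estimate keeps the trajectory inside the sublevel set on which it was
   established, so that the restriction to this set can be removed. *)
Lemma flow_invariance (l dl : R) : compact [set x | J x <= Jmin + l] -> 0 < dl ->
  \forall eps \near 0^'+, flow_estimate eps l dl.
Proof.
move=> cB dl0; set B := [set x | _] in cB.
have BLv x : B x -> J x - Jmin <= l by rewrite /B /=; lra.
have := flow_decay cB BLv dl0; apply: filterS => eps dec.
move=> x z A E s1 s2 AE s10 cx ode zrate zT0.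
set UA := expR (th * z A) * (J (x A) - Jmin) => hl.
have zT t : A <= t <= E -> z t <= T0 by move=> /zT0/andP[].
have VU t : A <= t <= E -> J (x t) - Jmin <= expR (th * z t) * (J (x t) - Jmin).
  move=> /zT0/andP[z0 _]; rewrite -[leLHS]mul1r; apply: ler_wpM2r.
    by rewrite subr_ge0.
  by rewrite -expR0 ler_expR mulr_ge0.
have sub v : A <= v -> v <= E -> (forall s, A <= s <= v -> B (x s)) ->
    forall t, A <= t <= v -> expR (th * z t) * (J (x t) - Jmin) <=
      expR (- (rho * (t - A))) * UA + dl.
  move=> Av vE Bv; apply: (dec x z A v s1 s2) => //.
  - by move=> t ht; apply: cx; lra.
  - by move=> t ht; apply: ode; lra.
  - by move=> s t h1 h2 h3; apply: zrate; lra.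
  - by move=> t ht; apply: zT; lra.
have UA0 : 0 <= UA by rewrite mulr_ge0 ?expR_ge0 ?subr_ge0.
suff BE : forall s, A <= s <= E -> B (x s) by exact: sub.
apply: (@creeping R A E (fun v => forall s, A <= s <= v -> B (x s))) => //.
  move=> s hs; have -> : s = A by apply/eqP; rewrite eq_le andbC.
  have hA : A <= A <= E by rewrite lexx.
  by have := VU A hA; rewrite -/UA /B /=; lra.
move=> c cAE.
have cJx : {for c, continuous (fun s => J (x s))}.
  by apply: (@continuous_comp _ _ _ x J); [exact: cx|exact: hJc].
(* Below the level, continuity extends the confinement past c. At or above it, J already exceeds
   Jmin + [UA] + dl just before c, against the estimate up to that point. *)
have [lt|ge] := ltP (J (x c)) (Jmin + l).
  have hlt : \forall s \near c, J (x s) < Jmin + l := @cvgr_lt _ _ _ (nbhs_filter c) _ _ cJx _ lt.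
  have [d /= d0 hd] := (nbhs_ballP _ _).1 hlt; exists d => // u v uc cv ur vr Pu s sv.
  have [su|us] := leP s u; first by apply: Pu; lra.
  by apply: ltW; apply: hd; rewrite -ball_normE /= ltr_norml; lra.
have gt : Jmin + (UA + dl) < J (x c) by lra.
have hgt : \forall s \near c, Jmin + (UA + dl) < J (x s) := @cvgr_gt _ _ _ (nbhs_filter c) _ _ cJx _ gt.
have [d /= d0 hd] := (nbhs_ballP _ _).1 hgt; exists d => // u v uc cv ur vr Pu.
exfalso.
have hu : Jmin + (UA + dl) < J (x u).
  by apply: hd; rewrite -ball_normE /= ltr_norml; lra.
have uA : A <= u <= u by lra.
have uE : A <= u <= E by lra.
have AAu : A <= u by lra.
have uE' : u <= E by lra.
have h1 := sub u AAu uE' Pu u uA; have h2 := VU u uE.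
have h3 : expR (- (rho * (u - A))) * UA <= UA.
  have uA0 : 0 <= u - A by lra.
  rewrite -[leRHS]mul1r ler_wpM2r// -expR0 ler_expR oppr_le0.
  exact: mulr_ge0 (ltW hrho) uA0.
lra.
Qed.

End Flow.

(** * Jump times of a hybrid time domain *)

Section HybridTime.
Context {R : realType}.

(** The nodes are those of the domain truncated at (T, m). Every piece lies in the truncation, and
    the one with counter m contains T, so it ends exactly at T. *)
Lemma hybrid_times (E : set (R * nat)) (T : R) (m : nat) :
  hybrid_time_domain E -> E (T, m) ->
  exists t : nat -> R, [/\ t 0%N = 0, t m.+1 = T &
    forall j, (j <= m)%N -> t j <= t j.+1 /\ `[t j, t j.+1] `<=` time_slice E j].
Proof.
move=> [E0 hE] ETm; have [N [t [t0 [tmono EE]]]] := hE T m ETm.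
have inE s j : (j < N)%N -> t j <= s <= t j.+1 -> [/\ E (s, j), 0 <= s <= T & (j <= m)%N].
  move=> jN hs.
  have : (E `&` (`[0, T] `*` [set j | (j <= m)%N])) (s, j).
    by rewrite EE; exists j => //; split => //=; rewrite in_itv.
  by move=> [Es [/= + jm]]; rewrite in_itv /= => hs0; split.
have T0 : 0 <= T by have := E0 _ ETm.
have : (E `&` (`[0, T] `*` [set j | (j <= m)%N])) (T, m).
  by split => //; split => //=; rewrite in_itv /= T0 lexx.
rewrite EE => -[j /= jN [/= hTj mj]]; subst j.
move: hTj; rewrite in_itv /= => /andP[tmT Ttm].
have tmm : t m <= t m.+1 <= t m.+1 by rewrite lexx andbT; exact: tmono.
have [_ /andP[_ tT] _] := inE (t m.+1) m jN tmm.
exists t; split => //; first by apply/eqP; rewrite eq_le tT Ttm.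
move=> j jm; have jN' : (j < N)%N by exact: leq_ltn_trans jm jN.
split; first exact: tmono.
by move=> s /=; rewrite in_itv /= => hs; have [] := inE s j jN' hs.
Qed.

End HybridTime.

(** * Continuous extension from a segment *)

Section Clamp.
Context {R : realType}.

Definition clamp (A B t : R) : R := Num.max A (Num.min t B).

Lemma clamp_in (A B t : R) : A <= B -> A <= clamp A B t <= B.
Proof. by move=> AB; rewrite /clamp le_max lexx /= ge_max AB /= ge_min lexx orbT. Qed.

Lemma clampE (A B t : R) : A <= t <= B -> clamp A B t = t.
Proof. by move=> /andP[At tB]; rewrite /clamp min_l// max_r. Qed.

Lemma clamp_dist (A B s t : R) : A <= B ->
  `|clamp A B s - clamp A B t| <= `|s - t|.
Proof.
move=> AB; rewrite /clamp ler_norml.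
have := ler_norm (s - t); have := ler_norm (- (s - t)); rewrite normrN.
case: (leP s B) => ?; case: (leP t B) => ?; rewrite ?(max_r AB);
  by case: (leP A s) => ?; case: (leP A t) => ?; lra.
Qed.

(** Absolute continuity tested on a single interval is uniform continuity, and clamping is
    1-Lipschitz. The extension is continuous in the two-sided sense even at the ends of the flow
    interval. *)
Lemma ac_clamp_continuous (V : normedModType R) (A B : R) (f : R -> V) : A <= B ->
  absolutely_continuous A B f -> continuous (fun t => f (clamp A B t)).
Proof.
move=> AB acf t; apply/cvgrPdist_le => e e0.
have [d d0 hd] := acf e e0.
have d2 : 0 < d / 2 by rewrite divr_gt0.
have := near_dist_le t d2; apply: filterS => s st.
have key p q : A <= p -> p <= q -> q <= B -> q - p < d -> `|f q - f p| < e.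
  move=> Ap pq qB pqd; have := hd 1%N (fun=> p) (fun=> q).
  rewrite !big_ord1; apply => //.
  by move=> i j _ _ _; rewrite !ord1.
have cd := clamp_dist s t AB; have cs := clamp_in s AB; have ct := clamp_in t AB.
rewrite distrC in st; move: (clamp A B s) (clamp A B t) cd cs ct => p q cd cs ct.
have [pq|qp] := leP p q.
  apply/ltW/key; try lra; move: cd; rewrite ler_norml; lra.
rewrite distrC; apply/ltW/key; try lra; move: cd; rewrite ler_norml; lra.
Qed.

End Clamp.

(** * A hybrid solution on one flow interval *)

Section FlowInterval.
Context {R : realType} {n r : nat}.
Context (kappa eta1 eta2 N0 T0 : R) (w : 'I_r -> rat).
Context (b : 'I_r -> 'cV[R]_n -> R -> 'cV[R]_n) (J : 'cV[R]_n -> R) (eps : R).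

Definition freq (i : 'I_r) : R := ratr (w i).
Definition gain (i : 'I_r) : R := Num.sqrt (2 * freq i) * (Num.sqrt kappa)^-1.
(** Equal to -kappa, 0 and kappa in modes 1, 2 and 3: on average the state ascends the gradient,
    stands still, or descends. *)
Definition mode_sign (z1 : R) : R := kappa * (z1 - 2).

Local Notation H := (es_system kappa eta1 eta2 N0 T0 w b J eps).
Local Notation state := (state_space R n).

Definition pos (s : state) := s.1.1.
Definition mode (s : state) := s.1.2.1.1.
Definition jump_timer (s : state) := s.1.2.1.2.
Definition spoof_timer (s : state) := s.1.2.2.
Definition slow_time (s : state) := s.2.1.
Definition fast_time (s : state) := s.2.2.

Lemma es_flow_mapP (s v : state) : flow_map H s v ->
  [/\ pos v = es_field freq gain b J (mode_sign (mode s)) eps (pos s) (slow_time s) (fast_time s),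
      mode v = 0, 0 <= jump_timer v <= eta1,
      - \1_(unstable_modes R) (mode s) <= spoof_timer v <= eta2 - \1_(unstable_modes R) (mode s) &
      slow_time v = eps^-1 /\ fast_time v = eps ^- 2].
Proof.
case: s => [[x [[z1 z2] z3]] [s1 s2]]; case: v => [[vx [[v1 v2] v3]] [u1 u2]] /=.
move=> [[/= ex [[/= e1 e2] [q /= hq e3]]] [/= e4 e5]].
rewrite /pos /mode /jump_timer /spoof_timer /slow_time /fast_time /=; split => //.
- rewrite ex; apply: eq_bigr => i _; congr (_ *: _).
  by rewrite /es_input /phase /gain /freq /mode_sign; ring.
- by rewrite -e3 -[X in X <= _]add0r !lerD2r; move: hq; rewrite /= in_itv.
Qed.

Lemma norm_fst_le (V W : normedModType R) (p : V * W) : `|p.1| <= `|p|.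
Proof. by rewrite [leRHS]/Num.Def.normr /= le_max lexx. Qed.

Lemma norm_snd_le (V W : normedModType R) (p : V * W) : `|p.2| <= `|p|.
Proof. by rewrite [leRHS]/Num.Def.normr /= le_max lexx orbT. Qed.

Section Interval.
Context (E : set (R * nat)) (y : R -> nat -> state) (j : nat) (A B : R).
Hypothesis hsol : hybrid_solution H E y.
Hypothesis AB : A < B.
Hypothesis hAB : `[A, B] `<=` time_slice E j.

Let slice_interior : (time_slice E j)° !=set0.
Proof.
exists ((A + B) / 2); rewrite /interior /=.
have : nbhs ((A + B) / 2) `]A, B[%classic.
  apply/nbhs_ballP; exists ((B - A) / 2) => /=; first by rewrite divr_gt0// subr_gt0.
  by move=> t; rewrite -ball_normE /= ltr_norml in_itv /=; lra.
apply: filterS => t /=; rewrite in_itv /= => ht; apply: hAB => /=.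
by rewrite in_itv /=; lra.
Qed.

Lemma flow_interval_set t : A <= t <= B -> flow_set H (y t j).
Proof.
move=> ht; have [_ [_ [_ [hf _]]]] := hsol; have [_ [h _]] := hf j slice_interior.
by apply: h; apply: hAB; rewrite /= in_itv.
Qed.

Lemma flow_interval_ac : absolutely_continuous A B (y ^~ j).
Proof.
have [_ [_ [_ [hf _]]]] := hsol; have [h _] := hf j slice_interior.
by apply: h => //; exact: ltW.
Qed.

Lemma flow_interval_ae : {ae @lebesgue_measure R, forall t, A <= t <= B ->
  exists2 v : state, is_derive t (1 : R) (y ^~ j) v & flow_map H (y t j) v}.
Proof.
have [_ [_ [_ [hf _]]]] := hsol; have [_ [_ h]] := hf j slice_interior.
by apply: ae_imply h => t h ht; apply: h; apply: hAB; rewrite /= in_itv.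
Qed.

(** The common source of the facts on modes, timers and clocks: [phi] is a coordinate, and the
    bounds that the inclusion puts on its velocity become bounds on increments. *)
Lemma flow_interval_increment (phi : state -> R) (c d : R) :
  (forall p q v (k : R), phi (p - q - k *: v) = phi p - phi q - k *: phi v) ->
  (forall p q, phi (p - q) = phi p - phi q) ->
  (forall p, `|phi p| <= `|p|) ->
  (forall t v, A <= t <= B -> flow_map H (y t j) v -> d <= phi v <= c) ->
  forall s t, A <= s -> s <= t -> t <= B ->
    d * (t - s) <= phi (y t j) - phi (y s j) <= c * (t - s).
Proof.
move=> lin linB contr hc s t As st tB.
have acs : absolutely_continuous s t (phi \o (y ^~ j)).
  apply: (ac_comp_contraction (f := y ^~ j)).
    by move=> p q; rewrite -linB; exact: contr.
  exact: ac_sub As tB flow_interval_ac.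
have D u : A <= u <= B -> (exists2 v : state, is_derive u (1 : R) (y ^~ j) v & flow_map H (y u j) v) ->
    exists2 v, is_derive u (1 : R) (phi \o (y ^~ j)) v & d <= v <= c.
  move=> hu [v Dv fv]; exists (phi v); last exact: (hc u).
  by apply: (is_derive_contraction (f := y ^~ j)) Dv => // p q k; exact: lin.
apply/andP; split.
  apply: (ac_increment_ge st acs); apply: ae_imply flow_interval_ae => u h hu.
  have hu' : A <= u <= B by lra.
  by have [v Dv /andP[]] := D u hu' (h hu'); exists v.
apply: (ac_increment_le st acs); apply: ae_imply flow_interval_ae => u h hu.
have hu' : A <= u <= B by lra.
by have [v Dv /andP[]] := D u hu' (h hu'); exists v.
Qed.

Lemma flow_interval_mode t : A <= t <= B -> mode (y t j) = mode (y A j).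
Proof.
move=> /andP[At tB].
have contr (p : state) : `|mode p| <= `|p|.
  exact: le_trans (le_trans (norm_fst_le p.1.2.1) (norm_fst_le p.1.2)) (le_trans (norm_snd_le p.1) (norm_fst_le p)).
have := @flow_interval_increment mode 0 0 _ _ contr _ A t (lexx _) At tB.
rewrite !mul0r -eq_le eq_sym subr_eq0 => h; apply/eqP/h => // u v _ /es_flow_mapP[_ -> _ _ _].
by rewrite lexx.
Qed.

Lemma flow_interval_jump_timer s t : A <= s -> s <= t -> t <= B ->
  0 <= jump_timer (y t j) - jump_timer (y s j) <= eta1 * (t - s).
Proof.
move=> As st tB.
have contr (p : state) : `|jump_timer p| <= `|p|.
  exact: le_trans (le_trans (norm_snd_le p.1.2.1) (norm_fst_le p.1.2)) (le_trans (norm_snd_le p.1) (norm_fst_le p)).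
have := @flow_interval_increment jump_timer eta1 0 _ _ contr _ s t As st tB.
by rewrite mul0r; apply => // u v _ /es_flow_mapP[].
Qed.

Lemma flow_interval_clock t : A <= t <= B ->
  slow_time (y t j) = slow_time (y A j) + eps^-1 * (t - A) /\
  fast_time (y t j) = fast_time (y A j) + eps ^- 2 * (t - A).
Proof.
move=> /andP[At tB].
have contr1 (p : state) : `|slow_time p| <= `|p|.
  exact: le_trans (norm_fst_le p.2) (norm_snd_le p).
have contr2 (p : state) : `|fast_time p| <= `|p|.
  exact: le_trans (norm_snd_le p.2) (norm_snd_le p).
have h1 := @flow_interval_increment slow_time eps^-1 eps^-1 _ _ contr1 _ A t (lexx _) At tB.
have h2 := @flow_interval_increment fast_time (eps ^- 2) (eps ^- 2) _ _ contr2 _ A t (lexx _) At tB.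
split.
  have : eps^-1 * (t - A) <= slow_time (y t j) - slow_time (y A j) <= eps^-1 * (t - A).
    by apply: h1 => // u v _ /es_flow_mapP[_ _ _ _ [-> _]]; rewrite lexx.
  by lra.
have : eps ^- 2 * (t - A) <= fast_time (y t j) - fast_time (y A j) <= eps ^- 2 * (t - A).
  by apply: h2 => // u v _ /es_flow_mapP[_ _ _ _ [_ ->]]; rewrite lexx.
by lra.
Qed.

Lemma flow_interval_spoof_timer s t : A <= s -> s <= t -> t <= B ->
  spoof_timer (y t j) - spoof_timer (y s j) <=
  (eta2 - \1_(unstable_modes R) (mode (y A j))) * (t - s).
Proof.
move=> As st tB.
have contr (p : state) : `|spoof_timer p| <= `|p|.
  exact: le_trans (norm_snd_le p.1.2) (le_trans (norm_snd_le p.1) (norm_fst_le p)).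
have := @flow_interval_increment spoof_timer (eta2 - \1_(unstable_modes R) (mode (y A j)))
  (- \1_(unstable_modes R) (mode (y A j))) _ _ contr _ s t As st tB.
move=> h; apply: (proj2 (andP (h _ _ _))) => // u v hu /es_flow_mapP[_ _ _].
by rewrite (flow_interval_mode hu).
Qed.

Definition interval_pos t := pos (y (clamp A B t) j).

Lemma interval_posE t : A <= t <= B -> interval_pos t = pos (y t j).
Proof. by move=> ht; rewrite /interval_pos clampE. Qed.

Lemma interval_pos_continuous : continuous interval_pos.
Proof.
apply: (ac_clamp_continuous (f := fun t => pos (y t j)) (ltW AB)).
apply: (ac_comp_contraction (f := y ^~ j) (phi := pos)) flow_interval_ac => p q.
exact: le_trans (norm_fst_le (p - q).1) (norm_fst_le (p - q)).
Qed.

Hypothesis hbc : forall i, cont_within [set p : 'cV[R]_n * R | 0 <= p.2] (fun p => b i p.1 p.2).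
Hypothesis hJc : continuous J.
Hypothesis heps : 0 < eps.

(** Once the mode is known to be constant and the clocks affine, the right-hand side is a continuous
    function of time, so that [ac_ode] upgrades the almost everywhere equation, coordinate by
    coordinate. *)
Lemma interval_pos_ode t : A < t < B ->
  is_derive t (1 : R) interval_pos
    (es_field freq gain b J (mode_sign (mode (y A j))) eps (interval_pos t)
       (slow_time (y A j) + eps^-1 * (t - A)) (fast_time (y A j) + eps ^- 2 * (t - A))).
Proof.
set k := mode_sign _; set s1 := slow_time _; set s2 := fast_time _ => ht.
have s10 : 0 <= s1.
  have hA : A <= A <= B by rewrite lexx ltW.
  by have [_ [/= + _]] := flow_interval_set hA; rewrite in_itv /= andbT.
pose g u := es_field freq gain b J k eps (interval_pos u) (slow_clock eps s1 A u) (fast_clock eps s2 A u).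
have gc u : {for u, continuous g}.
  have cx : {for u, continuous interval_pos} by exact: interval_pos_continuous.
  have c1 : {for u, continuous (slow_clock eps s1 A)} by exact: tau1_continuous.
  have c2 : {for u, continuous (fast_clock eps s2 A)}.
    exact: is_derive_continuous (is_derive_tau2 _ _ _ _).
  apply: cvg_big => [|i _]; first exact: add_continuous.
  apply: cvgZ; last first.
    apply: (cont_within_curve (f := fun p => b i p.1 p.2) (hbc i)
       (c := fun u => (interval_pos u, slow_clock eps s1 A u))).
      by move=> v; exact: tau1_ge0.
    exact: (cvg_pair cx c1).
  apply: cvgM; first exact: cvg_cst.
  apply: (cvg_comp _ cos); last exact: continuous_cos.
  apply: cvgD; first by apply: cvgM => //; exact: cvg_cst.
  apply: cvgM; first exact: cvg_cst.
  by apply: (@continuous_comp _ _ _ interval_pos J); [exact: cx|exact: hJc].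
have gE u : A <= u <= B -> g u = es_field freq gain b J k eps (pos (y u j)) (slow_time (y u j)) (fast_time (y u j)).
  move=> hu; have [h1 h2] := flow_interval_clock hu.
  by rewrite /g interval_posE// /slow_clock /fast_clock max_r ?h1 ?h2//; case/andP: hu.
have -> : s1 + eps^-1 * (t - A) = slow_clock eps s1 A t by rewrite /slow_clock max_r//; lra.
rewrite -/(fast_clock eps s2 A t) -/(g t).
apply/is_derive_colP => i.
have Dy : is_derive t (1 : R) (fun u => pos (y u j) i 0) (g t i 0).
  apply: (ac_ode (a := A) (b := B) (f := fun u => pos (y u j) i 0) (g := fun u => g u i 0) ht).
  - apply: (ac_comp_contraction (f := y ^~ j) (phi := fun s => pos s i 0)) flow_interval_ac => p q.
    have := mx_entry_le (pos (p - q)) i 0; rewrite /pos !mxE => /le_trans; apply.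
    exact: le_trans (norm_fst_le (p - q).1) (norm_fst_le (p - q)).
  - apply: ae_imply flow_interval_ae => u h hu; have [v Dv fv] := h hu.
    have [pv _ _ _ _] := es_flow_mapP fv.
    move: pv; rewrite gE// (flow_interval_mode hu) -/k => <-.
    apply: (is_derive_contraction (phi := fun s : state => pos s i 0)) Dv => [p q c|p].
      by rewrite /pos !mxE.
    apply: le_trans (mx_entry_le _ _ _) _.
    exact: le_trans (norm_fst_le p.1) (norm_fst_le p).
  - exact: continuous_entry (gc t).
apply: near_eq_is_derive Dy.
have /nbhs_ballP[d /= d0 hd] : nbhs t `]A, B[%classic.
  apply/nbhs_ballP; exists (Num.min (t - A) (B - t)) => /=; first by rewrite lt_min !subr_gt0.
  move=> u; rewrite -ball_normE /= lt_min !ltr_norml in_itv /=; lra.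
apply/nbhs_ballP; exists d => // u /hd /=; rewrite in_itv /= => hu.
by rewrite interval_posE//; lra.
Qed.

End Interval.
End FlowInterval.

(** * Decay along flows and jumps *)

Section HybridDecay.
Context {R : realType} {n r : nat}.
Context (kappa eta1 eta2 N0 T0 : R) (w : 'I_r -> rat).
Context (b : 'I_r -> 'cV[R]_n -> R -> 'cV[R]_n) (J : 'cV[R]_n -> R) (eps : R).
Context (Jmin th rho l0 l dl Kc : R).

Local Notation H := (es_system kappa eta1 eta2 N0 T0 w b J eps).
Local Notation state := (state_space R n).

Hypothesis hbc : forall i, cont_within [set p : 'cV[R]_n * R | 0 <= p.2] (fun p => b i p.1 p.2).
Hypothesis hJc : continuous J.
Hypothesis hJmin : forall x, Jmin <= J x.
Hypothesis heps : 0 < eps.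
Hypothesis heta1 : 0 < eta1.
Hypothesis hrho : 0 < rho.
Hypothesis hdl : 0 < dl.
Hypothesis hflow : forall z, modes R z ->
  flow_estimate (freq w) (gain kappa w) b J (mode_sign kappa z)
    Jmin (eta2 - \1_(unstable_modes R) z) th rho T0 eps l dl.

Hypothesis hKc : Kc = N0 + eta1 / rho.
Hypothesis hl : l0 + dl * (Kc + 1) < l.

Definition weighted_value (s : state) := expR (th * spoof_timer s) * (J (pos s) - Jmin).

Lemma weighted_value_ge0 s : 0 <= weighted_value s.
Proof. by rewrite mulr_ge0 ?expR_ge0 ?subr_ge0. Qed.

Lemma flow_setP (s : state) : flow_set H s <->
  [/\ modes R (mode s), 0 <= jump_timer s <= N0, 0 <= spoof_timer s <= T0 &
      0 <= slow_time s /\ 0 <= fast_time s].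
Proof.
case: s => [[x [[z1 z2] z3]] [s1 s2]].
rewrite /pos /mode /jump_timer /spoof_timer /slow_time /fast_time /=; split.
  move=> [[_ [[/= h1 h2] h3]] [/= h4 h5]].
  by move: h2 h3 h4 h5; rewrite /= !in_itv /= !andbT; split.
move=> [h1 h2 h3 [h4 h5]]; split; last by split; rewrite /= in_itv /= andbT.
by split.
Qed.

Lemma jump_setP (s : state) : jump_set H s -> flow_set H s /\ 1 <= jump_timer s.
Proof.
case: s => [[x [[z1 z2] z3]] [s1 s2]].
move=> [[_ [[/= h1 h2] h3]] h4]; move: h2; rewrite /= in_itv /= => /andP[h2 h2'].
split => //; split => //; split => //; split => //; split => //=.
by rewrite in_itv /=; apply/andP; split => //; lra.
Qed.

Lemma jump_mapP (s s' : state) : jump_map H s s' ->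
  [/\ pos s' = pos s, modes R (mode s'), jump_timer s' = jump_timer s - 1,
      spoof_timer s' = spoof_timer s & s'.2 = s.2].
Proof.
case: s => [[x [[z1 z2] z3]] s]; case: s' => [[x' [[z1' z2'] z3']] s'].
by move=> [[/= -> [[/= [h1 _] ->] ->]] /= ->].
Qed.

(* The decay over a flow interval compensates the possible growth of the jump
   timer, which pays for the additive error made on each flow interval. *)
Lemma timer_balance (D z z' : R) : 0 <= D -> z' <= N0 -> z' - z <= eta1 * D ->
  expR (- (rho * D)) * (Kc - z) <= Kc - z'.
Proof.
move=> D0 z'N hz; set q := expR _.
have q0 : 0 <= q by exact: expR_ge0.
have hq : q * (1 + rho * D) <= 1.
  have : q * (1 + rho * D) <= q * expR (rho * D) by rewrite ler_wpM2l// expR_ge1Dx.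
  by rewrite -expRD addNr expR0.
(* The reason for [Kc]: decay of [Kc - z'] at rate rho then outweighs a recharge at speed eta1. *)
have hs : eta1 / rho <= Kc - z' by rewrite hKc; lra.
have s0 : 0 <= Kc - z' by apply: le_trans hs; rewrite divr_ge0 ?ltW.
have h1 : eta1 * D <= (Kc - z') * (rho * D).
  by rewrite mulrA ler_wpM2r// -ler_pdivrMr.
have h2 : q * (Kc - z) <= q * ((1 + rho * D) * (Kc - z')) by rewrite ler_wpM2l//; lra.
have h3 : (q * (1 + rho * D)) * (Kc - z') <= 1 * (Kc - z') by rewrite ler_wpM2r.
lra.
Qed.

Section Solution.
Context (E : set (R * nat)) (y : R -> nat -> state).
Hypothesis hsol : hybrid_solution H E y.
Hypothesis hinit : weighted_value (y 0 0%N) <= l0.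

Local Notation U t j := (weighted_value (y t j)).

Lemma interval_estimate j A B : A <= B -> `[A, B] `<=` time_slice E j ->
  flow_set H (y A j) -> U A j + dl < l -> forall t, A <= t <= B ->
  [/\ flow_set H (y t j), U t j <= expR (- (rho * (t - A))) * U A j + dl &
      jump_timer (y t j) - jump_timer (y A j) <= eta1 * (t - A)].
Proof.
move=> AB hAB hA hlev t ht.
(* Consecutive jumps give a degenerate interval, on which the flow conditions may say nothing. *)
have [lt|ge] := ltP A B; last first.
  have -> : t = A by apply: le_anti; lra.
  rewrite !subrr !mulr0 oppr0 expR0 mul1r; split => //.
  by rewrite lerDl ltW.
split.
- exact: (flow_interval_set hsol lt hAB ht).
- have hAA : A <= A <= B by rewrite lexx.
  have [hm _ _ [hs _]] := (flow_setP _).1 hA.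
  have c1 u : A <= u <= B -> {for u, continuous (interval_pos y j A B)}.
    by move=> _; exact: (interval_pos_continuous hsol lt hAB).
  have c2 u (hu : A < u < B) := interval_pos_ode hsol lt hAB hbc hJc heps hu.
  have c3 s u (h1 : A <= s) (h2 : s <= u) (h3 : u <= B) :=
    flow_interval_spoof_timer hsol lt hAB h1 h2 h3.
  have c4 u : A <= u <= B -> 0 <= spoof_timer (y u j) <= T0.
    by move=> hu; have [] := (flow_setP _).1 (flow_interval_set hsol lt hAB hu).
  have := @hflow _ hm (interval_pos y j A B) (fun t => spoof_timer (y t j))
     A B (slow_time (y A j)) (fast_time (y A j)) AB hs c1 c2 c3 c4.
  have e1 := interval_posE y j ht; have e2 := interval_posE y j hAA.
  by rewrite e2 => /(_ hlev t ht); rewrite e1.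
- have /andP[h1 h2] := ht.
  by have /andP[] := flow_interval_jump_timer hsol lt hAB (lexx A) h1 h2.
Qed.

(** The accumulated error at the start of an interval is kept below dl (Kc - z_2): a flow adds dl,
    and the jump that ends it lowers z_2 by one, which makes room for it. The same induction keeps
    z_2 + i below N0 + eta1 t_i, which bounds the number of jumps. *)
Lemma hybrid_decay T m : E (T, m) ->
  [/\ flow_set H (y T m),
      U T m <= expR (- (rho * T)) * U 0 0%N + dl * (Kc + 1) &
      m%:R <= N0 + eta1 * T].
Proof.
move=> ETm; have [hE [E00 [init [_ hjump]]]] := hsol.
have [t [t0 tT ht]] := hybrid_times hE ETm.
have U0 := weighted_value_ge0 (y 0 0%N).
have K0 : 0 <= eta1 / rho by rewrite divr_ge0 ?ltW.
have tpos i : (i <= m.+1)%N -> 0 <= t i.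
  elim: i => [_|i ih im]; first by rewrite t0.
  by have [h _] := ht i im; apply: le_trans h; apply: ih; exact: ltnW.
(* The invariant allows an error dl Kc and the next flow one more dl, whence Kc + 1 in [hl]. *)
have level i : (i <= m)%N -> flow_set H (y (t i) i) ->
    U (t i) i <= expR (- (rho * t i)) * U 0 0%N + dl * (Kc - jump_timer (y (t i) i)) ->
    U (t i) i + dl < l.
  move=> im /flow_setP[_ /andP[z0 _] _ _] hU; apply: le_lt_trans hl.
  have h1 : expR (- (rho * t i)) * U 0 0%N <= U 0 0%N.
    rewrite -[leRHS]mul1r ler_wpM2r// -expR0 ler_expR oppr_le0.
    by apply: mulr_ge0; [exact: ltW|exact: tpos (leqW im)].
  have : 0 <= dl * jump_timer (y (t i) i) by rewrite mulr_ge0// ltW.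
  move: hinit hU h1; lra.
have inv i : (i <= m)%N ->
    [/\ flow_set H (y (t i) i),
        U (t i) i <= expR (- (rho * t i)) * U 0 0%N + dl * (Kc - jump_timer (y (t i) i)) &
        jump_timer (y (t i) i) + i%:R <= N0 + eta1 * t i].
  elim: i => [_|i ih im].
    rewrite t0 !mulr0 oppr0 expR0 mul1r !addr0.
    have f0 : flow_set H (y 0 0%N) by case: init => [//|/jump_setP[]].
    have [_ /andP[_ zN] _ _] := (flow_setP _).1 f0.
    by split => //; rewrite lerDl mulr_ge0 ?(ltW hdl)// hKc; lra.
  have [hf hU hj] := ih (ltnW im).
  have [ti sl] := ht i (ltnW im); have [ti' sl'] := ht i.+1 im.
  have hT : t i <= t i.+1 <= t i.+1 by rewrite ti lexx.
  have [fT UT jT] := interval_estimate ti sl hf (level i (ltnW im) hf hU) hT.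
  have Ei : E (t i.+1, i) by apply: sl; rewrite /= in_itv /= ti lexx.
  have Ei1 : E (t i.+1, i.+1) by apply: sl'; rewrite /= in_itv /= ti' lexx.
  have [/jump_setP[_ z1] /jump_mapP[ep hm ej es et]] := hjump _ _ Ei Ei1.
  have [_ /andP[z0 zN] sT tau] := (flow_setP _).1 fT.
  have D0 : 0 <= t i.+1 - t i by lra.
  split.
  - apply/flow_setP; split => //.
    + by rewrite ej; lra.
    + by rewrite es.
    + by move: tau; rewrite /slow_time /fast_time et.
  - have -> : U (t i.+1) i.+1 = U (t i.+1) i by rewrite /weighted_value ep es.
    have := timer_balance D0 zN jT.
    set q := expR _ => hb'.
    have : dl * (q * (Kc - jump_timer (y (t i) i))) <= dl * (Kc - jump_timer (y (t i.+1) i)).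
      by rewrite ler_pM2l.
    have : q * U (t i) i <= q * (expR (- (rho * t i)) * U 0 0%N + dl * (Kc - jump_timer (y (t i) i))).
      by rewrite ler_wpM2l// expR_ge0.
    rewrite mulrDr mulrA -expRD.
    rewrite (_ : - (rho * (t i.+1 - t i)) + - (rho * t i) = - (rho * t i.+1)); last by ring.
    by rewrite ej -/q in UT *; lra.
  - by rewrite ej -natr1; lra.
have [hf hU hj] := inv m (leqnn m).
have [tm1 sl] := ht m (leqnn m).
have hT : t m <= T <= t m.+1 by rewrite tT lexx andbT -tT.
have [fT UT jT] := interval_estimate tm1 sl hf (level m (leqnn m) hf hU) hT.
have [_ /andP[z0 zN] _ _] := (flow_setP _).1 fT.
have D0 : 0 <= T - t m by lra.
split => //.
- have := timer_balance D0 zN jT.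
  set q := expR _ => hb'.
  have : dl * (q * (Kc - jump_timer (y (t m) m))) <= dl * (Kc - jump_timer (y T m)).
    by rewrite ler_pM2l.
  have : q * U (t m) m <= q * (expR (- (rho * t m)) * U 0 0%N + dl * (Kc - jump_timer (y (t m) m))).
    by rewrite ler_wpM2l// expR_ge0.
  rewrite mulrDr mulrA -expRD.
  rewrite (_ : - (rho * (T - t m)) + - (rho * t m) = - (rho * T)); last by ring.
  have : 0 <= dl * jump_timer (y T m) by rewrite mulr_ge0// ltW.
  by rewrite -/q in UT; lra.
- by lra.
Qed.

End Solution.
End HybridDecay.

(** * Distance to the target set *)

Section ThetaDist.
Context {R : realType} {n : nat} (N0 T0 : R) (xs : 'cV[R]_n).

Let A := [set xs] `*` C_z N0 T0.

Lemma theta_dist_le (x : 'cV[R]_n) (z : zspace R) : C_z N0 T0 z ->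
  theta_dist A (x, z) <= norm2 (x - xs).
Proof.
move=> hz; apply: ge_inf; first by exists 0 => _ [a _ <-]; exact: sqrtr_ge0.
exists (xs, z) => //; rewrite /theta_norm2 /= !subrr expr0n /= !addr0.
by rewrite sqrtr_sqr ger0_norm// norm2_ge0.
Qed.

Lemma theta_dist_ge (th : theta_space R n) : C_z N0 T0 !=set0 ->
  norm2 (th.1 - xs) <= theta_dist A th.
Proof.
move=> [z0 hz0]; apply: lb_le_inf; first by exists (theta_norm2 (th - (xs, z0))), (xs, z0).
move=> _ [[x z] [/= -> _] <-]; rewrite /theta_norm2 /=.
rewrite -[leLHS]ger0_norm ?norm2_ge0// -sqrtr_sqr ler_wsqrtr//.
by rewrite -!addrA lerDl !addr_ge0// sqr_ge0.
Qed.

End ThetaDist.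

(** * An exponential function of class KL *)

Section ExponentialKL.
Context {R : realType}.

Lemma class_KL_exp (C s0 : R) : 0 <= C -> 0 < s0 ->
  class_KL (fun r s => C * expR (- (s0 * s)) * r).
Proof.
move=> C0 s00; split; [|split; [|split; [|split]]].
- by move=> r s r0 sp; rewrite !mulr_ge0// expR_ge0.
- by move=> r r' s r0 rr sp; rewrite ler_wpM2l// mulr_ge0// expR_ge0.
- move=> r s s' r0 sp ss; rewrite ler_wpM2r// ler_wpM2l// ler_expR lerN2.
  by rewrite ler_wpM2l// ltW.
- move=> s sp; apply: cvg_at_right_filter.
  rewrite -[X in _ --> X](mulr0 (C * expR (- (s0 * s)))).
  by apply: cvgM; [exact: cvg_cst|exact: cvg_id].
- move=> r r0; apply/cvgrPdist_le => e e0.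
  near=> s.
  have sp : 0 <= s by near: s; apply: nbhs_pinfty_ge; rewrite num_real.
  have hs : C * r / (e * s0) <= s by near: s; apply: nbhs_pinfty_ge; rewrite num_real.
  have Cr : 0 <= C * r by rewrite mulr_ge0.
  rewrite sub0r normrN ger0_norm; last by rewrite !mulr_ge0// expR_ge0.
  move: hs; rewrite ler_pdivrMr ?mulr_gt0// => hs.
  have s1 : 0 <= s0 * s by rewrite mulr_ge0// ltW.
  have hq : expR (- (s0 * s)) * (1 + s0 * s) <= 1.
    have : expR (- (s0 * s)) * (1 + s0 * s) <= expR (- (s0 * s)) * expR (s0 * s).
      by rewrite ler_wpM2l ?expR_ge0// expR_ge1Dx.
    by rewrite -expRD addNr expR0.
  have q0 := expR_ge0 (- (s0 * s)).
  rewrite mulrAC; set q := expR _ in hq q0 *.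
  have h1 : C * r * q <= (e * (1 + s0 * s)) * q by rewrite ler_wpM2r//; lra.
  have h2 : e * (q * (1 + s0 * s)) <= e * 1 by rewrite ler_wpM2l// ltW.
  lra.
Unshelve. all: by end_near. Qed.

End ExponentialKL.

(** * Modes, frequencies and choice of the constants *)

Lemma indic_unstable (R : realType) (z : R) : modes R z ->
  z = 3 /\ \1_(unstable_modes R) z = 0 :> R \/
  (z = 1 \/ z = 2) /\ \1_(unstable_modes R) z = 1 :> R.
Proof.
rewrite /modes /= !inE => /or3P[] /eqP ->.
- by right; split; [left|rewrite indicE mem_set// /unstable_modes /= !inE eqxx].
- by right; split; [right|rewrite indicE mem_set// /unstable_modes /= !inE eqxx orbT].
- left; split=> //; rewrite indicE memNset// /unstable_modes /= !inE => /orP[] /eqP; lra.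
Qed.

Lemma freq_gain (R : realType) (r : nat) (kappa : R) (w : 'I_r -> rat) :
  0 < kappa -> (forall i, 0 < w i) -> (forall i j, i != j -> w i != w j) ->
  [/\ forall i, 0 < freq w i :> R,
      forall i j, (freq w i == freq w j :> R) = (i == j) &
      forall i, gain kappa w i * gain kappa w i = 2 * freq w i / kappa].
Proof.
move=> hk hw hw_neq.
have w0 i : 0 < freq w i :> R by rewrite /freq ltr0q.
split => // [i j|i].
  rewrite /freq (inj_eq (fmorph_inj (ratr : {rmorphism rat -> R}))).
  by have [->|ij] := eqVneq i j; [rewrite eqxx|apply/negbTE/hw_neq].
rewrite /gain mulrACA -expr2 sqr_sqrtr; last by rewrite mulr_ge0// ltW.
by rewrite -invfM -expr2 sqr_sqrtr// ltW.
Qed.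

Local Tactic Notation "lra_only" ne_hyp_list(Hs) := clear - Hs; lra.

Theorem proposition2 (R : realType) (n r : nat) (hr : (1 <= r)%N)
  (kappa : R) (hkappa : 0 < kappa)
  (N0 : R) (hN0 : 1 <= N0) (T0 : R) (hT0 : 0 < T0)
  (w : 'I_r -> rat) (hw : forall i, 0 < w i)
  (hw_neq : forall i j, i != j -> w i != w j)
  (T1 : R) (hT1 : 0 < T1)
  (b : 'I_r -> 'cV[R]_n -> R -> 'cV[R]_n)
  (hb_C1 : forall i, class_C1 [set p : 'cV[R]_n * R | 0 <= p.2]
                       (fun p : 'cV[R]_n * R => b i p.1 p.2))
  (hb_per : forall i x tau1, 0 <= tau1 -> b i x (tau1 + T1) = b i x tau1)
  (hP : exists lambdaP MP : R, 0 < lambdaP /\ 0 < MP /\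
          forall x v : 'cV[R]_n,
            norm2 (averaged_gain T1 b x *m v) <= MP * norm2 v /\
            lambdaP * norm2 v ^+ 2 <= (v^T *m averaged_gain T1 b x *m v) 0 0)
  (J : 'cV[R]_n -> R) (hJ_C1 : class_C1 [set: 'cV[R]_n] J)
  (mu : R) (hmu : 0 < mu) (hJ_conv : strongly_convex mu J)
  (xstar : 'cV[R]_n) (hxstar : forall x, J xstar <= J x)
  (hJ_lip : exists2 LJ : R, 0 < LJ &
              forall x x', norm2 (grad J x - grad J x') <= LJ * norm2 (x - x')) :
  forall eta1 : R, 0 < eta1 ->
    exists2 eta2_star : R, 0 < eta2_star <= 1 &
      forall eta2 : R, 0 < eta2 < eta2_star ->
        SGPAS (es_system kappa eta1 eta2 N0 T0 w b J)
              ([set xstar] `*` C_z N0 T0).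
Proof.
move=> eta1 heta1.
have [LJ hLJ hlip] := hJ_lip; have [DJ [hDJ' _]] := hJ_C1.
have hDJ x : deriv_within setT J x (DJ x) by exact: hDJ'.
have /choice[Db hDb'] := hb_C1.
have hb i p : [set p : 'cV[R]_n * R | 0 <= p.2] p -> 
    deriv_within [set p : 'cV[R]_n * R | 0 <= p.2] (fun p => b i p.1 p.2) p (Db i p).
  by move=> hp; have [h _] := hDb' i; exact: h.
have hDb i p : [set p : 'cV[R]_n * R | 0 <= p.2] p ->
    exists (U : set ('cV[R]_n * R)) (c : R), nbhs p U /\
    forall q q', U q -> [set p : 'cV[R]_n * R | 0 <= p.2] q -> U q' ->
      [set p : 'cV[R]_n * R | 0 <= p.2] q' ->
      forall v, `|Db i q v - Db i q' v| <= c * `|q - q'| * `|v|.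
  by move=> hp; have [_ h] := hDb' i; exact: h.
have hbc i : cont_within [set p : 'cV[R]_n * R | 0 <= p.2] (fun p => b i p.1 p.2).
  exact: (b_cont_within hb).
have hJc : continuous J.
  move=> x; apply/(@cvgrPdist_le _ _ _ (nbhs x)) => e e0.
  have cJ : cont_within setT J by apply: (cont_within_deriv (L := DJ)) => y _; exact: hDJ.
  have := cJ x I e e0; apply: filterS => y h.
  by rewrite distrC; exact: h.
have [lP [MP [lP0 [MP0 hPP]]]] := hP.
have [om_gt0 om_inj ha] := freq_gain hkappa hw hw_neq.
pose Q x := ((grad J x)^T *m averaged_gain T1 b x *m grad J x) 0 0.
have hQ x : exists2 Th : R -> R,
    forall s : R, 0 <= s ->
      is_derive s (1 : R) Th (\sum_(i < r) dotv (grad J x) (b i x s) ^+ 2) &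
    forall s : R, 0 <= s -> Th (s + T1) - Th s = T1 * Q x.
  exact: (averaged_gain_primitive hT1 hb_per hbc).
(* The bounds on P are combined with [polyak_lojasiewicz] for c and with [grad_sqr_le] for d. *)
pose c := lP * (mu / 4); pose d := MP * (4 * LJ).
have c0 : 0 < c by rewrite mulr_gt0// divr_gt0.
have d0 : 0 < d by rewrite mulr_gt0// mulr_gt0.
have cQ x : c * (J x - J xstar) <= Q x.
  have [_ h] := hPP x (grad J x); apply: le_trans h.
  by rewrite -mulrA ler_pM2l//; exact: (polyak_lojasiewicz hDJ hmu hJ_conv hxstar x).
have Qd x : Q x <= d * (J x - J xstar).
  have [h _] := hPP x (grad J x).
  have -> : Q x = dotv (grad J x) (averaged_gain T1 b x *m grad J x).
    by rewrite /Q -mulmxA mxE; apply: eq_bigr => i _; rewrite mxE.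
  apply: le_trans (ler_norm _) _; apply: le_trans (dotv_le_norm2 _ _) _.
  apply: le_trans (ler_wpM2l (norm2_ge0 _) h) _.
  rewrite mulrCA -expr2 -mulrA ler_pM2l//.
  exact: (grad_sqr_le hDJ hmu hJ_conv hxstar hLJ hlip x).
have cd0 : 0 < c + d by rewrite addr_gt0.
exists (Num.min 1 (c / (c + d))) => [|eta2].
  by rewrite lt_min ltr01 divr_gt0//= ge_min lexx.
rewrite lt_min => /and3P[eta20 eta21 eta2c].
(* The weight equalizes the rates: th eta2 - c in the stable mode and th (eta2 - 1) + d in an
   unstable one are both -rho. *)
pose th := c + d; pose rho := c - (c + d) * eta2.
have rho0 : 0 < rho by rewrite subr_gt0 mulrC -ltr_pdivlMr.
(* The factor 2 appears because the distance behaves like the square root of the value; 1 + eta1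
   because j <= N0 + eta1 t converts decay in t into decay in t + j. *)
pose s0 := rho / (2 * (1 + eta1)).
have e1 : 0 < 1 + eta1 by rewrite addr_gt0.
have s00 : 0 < s0 by rewrite divr_gt0// mulr_gt0.
pose X := expR (th * T0).
(* The square root comes from the quadratic bounds on J from below and above and from the weight;
   the exponential pays for the N0 initial jumps. Nothing here depends on [K] or [nu]. *)
pose G := Num.sqrt (4 / mu * (X * LJ)) * expR (s0 * N0).
exists (fun r0 s => G * expR (- (s0 * s)) * r0).
  by apply: class_KL_exp => //; rewrite mulr_ge0 ?expR_ge0// sqrtr_ge0.
move=> K nu cK nu0.
have [[M hM] _] : unif_on K (fun p (_ : R) => J p.1).
  apply: unif_on_continuous => //.
  apply: (cont_within_comp (S' := setT) (g := fst)) => //.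
    by move=> p; exact: cvg_fst.
  by apply: (cont_within_deriv (L := DJ)) => y _; exact: hDJ.
pose Kc := N0 + eta1 / rho.
have Kc0 : 0 < Kc + 1.
  by rewrite /Kc !addr_gt0// ?divr_gt0//; lra.
(* The total error dl (Kc + 1) on the value then amounts to nu^2 on the squared distance. *)
pose dl := nu ^+ 2 * (mu / 4) / (Kc + 1).
have dl0 : 0 < dl by rewrite divr_gt0// mulr_gt0 ?exprn_gt0// divr_gt0.
(* [l0] bounds the weighted value of initial states in [K]; the final 1 makes the margin strict. *)
pose l0 := X * (`|M| + `|J xstar|); pose l := l0 + dl * (Kc + 1) + 1.
have lcomp : compact [set x | J x <= J xstar + l].
  apply: (sublevel_compact (rho := 1 + 4 / mu * l) (xs := xstar)) => // x hx.
  have h1 := quadratic_growth hJ_conv hxstar x.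
  have h2 : norm2 (x - xstar) ^+ 2 <= 4 / mu * l.
    have -> : norm2 (x - xstar) ^+ 2 = 4 / mu * (mu / 4 * norm2 (x - xstar) ^+ 2).
      by field; rewrite gt_eqF.
    by rewrite ler_pM2l ?divr_gt0//; lra.
  by have := norm2_ge0 (x - xstar); nra.
have flow z : modes R z -> \forall eps \near 0^'+,
    flow_estimate (freq w) (gain kappa w) b J (mode_sign kappa z)
      (J xstar) (eta2 - \1_(unstable_modes R) z) th rho T0 eps l dl.
  move=> hz.
  have kE : mode_sign kappa z / kappa = z - 2.
    by rewrite /mode_sign mulrC mulrA mulVf ?mul1r// gt_eqF.
  have win : window_estimate (freq w) (gain kappa w) b J (mode_sign kappa z) kappa T1 Q.
    exact: (averaging_window _ om_gt0 hb hDb hDJ hLJ hlip hkappa om_inj ha hmu hJ_conv hT1 hQ).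
  have th0 : 0 <= th by exact: ltW.
  have [[z3 ind]|[z12 ind]] := indic_unstable hz; rewrite ind.
    apply: (flow_invariance (cz := c) T0 hT1 hb_per win hxstar _ rho0 th0 _ hJc lcomp dl0).
      by move=> x; rewrite kE z3; have := cQ x; lra.
    by rewrite /th /rho; lra.
  apply: (flow_invariance (cz := - d) T0 hT1 hb_per win hxstar _ rho0 th0 _ hJc lcomp dl0).
    move=> x; rewrite kE; have := Qd x; have := hxstar x; have := cQ x.
    have : 0 <= c * (J x - J xstar) by rewrite mulr_ge0 ?subr_ge0// ltW.
    have : 0 <= d * (J x - J xstar) by rewrite mulr_ge0 ?subr_ge0// ltW.
    by case: z12 => ->; lra_only hmu.
  by rewrite /th /rho; lra.
have m1 : modes R 1 by rewrite /modes /= !inE eqxx.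
have m2 : modes R 2 by rewrite /modes /= !inE eqxx !orbT.
have m3 : modes R 3 by rewrite /modes /= !inE eqxx !orbT.
have : \forall eps \near 0^'+, forall z, modes R z ->
    flow_estimate (freq w) (gain kappa w) b J (mode_sign kappa z)
      (J xstar) (eta2 - \1_(unstable_modes R) z) th rho T0 eps l dl.
  apply: filterS3 (flow 1 m1) (flow 2 m2) (flow 3 m3) => eps f1 f2 f3 z.
  by rewrite /modes /= !inE => /or3P[] /eqP ->.
move=> [rr /= rr0 hrr].
exists (rr / 2) => [|eps eps0 epsr E y hsol Ky t j Etj]; first by rewrite divr_gt0.
have hflow z : modes R z -> flow_estimate (freq w) (gain kappa w) b J (mode_sign kappa z)
      (J xstar) (eta2 - \1_(unstable_modes R) z) th rho T0 eps l dl.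
  move=> hz; have hball : ball_ Num.Def.normr (0 : R) rr eps.
    by rewrite /ball_ /= sub0r normrN gtr0_norm//; lra.
  exact: hrr hball eps0 z hz.
have [_ [_ [init _]]] := hsol.
have f0 : flow_set (es_system kappa eta1 eta2 N0 T0 w b J eps) (y 0 0%N).
  by case: init => [//|/jump_setP[]].
have [_ _ sT _] := (flow_setP _ _ _ _ _ _ _ _ _ _).1 f0.
have XU : weighted_value J (J xstar) th (y 0 0%N) <= X * (J (pos (y 0 0%N)) - J xstar).
  rewrite /weighted_value ler_wpM2r ?subr_ge0// ler_expR.
  by rewrite ler_wpM2l ?(ltW cd0)//; case/andP: sT.
have hinit : weighted_value J (J xstar) th (y 0 0%N) <= l0.
  apply: le_trans XU _; rewrite ler_wpM2l ?expR_ge0//.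
  have := hM _ Ky 0; have := ler_norm M; have := ler_norm (- J xstar); rewrite normrN.
  by rewrite ler_norml /pos => a1 a2 /andP[_ a3]; lra_only a1 a2 a3.
have hl : l0 + dl * (Kc + 1) < l by rewrite /l ltrDl.
have [ft Ut jt] := hybrid_decay hbc hJc hxstar eps0 heta1 rho0 dl0 hflow erefl hl hsol hinit Etj.
have [zm zj zs _] := (flow_setP _ _ _ _ _ _ _ _ _ _).1 ft.
have hz : C_z N0 T0 (y t j).1.2.
  move: zm zj zs; rewrite /mode /jump_timer /spoof_timer.
  by case: (y t j) => [[x [[z1 z2] z3]] tau] /= ? ? ?; split; [split|]; rewrite //= in_itv.
have hz0 : C_z N0 T0 !=set0 by exists (y t j).1.2.
set Dt := norm2 (pos (y t j) - xstar); set D0 := norm2 (pos (y 0 0%N) - xstar).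
have h1 : theta_dist ([set xstar] `*` C_z N0 T0) (y t j).1 <= Dt.
  by rewrite [(y t j).1]surjective_pairing; exact: theta_dist_le.
have h2 : D0 <= theta_dist ([set xstar] `*` C_z N0 T0) (y 0 0%N).1.
  exact: theta_dist_ge.
have D00 : 0 <= D0 by exact: norm2_ge0.
have Dt0 : 0 <= Dt by exact: norm2_ge0.
pose q := expR (- (rho * t / 2)).
have q0 : 0 <= q by exact: expR_ge0.
have qq : q ^+ 2 = expR (- (rho * t)).
  by rewrite expr2 -expRD; congr expR; field.
have hDt : Dt ^+ 2 <= 4 / mu * (X * LJ) * q ^+ 2 * D0 ^+ 2 + nu ^+ 2.
  have g1 := quadratic_growth hJ_conv hxstar (pos (y t j)).
  have g2 : J (pos (y t j)) - J xstar <= weighted_value J (J xstar) th (y t j).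
    rewrite -[leLHS]mul1r ler_wpM2r ?subr_ge0// -expR0 ler_expR mulr_ge0 ?(ltW cd0)//.
    by case/andP: zs.
  have g3 := value_le_sqr hDJ hmu hJ_conv hxstar hLJ hlip (pos (y 0 0%N)).
  have g4 : weighted_value J (J xstar) th (y 0 0%N) <= X * (LJ * D0 ^+ 2).
    by apply: le_trans XU _; rewrite ler_wpM2l// expR_ge0.
  have g5 : q ^+ 2 * weighted_value J (J xstar) th (y 0 0%N) <= q ^+ 2 * (X * (LJ * D0 ^+ 2)).
    by rewrite ler_wpM2l// sqr_ge0.
  have g6 : dl * (Kc + 1) = nu ^+ 2 * (mu / 4) by rewrite /dl divfK// gt_eqF.
  rewrite -qq g6 in Ut.
  have m40 : 0 < mu / 4 by rewrite divr_gt0.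
  rewrite -(ler_pM2l m40).
  have -> : mu / 4 * (4 / mu * (X * LJ) * q ^+ 2 * D0 ^+ 2 + nu ^+ 2) =
     q ^+ 2 * (X * (LJ * D0 ^+ 2)) + nu ^+ 2 * (mu / 4) by field; rewrite gt_eqF.
  rewrite -/Dt in g1; lra_only g1 g2 g5 Ut.
pose sq := Num.sqrt (4 / mu * (X * LJ)).
have sq0 : 0 <= sq by exact: sqrtr_ge0.
have sqE : sq ^+ 2 = 4 / mu * (X * LJ).
  rewrite sqr_sqrtr// mulr_ge0 ?divr_ge0 ?(ltW hmu)// mulr_ge0 ?expR_ge0//.
  exact: ltW.
have a0 : 0 <= sq * q * D0 by rewrite !mulr_ge0.
(* The square root of a sum of two squares is at most the sum of their roots. *)
have hDta : Dt <= sq * q * D0 + nu.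
  rewrite -ler_sqr ?nnegrE ?addr_ge0 ?(ltW nu0)//.
  apply: le_trans hDt _; rewrite -sqE -!exprMn sqrrD.
  have : 0 <= sq * q * D0 * nu by rewrite mulr_ge0// ltW.
  by rewrite mulr2n; lra_only hmu.
have hq : q <= expR (s0 * N0) * expR (- (s0 * (t + j%:R))).
  rewrite -expRD ler_expR.
  have : s0 * j%:R <= s0 * (N0 + eta1 * t) by rewrite ler_pM2l.
  have : rho * t / 2 = s0 * ((1 + eta1) * t).
    by rewrite /s0; field; rewrite gt_eqF.
  lra_only hmu.
have hb1 : sq * q * D0 <= G * expR (- (s0 * (t + j%:R))) * D0.
  by rewrite ler_wpM2r// /G -/sq -mulrA ler_wpM2l.
have hb2 : G * expR (- (s0 * (t + j%:R))) * D0 <= G * expR (- (s0 * (t + j%:R))) *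
    theta_dist ([set xstar] `*` C_z N0 T0) (y 0 0%N).1.
  by rewrite ler_wpM2l// mulr_ge0 ?expR_ge0// mulr_ge0 ?expR_ge0.
lra_only h1 hb1 hb2 hDta.
Qed.
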